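(* Let $W$ be a multigraphon with $0<\rho(W)<+\infty$. For every $n\in\mathbb{N}$ let $\mathbf{X}_n=(X_n(i,j))_{i,j=1}^n$ be an $\mathcal{A}_n$-valued edge stationary random variable. Suppose that $\mathbf{X}_n \xrightarrow{\ p\ } W$ and that $$\lim_{m\to\infty}\ \sup_{n\in\mathbb{N},\, n\ge 2}\ \frac{1}{\binom{n}{2}}\sum_{1\le i<j\le n}\mathbf{E}\big(X_n(i,j)\cdot \mathbf{1}[X_n(i,j)\ge m]\big)=0,$$ $$\lim_{m\to\infty}\ \sup_{n\in\mathbb{N}}\ \frac1n\sum_{i=1}^n \mathbf{E}\big(X_n(i,i)\cdot \mathbf{1}[X_n(i,i)\ge m]\big)=0.$$ Then $\hat W\cong W$, where $\hat W$ is the multigraphon defined (for $x,y\in(0,1)$, $k\in\mathbb{N}_0$) by $$\hat W(x,y,k)=\begin{cases}\mathbf{p}\Big(k,\dfrac{F_W^{-1}(x)F_W^{-1}(y)}{\rho(W)}\Big) & \text{if } x\neq y,\\[2mm] \mathbf{1}[\,2\mid k\,]\cdot \mathbf{p}\Big(\dfrac k2,\dfrac{F_W^{-1}(x)F_W^{-1}(y)}{2\rho(W)}\Big) & \text{if } x=y.\end{cases}$$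
   Context: $\mathbb{N}_0=\{0,1,2,\dots\}$, $[n]=\{1,\dots,n\}$. $\mathbf{1}[\cdot]$ denotes an indicator. Adjacency matrices: $\mathcal{A}_n$ is the set of symmetric matrices $B\in\mathbb{N}_0^{n\times n}$ with $B(i,i)$ even for all $i\in[n]$ (adjacency matrices of labeled multigraphs on $[n]$ with parallel and loop edges allowed; $B(i,i)$ is twice the number of loops at $i$). The degree is $d(B,i)=\sum_{j=1}^n B(i,j)$. Edge stationarity: for a sequence $(d_i)_{i=1}^n$ of nonnegative integers with even sum, the configuration model is the random multigraph obtained by placing $d_i$ stubs (half-edges) at vertex $i$ and choosing uniformly at random a perfect matching of all the stubs, each matched pair of stubs forming an edge. A random element $\mathbf{X}_n$ of $\mathcal{A}_n$ is edge stationary if, conditionally on its degree sequence $(d(\mathbf{X}_n,i))_{i=1}^n$, it is distributed as the adjacency matrix of the configuration model with that degree sequence. Homomorphism densities: for $A\in\mathcal{A}_k$ and $B\in\mathcal{A}_n$, $$t_=(A,B)=\frac1{n^k}\sum_{\varphi:[k]\to[n]}\mathbf{1}\big[\forall i,j\in[k]:\ A(i,j)=B(\varphi(i),\varphi(j))\big].$$ Multigraphons: a multigraphon is a (Borel) measurable function $W:[0,1]\times[0,1]\times\mathbb{N}_0\to[0,1]$ with $W(x,y,k)=W(y,x,k)$, $\sum_{k=0}^\infty W(x,y,k)=1$ and $W(x,x,2k+1)=0$ for all $x,y,k$. For $A\in\mathcal{A}_k$, $$t_=(A,W)=\int_{[0,1]^k}\prod_{1\le i\le j\le k}W(x_i,x_j,A(i,j))\,dx_1\cdots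 dx_k.$$ $W_1\cong W_2$ means $t_=(A,W_1)=t_=(A,W_2)$ for all $k$ and all $A\in\mathcal{A}_k$. (The values of a multigraphon at coordinates $x,y\in\{0,1\}$ do not matter for $t_=$.) Convergence: for random elements $\mathbf{X}_n$ of $\mathcal{A}_n$, $\mathbf{X}_n\xrightarrow{\ p\ }W$ means that for every $k\in\mathbb{N}$ and $A\in\mathcal{A}_k$, $t_=(A,\mathbf{X}_n)\to t_=(A,W)$ in probability as $n\to\infty$. Degrees of a multigraphon: $D(W,x)=\int_0^1\sum_{k=0}^\infty k\,W(x,y,k)\,dy$; $\rho(W)=\int_0^1 D(W,x)\,dx$; $F_W(z)=\int_0^1\mathbf{1}[D(W,x)\le z]\,dx$ for $z\ge0$; $F_W^{-1}(u)=\min\{z\ge 0:F_W(z)\ge u\}$ for $u\in(0,1)$. Poisson weights: $\mathbf{p}(k,\lambda)=e^{-\lambda}\lambda^k/k!$, with $\mathbf{p}(0,0)=1$. *)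

(* Defs.v *)
From HB Require Import structures.
From mathcomp Require Import all_boot all_order all_algebra.
From mathcomp Require Import all_classical all_reals all_analysis.

Set Implicit Arguments.
Unset Strict Implicit.
Unset Printing Implicit Defensive.

Import Order.TTheory GRing.Theory Num.Theory.
Import numFieldNormedType.Exports.

Local Open Scope ring_scope.

Definition adjmx (n : nat) (B : 'M[nat]_n) : Prop :=
  (forall i j, B i j = B j i) /\ (forall i, ~~ odd (B i i)).

Definition degseq (n : nat) (B : 'M[nat]_n) : {ffun 'I_n -> nat} :=
  [ffun i => (\sum_(j < n) B i j)%N].

(* [Tagged _ s] with [s : 'I_(d i)] is the [s]-th half-edge at the vertex [i]. *)
Definition stub (n : nat) (d : {ffun 'I_n -> nat}) : finType :=
  {i : 'I_n & 'I_(d i)}.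

Definition perfect_matchings (n : nat) (d : {ffun 'I_n -> nat}) :
    {set {set {set stub d}}} :=
  [set M : {set {set stub d}} |
     finset.partition M [set: stub d] && [forall e in M, #|e| == 2%N]]%SET.

Definition edges_between (n : nat) (d : {ffun 'I_n -> nat})
    (M : {set {set stub d}}) (i j : 'I_n) : {set {set stub d}} :=
  [set e in M | [set tag s | s in e] == [set i; j]]%SET.

(* A loop contributes 2 to its diagonal entry. *)
Definition matching_adjmx (n : nat) (d : {ffun 'I_n -> nat})
    (M : {set {set stub d}}) : 'M[nat]_n :=
  \matrix_(i, j) ((if i == j then 2 else 1) * #|edges_between M i j|)%N.

Definition config_model (R : realType) (n : nat) (d : {ffun 'I_n -> nat})
    (B : 'M[nat]_n) : R :=
  #|[set M in perfect_matchings d | matching_adjmx M == B]%SET|%:R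
  / #|perfect_matchings d|%:R.

Definition hom_density (R : realType) (k n : nat)
    (A : 'M[nat]_k) (B : 'M[nat]_n) : R :=
  (\sum_(phi : {ffun 'I_k -> 'I_n})
     [forall i, forall j, A i j == B (phi i) (phi j)]%:R) / n%:R ^+ k.

(* This differs from the library's [poisson_pmf] at rate 0, where the latter is
   1 for all [k]; here the weights at rate 0 are those of the point mass at 0. *)
Definition poisson_weight (R : realType) (k : nat) (l : R) : R :=
  expR (- l) * l ^+ k / k`!%:R.

Local Open Scope classical_set_scope.

(* The codomain being countable, measurability is measurability of the fibres. *)
Definition random_adjmx (d : measure_display) (T : measurableType d) (n : nat)
    (X : T -> 'M[nat]_n) : Prop :=
  (forall w, adjmx (X w)) /\ (forall B, measurable (X @^-1` [set B])).

Definition edge_stationary (R : realType) (d : measure_display)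
    (T : measurableType d) (P : probability T R) (n : nat)
    (X : T -> 'M[nat]_n) : Prop :=
  forall D : {ffun 'I_n -> nat}, P [set w | degseq (X w) = D] != 0%E ->
  forall B : 'M[nat]_n,
    fine (P ([set w | X w = B] `&` [set w | degseq (X w) = D]))
      / fine (P [set w | degseq (X w) = D]) = config_model R D B.

(* Only the values of [W x y] for [x, y] in [0, 1] are relevant. *)
Definition multigraphon (R : realType) (W : R -> R -> nat -> R) : Prop :=
  [/\ measurable_fun (`[0 : R, 1] `*` `[0 : R, 1] `*` [set: nat])
        (fun p : R * R * nat => W p.1.1 p.1.2 p.2),
      forall x y k, `[0, 1] x -> `[0, 1] y -> 0 <= W x y k <= 1,
      forall x y k, `[0, 1] x -> `[0, 1] y -> W x y k = W y x k,
      forall x y, `[0, 1] x -> `[0, 1] y ->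
        (\sum_(0 <= k <oo) (W x y k)%:E = 1)%E
    & forall x k, `[0, 1] x -> W x x (2 * k + 1)%N = 0].

(* Integral over [0, 1]^k, as an iterated integral; it is only applied to
   nonnegative measurable integrands. *)
Fixpoint cube_integral (R : realType) (k : nat) :
    (k.-tuple R -> \bar R) -> \bar R :=
  match k with
  | 0 => fun f => f [tuple]
  | k'.+1 => fun f =>
      (\int[lebesgue_measure]_(x in `[0%R, 1%R])
         cube_integral (fun t : k'.-tuple R => f [tuple of x :: t]))%E
  end.

Definition graphon_density (R : realType) (k : nat) (A : 'M[nat]_k)
    (W : R -> R -> nat -> R) : R :=
  fine (cube_integral (fun x : k.-tuple R =>
    (\prod_(i < k) \prod_(j < k | (i <= j)%N)
       W (tnth x i) (tnth x j) (A i j))%:E)).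

Definition graphon_equiv (R : realType) (W1 W2 : R -> R -> nat -> R) : Prop :=
  forall (k : nat) (A : 'M[nat]_k), (0 < k)%N -> adjmx A ->
    graphon_density A W1 = graphon_density A W2.

Definition cvg_in_probability (R : realType) (d : nat -> measure_display)
    (T : forall n, measurableType (d n)) (P : forall n, probability (T n) R)
    (X : forall n, T n -> 'M[nat]_n) (W : R -> R -> nat -> R) : Prop :=
  forall (k : nat) (A : 'M[nat]_k), (0 < k)%N -> adjmx A ->
  forall eps : R, 0 < eps ->
    P n [set w | eps <= `|hom_density R A (X n w) - graphon_density A W|]
      @[n --> \oo] --> 0%E.

Definition graphon_degree (R : realType) (W : R -> R -> nat -> R) (x : R) :
    \bar R :=
  (\int[lebesgue_measure]_(y in `[0%R, 1%R])
     \sum_(0 <= k <oo) (k%:R * W x y k)%:E)%E.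

Definition edge_density (R : realType) (W : R -> R -> nat -> R) : \bar R :=
  (\int[lebesgue_measure]_(x in `[0%R, 1%R]) graphon_degree W x)%E.

Definition degree_cdf (R : realType) (W : R -> R -> nat -> R) (z : R) : R :=
  \int[lebesgue_measure]_(x in `[0%R, 1%R])
     \1_[set t | (graphon_degree W t <= z%:E)%E] x.

(* The least element of [A] if there is one, and 0 otherwise. *)
Definition set_min (R : realType) (A : set R) : R :=
  xget 0 [set z | A z /\ lbound A z].

Definition degree_quantile (R : realType) (W : R -> R -> nat -> R) (u : R) : R :=
  set_min [set z | 0 <= z /\ u <= degree_cdf W z].

(* The formula is meant for [x, y] in the open interval (0, 1); at the endpoints
   it uses the value 0 that [set_min] gives to a nonexistent minimum. *)
Definition hat_graphon (R : realType) (W : R -> R -> nat -> R)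
    (x y : R) (k : nat) : R :=
  let qq := degree_quantile W x * degree_quantile W y in
  let rho := fine (edge_density W) in
  if x != y then poisson_weight k (qq / rho)
  else (2 %| k)%N%:R * poisson_weight (k %/ 2)%N (qq / (2 * rho)).

(* Main.v *)
(* Switching two edges {a, b}, {c, e} of a configuration-model matching into
   {a, c}, {b, e} is a bijection of matchings, so edge stationarity relates the
   probabilities of the two adjacency matrices. Sampling vertices and letting n
   tend to infinity gives, for a pattern A and vertices i, j, l, m with l, m
   distinct from each other and from i, j,
     A'(i,j) A'(l,m) t(A', W) = A''(i,l) A''(j,m) t(A'', W),
   where A' = A + ij + lm and A'' = A + il + jm. Take l, m, and further vertices
   y_1, ..., y_r joined to some x_a, to be new, and sum over the multiplicities
   of their edges: with D the degree function of W and w a word in the D(x_a),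
     E[q_A D(x_i) D(x_j) w] = (A + ij)(i,j) rho E[q_(A + ij) w],
   where q_A = q_A(x) is the conditional probability of the pattern A. As D need
   not have moments, this is first obtained for words in truncated degrees. Let
   L(x) be the sum of D(x_i) D(x_j) / rho over i < j and of D(x_i)^2 / (2 rho)
   over i. Expanding exp(- c L) in words shows, by induction on A, that
     E[q_A w exp(- c L)] = E[q_0 p_A w exp(- c L)],
   with p_A the product of Poisson weights deprived of their factor exp(- L).
   Summing over A gives E[w exp(- c L)] = E[q_0 w exp(L) exp(- c L)], hence
     E[q_A exp(- c L)] = E[p_A exp(- L) exp(- c L)],
   and c -> 0 yields t(A, W) = E[p_A exp(- L)]. The right-hand side depends only
   on the law of D under the uniform measure, which is also the law of the
   quantile function F_W^-1, and so equals t(A, \hat W). *)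

Require Import Defs.
From HB Require Import structures.
From mathcomp Require Import all_boot all_order all_algebra.
From mathcomp Require Import all_classical all_reals all_analysis.
From mathcomp Require Import fingroup perm measurable_realfun.
From mathcomp Require Import ring lra zify.

Set Implicit Arguments.
Unset Strict Implicit.
Unset Printing Implicit Defensive.
Import Order.TTheory GRing.Theory Num.Theory.
Import numFieldNormedType.Exports.
Local Open Scope classical_set_scope.
Local Open Scope ring_scope.

(** * Expectation of bounded random variables *)

(** Degrees may lack a second moment, so the factor D(x_i) D(x_j) cannot be inserted freely.
    Multiplicities are therefore summed only up to N. The pairs summed out then contribute truncated
    masses instead of 1. These tend to 1 at no known rate, and differently on the two sides, while
    all other factors increase with N. Monotonicity alone is enough to compare the two limits, and
    the integrability of q_A D(x_i) D(x_j) comes out of the finiteness of rho. The loops put the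
    squares D(x_i)^2 / (2 rho) into L, so that exp(- c L) makes every word in the degrees bounded as
    soon as c > 0. The exponential series itself is expanded for truncated degrees, which are
    bounded, and the truncation is removed afterwards under this uniform bound. Edges and loops go
    through the same induction: a diagonal entry counts ordered pairs of matched stubs, hence each
    loop twice, and the factor A(i,i) + 2 absorbs the halved rate of the loops. Sums over
    multiplicities also meet matrices with an odd diagonal entry, for which both sides vanish. *)

Section Expectation.
Context (d : measure_display) (T : measurableType d) (R : realType).
Variable P : probability T R.
Implicit Types f g : T -> R.

Definition bdm f := measurable_fun setT f /\ exists C : R, forall x, `|f x| <= C.

Definition Ex f : R := Rintegral P setT f.

Lemma bdm_integrable f : bdm f -> P.-integrable setT (EFin \o f).
Proof.
move=> [mf [C fC]]; apply: measurable_bounded_integrable => //.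
  exact: (le_lt_trans (probability_le1 P measurableT) (ltry _)).
exists C; split; first exact: num_real.
by move=> M CM x _ /=; rewrite (le_trans (fC x)) // ltW.
Qed.

Lemma bdm_cst (c : R) : bdm (fun=> c).
Proof. by split; [exact: measurable_cst | exists `|c|]. Qed.

Lemma bdmD f g : bdm f -> bdm g -> bdm (fun x => f x + g x).
Proof.
move=> [mf [C fC]] [mg [D gD]]; split; first exact: measurable_funD.
by exists (C + D) => x; rewrite (le_trans (ler_normD _ _)) // lerD.
Qed.

Lemma bdmM f g : bdm f -> bdm g -> bdm (fun x => f x * g x).
Proof.
move=> [mf [C fC]] [mg [D gD]]; split; first exact: measurable_funM.
by exists (C * D) => x; rewrite normrM ler_pM.
Qed.

Lemma bdm_norm f : bdm f -> bdm (fun x => `|f x|).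
Proof.
move=> [mf [C fC]]; split; last by exists C => x; rewrite normr_id.
by apply: measurableT_comp => //; exact: normr_measurable.
Qed.

Lemma bdm_sum (I : Type) (r : seq I) (Q : pred I) (F : I -> T -> R) :
  (forall i, Q i -> bdm (F i)) -> bdm (fun x => \sum_(i <- r | Q i) F i x).
Proof.
move=> bF; elim: r => [|i r IH].
  by under eq_fun do rewrite big_nil; exact: bdm_cst.
under eq_fun do rewrite big_cons.
by case: (boolP (Q i)) => Qi //; apply: bdmD => //; exact: bF.
Qed.

Lemma bdm_prod (I : Type) (r : seq I) (Q : pred I) (F : I -> T -> R) :
  (forall i, Q i -> bdm (F i)) -> bdm (fun x => \prod_(i <- r | Q i) F i x).
Proof.
move=> bF; elim: r => [|i r IH].
  by under eq_fun do rewrite big_nil; exact: bdm_cst.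
under eq_fun do rewrite big_cons.
by case: (boolP (Q i)) => Qi //; apply: bdmM => //; exact: bF.
Qed.

Lemma eq_Ex f g : f =1 g -> Ex f = Ex g.
Proof. by move=> fg; apply: eq_Rintegral => x _; exact: fg. Qed.

Lemma ExD f g : P.-integrable setT (EFin \o f) -> P.-integrable setT (EFin \o g) ->
  Ex (fun x => f x + g x) = Ex f + Ex g.
Proof. by move=> *; exact: RintegralD. Qed.

Lemma ExB f g : P.-integrable setT (EFin \o f) -> P.-integrable setT (EFin \o g) ->
  Ex (fun x => f x - g x) = Ex f - Ex g.
Proof. by move=> *; exact: RintegralB. Qed.

Lemma ExZl f c : P.-integrable setT (EFin \o f) ->
  Ex (fun x => c * f x) = c * Ex f.
Proof. by move=> *; exact: RintegralZl. Qed.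

Lemma Ex_cst c : Ex (fun=> c) = c.
Proof.
rewrite /Ex Rintegral_cst// -[RHS]mulr1; congr (_ * _).
exact: (congr1 fine (probability_setT P)).
Qed.

Lemma Ex_ge0 f : (forall x, 0 <= f x) -> 0 <= Ex f.
Proof. by move=> f0; apply: Rintegral_ge0 => x _; exact: f0. Qed.

Lemma le_Ex f g : P.-integrable setT (EFin \o f) ->
  P.-integrable setT (EFin \o g) ->
  (forall x, f x <= g x) -> Ex f <= Ex g.
Proof. by move=> intf intg fg; apply: le_Rintegral => // x _; exact: fg. Qed.

Lemma Ex_bound f C : bdm f -> (forall x, `|f x| <= C) -> `|Ex f| <= C.
Proof.
move=> bf fC; apply: le_trans (le_normr_Rintegral _ _) _ => //.
  exact: bdm_integrable.
rewrite -[leRHS]Ex_cst; apply: le_Ex; last by move=> x; exact: fC.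
  exact/bdm_integrable/bdm_norm.
exact/bdm_integrable/bdm_cst.
Qed.

Lemma integrable_sum_real (I : Type) (r : seq I) (Q : pred I) (F : I -> T -> R) :
  (forall i, Q i -> P.-integrable setT (EFin \o F i)) ->
  P.-integrable setT (EFin \o (fun x => \sum_(i <- r | Q i) F i x)).
Proof.
move=> iF; elim: r => [|i r IH].
  under eq_fun do rewrite big_nil.
  exact/bdm_integrable/bdm_cst.
under eq_fun do rewrite big_cons.
case: (boolP (Q i)) => Qi //.
have := integrableD measurableT (iF i Qi) IH.
by apply: eq_integrable => // x _.
Qed.

Lemma Ex_sum (I : Type) (r : seq I) (Q : pred I) (F : I -> T -> R) :
  (forall i, Q i -> P.-integrable setT (EFin \o F i)) ->
  Ex (fun x => \sum_(i <- r | Q i) F i x) = \sum_(i <- r | Q i) Ex (F i).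
Proof.
move=> iF; elim: r => [|i r IH].
  by rewrite big_nil -[RHS]Ex_cst; apply: eq_Ex => x; rewrite big_nil.
rewrite big_cons -IH; case: (boolP (Q i)) => Qi.
  rewrite -ExD; [|exact: iF|exact: integrable_sum_real].
  by apply: eq_Ex => x; rewrite big_cons Qi.
by apply: eq_Ex => x; rewrite big_cons (negbTE Qi).
Qed.

Lemma integrableM_bdm f g : P.-integrable setT (EFin \o f) -> bdm g ->
  P.-integrable setT (EFin \o (fun x => f x * g x)).
Proof.
move=> /[dup] intf /integrableP[/measurable_EFinP mf _] [mg [C gC]].
apply: (@le_integrable _ _ _ _ _ measurableT _ (EFin \o (fun x => C * `|f x|))) => //.
- exact/measurable_EFinP/measurable_funM.
- move=> x _; rewrite /= lee_fin normrM mulrC.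
  by rewrite (le_trans _ (ler_norm _))// ler_wpM2r.
- have := integrableZl measurableT C (integrable_abse intf).
  by apply: eq_integrable => // x _.
Qed.

Lemma Ex_dct (F : nat -> T -> R) f g :
  (forall n, measurable_fun setT (F n)) ->
  P.-integrable setT (EFin \o g) ->
  (forall n x, `|F n x| <= g x) ->
  (forall x, F n x @[n --> \oo] --> f x) ->
  Ex (F n) @[n --> \oo] --> Ex f.
Proof.
move=> mF intg Fg Ff.
have mf : measurable_fun setT f by apply: (measurable_fun_cvg mF).
have mF' n : measurable_fun setT (EFin \o F n) by exact/measurable_EFinP.
have mf' : measurable_fun setT (EFin \o f) by exact/measurable_EFinP.
have Ff' : {ae P, forall x, setT x -> (EFin (F n x)) @[n --> \oo] --> (EFin \o f) x}.
  apply: aeW => x _; apply: cvg_EFin; last exact: Ff.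
  by apply: nearW.
have Fg' : {ae P, forall x n, setT x -> (`|(EFin \o F n) x| <= (EFin \o g) x)%E}.
  by apply: aeW => x n _; rewrite /= lee_fin.
have [intf _ h] := dominated_convergence measurableT mF' mf' Ff' intg Fg'.
apply: fine_cvg; rewrite fineK //.
exact: integrable_fin_num.
Qed.

Lemma Ex_bct (F : nat -> T -> R) f (C : R) :
  (forall n, measurable_fun setT (F n)) ->
  (forall n x, `|F n x| <= C) ->
  (forall x, F n x @[n --> \oo] --> f x) ->
  Ex (F n) @[n --> \oo] --> Ex f.
Proof.
move=> mF FC Ff; apply: (Ex_dct mF _ FC Ff).
exact/bdm_integrable/bdm_cst.
Qed.

(** Integrability of the limit is a conclusion here: this is how products of untruncated degrees
    become integrable without a moment assumption. *)
Lemma Ex_mct (F : nat -> T -> R) f (l : R) :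
  (forall n, bdm (F n)) -> (forall n x, 0 <= F n x) ->
  (forall x, nondecreasing_seq (fun n => F n x)) ->
  (forall x, F n x @[n --> \oo] --> f x) ->
  Ex (F n) @[n --> \oo] --> l ->
  P.-integrable setT (EFin \o f) /\ Ex f = l.
Proof.
move=> bF F0 ndF Ff El.
have mf : measurable_fun setT f.
  by apply: (@measurable_fun_cvg _ _ _ _ F) => // n; case: (bF n).
have f0 x : 0 <= f x.
  by rewrite -(cvg_lim _ (Ff x))//; apply: limr_ge; [exact: cvgP (Ff x)|apply: nearW].
have H : (\int[P]_x (F n x)%:E @[n --> \oo] --> \int[P]_x (f x)%:E)%E.
  rewrite (_ : (\int[P]_x (f x)%:E)%E =
    (\int[P]_x limn (fun n => (F n x)%:E))%E); last first.
    apply: eq_integral => x _; apply/esym/cvg_lim => //.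
    by apply: cvg_EFin; [exact: nearW|exact: Ff].
  apply: cvg_monotone_convergence => //.
  - by move=> n; apply/measurable_EFinP; case: (bF n).
  - by move=> n x _; rewrite lee_fin.
  - by move=> x _ m n mn; rewrite lee_fin; exact: ndF.
have H2 : (\int[P]_x (F n x)%:E @[n --> \oo] --> l%:E)%E.
  have -> : (fun n => \int[P]_x (F n x)%:E)%E = EFin \o (fun n => Ex (F n)).
    apply/funext => n /=; rewrite /Ex /Rintegral fineK//.
    exact/integrable_fin_num/bdm_integrable.
  by apply: cvg_EFin => //; exact: nearW.
have e : (\int[P]_x (f x)%:E)%E = l%:E by apply: (cvg_unique _ H H2).
split; last by rewrite /Ex /Rintegral e.
apply/integrableP; split; first exact/measurable_EFinP.
under eq_integral do rewrite /= ger0_norm//.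
by rewrite e ltry.
Qed.

(* The cut-offs [c], [c'] increase to 1, possibly more slowly than [L], [L'] grow. *)
Lemma Ex_cutoff_limit (L L' c c' : nat -> T -> R) (l : R) (N0 : nat) :
  (forall n, bdm (L n)) -> (forall n, bdm (L' n)) ->
  (forall n, bdm (c n)) -> (forall n, bdm (c' n)) ->
  (forall n x, 0 <= L n x) -> (forall n x, 0 <= L' n x) ->
  (forall n x, 0 <= c n x <= 1) -> (forall n x, 0 <= c' n x <= 1) ->
  (forall x, nondecreasing_seq (fun n => L n x)) ->
  (forall x, nondecreasing_seq (fun n => L' n x)) ->
  (forall x, c n x @[n --> \oo] --> (1 : R)) -> (forall x, c' n x @[n --> \oo] --> (1 : R)) ->
  (forall n, (N0 <= n)%N ->
    Ex (fun x => L n x * c n x) = Ex (fun x => L' n x * c' n x)) ->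
  Ex (L n) @[n --> \oo] --> l -> Ex (L' n) @[n --> \oo] --> l.
Proof.
move=> bL bL' bc bc' L0 L'0 c01 c'01 ndL ndL' c1 c'1 e Ll.
have lim (G h : nat -> T -> R) m : bdm (G m) -> (forall n, bdm (h n)) ->
    (forall n x, 0 <= h n x <= 1) -> (forall x, h n x @[n --> \oo] --> (1 : R)) ->
    Ex (fun x => G m x * h n x) @[n --> \oo] --> Ex (G m).
  move=> bG bh h01 h1; case: (bG) => mG [C GC].
  apply: (@Ex_bct _ _ C).
  - by move=> n; case: (bdmM bG (bh n)).
  - move=> n x; have /andP[h0 h2] := h01 n x.
    rewrite normrM (ger0_norm h0) -[leRHS]mulr1.
    by apply: ler_pM => //; exact: GC.
  - move=> x; rewrite -[X in _ --> X]mulr1; apply: cvgM => //; exact: cvg_cst.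
have le1 (G h : nat -> T -> R) m n : (forall n, bdm (G n)) -> (forall n, bdm (h n)) ->
    (forall n x, 0 <= G n x) -> (forall n x, 0 <= h n x <= 1) ->
    (forall x, nondecreasing_seq (fun n => G n x)) -> (m <= n)%N ->
    Ex (fun x => G m x * h n x) <= Ex (fun x => G n x * h n x) <= Ex (G n).
  move=> bG bh G0 h01 ndG mn; apply/andP; split; apply: le_Ex;
    try by apply: bdm_integrable => //; exact: bdmM.
    by move=> x; apply: ler_wpM2r; [case/andP: (h01 n x)|exact: ndG].
  move=> x; rewrite -[leRHS]mulr1; apply: ler_wpM2l => //.
  by case/andP: (h01 n x).
have ndE (G : nat -> T -> R) : (forall n, bdm (G n)) ->
    (forall x, nondecreasing_seq (fun n => G n x)) ->
    nondecreasing_seq (fun n => Ex (G n)).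
  move=> bG ndG m n mn; apply: le_Ex; try exact: bdm_integrable.
  by move=> x; exact: ndG.
(* For fixed [m] and large [n], the mean of [L' m * c' n] is at most that of [L' n * c' n], which
   equals that of [L n * c n] and so is at most the mean of [L n]. Then [n] tends to infinity. *)
have ub m : Ex (L' m) <= l.
  apply: (@ler_cvg_to _ \oo _ _ (fun n => Ex (fun x => L' m x * c' n x)) (fun n => Ex (L n))) => //.
    exact: lim.
  near=> n.
  have mn : (m <= n)%N by near: n; exact: nbhs_infty_ge.
  have Nn : (N0 <= n)%N by near: n; exact: nbhs_infty_ge.
  have /andP[h1 _] := le1 _ _ _ _ bL' bc' L'0 c'01 ndL' mn.
  apply: (le_trans h1); rewrite -e//.
  by have /andP[_] := le1 _ _ _ _ bL bc L0 c01 ndL (leqnn n).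
have cL' : cvgn (fun n => Ex (L' n)).
  apply: nondecreasing_is_cvgn; first exact: ndE.
  by exists l => _ [n _ <-].
suff -> : l = limn (fun n => Ex (L' n)) by exact: cL'.
apply/eqP; rewrite eq_le; apply/andP; split; last first.
  by apply: limr_le => //; apply: nearW.
apply: (@ler_cvg_to _ \oo _ _ (fun n => Ex (L n)) (fun n => limn (fun n => Ex (L' n)))) => //.
  exact: cvg_cst.
(* The same comparison with the two sides exchanged, now against the limit of the means of [L']. *)
apply: nearW => m.
apply: (@ler_cvg_to _ \oo _ _ (fun n => Ex (fun x => L m x * c n x)) (fun n => Ex (L' n))) => //.
  exact: lim.
near=> n.
have mn : (m <= n)%N by near: n; exact: nbhs_infty_ge.
have Nn : (N0 <= n)%N by near: n; exact: nbhs_infty_ge.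
have /andP[h1 _] := le1 _ _ _ _ bL bc L0 c01 ndL mn.
apply: (le_trans h1); rewrite e//.
by have /andP[_] := le1 _ _ _ _ bL' bc' L'0 c'01 ndL' (leqnn n).
Unshelve. all: by end_near. Qed.

End Expectation.

Lemma Ex_distribution (d d' : measure_display) (T : measurableType d)
  (T' : measurableType d') (R : realType) (P : probability T R)
  (X : {RV P >-> T'}) (f : T' -> R) : bdm f ->
  Ex (distribution P X) f = Ex P (f \o X).
Proof.
move=> [mf [C fC]]; rewrite /Ex /Rintegral integral_distribution//.
- exact/measurable_EFinP.
- apply: bdm_integrable; split; first exact: measurableT_comp.
  by exists C => x; exact: fC.
Qed.

Lemma bdm_comp (d d' : measure_display) (T : measurableType d)
  (T' : measurableType d') (R : realType) (f : T' -> R) (g : T -> T') :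
  bdm f -> measurable_fun setT g -> bdm (f \o g).
Proof.
move=> [mf [C fC]] mg; split; first exact: measurableT_comp.
by exists C => x; exact: fC.
Qed.

Section FubiniBounded.
Context (d1 d2 : measure_display) (T1 : measurableType d1) (T2 : measurableType d2).
Context (R : realType) (P1 : probability T1 R) (P2 : probability T2 R).

Lemma bdm_Ex2 (f : T1 * T2 -> R) : bdm f ->
  bdm (fun x => Ex P2 (fun y => f (x, y))).
Proof.
move=> bf; case: (bf) => mf [C fC]; split.
  have := measurable_fubini_F (bdm_integrable (P1 \x P2)%E bf).
  by move=> h; apply: (measurableT_comp _ h) => //; exact: measurable_fine.
exists C => x.
have b1 : bdm (fun y => f (x, y)).
  by split; [exact: measurableT_comp|exists C].
exact: Ex_bound.
Qed.

Lemma Ex_fubini (f : T1 * T2 -> R) : bdm f ->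
  Ex (P1 \x P2)%E f = Ex P1 (fun x => Ex P2 (fun y => f (x, y))).
Proof.
move=> bf; case: (bf) => mf [C fC].
rewrite /Ex /Rintegral -integral12_prod_meas1; last exact: bdm_integrable.
congr fine; apply: eq_integral => x _; rewrite fineK//.
apply: integrable_fin_num => //; apply: bdm_integrable.
by split; [exact: measurableT_comp|exists C].
Qed.

End FubiniBounded.

(** * Independent samples *)

Section TupleMeasure.
Context (d : measure_display) (T : measurableType d) (R : realType).

Definition cons_pair k (p : T * k.-tuple T) : k.+1.-tuple T :=
  [tuple of p.1 :: p.2].

Lemma measurable_cons_pair k : measurable_fun setT (@cons_pair k).
Proof. exact: measurable_cons. Qed.

HB.instance Definition _ k := @isMeasurableFun.Build _ _ _ _ (@cons_pair k)
  (@measurable_cons_pair k).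

Variable U : probability T R.

(** The k-fold product of [U], built by recursion on the head so that its integrals unfold in step
    with [cube_integral]. *)
Fixpoint tuple_prob k : probability (k.-tuple T) R :=
  match k with
  | 0 => dirac [tuple]
  | k'.+1 => distribution (U \x tuple_prob k')%E (@cons_pair k')
  end.

Lemma integral_tuple_prob0 (f : 0.-tuple T -> \bar R) :
  (\int[tuple_prob 0]_x f x = f [tuple])%E.
Proof.
rewrite /= integral_dirac//; first by rewrite diracT mul1e.
move=> _ Y mY.
have [h|h] := pselect (Y (f [tuple])).
  rewrite (_ : _ `&` _ = setT)//; apply/seteqP; split=> // x _; split=> //=.
  by rewrite (tuple0 x).
rewrite (_ : _ `&` _ = set0)//; apply/seteqP; split=> // x [_] /=.
by rewrite (tuple0 x).
Qed.

Lemma integral_tuple_probS k (f : k.+1.-tuple T -> \bar R) :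
  measurable_fun setT f -> (forall x, 0 <= f x)%E ->
  (\int[tuple_prob k.+1]_x f x =
   \int[U]_x \int[tuple_prob k]_t f [tuple of x :: t])%E.
Proof.
move=> mf f0; rewrite /= ge0_integral_distribution//.
have mf' : measurable_fun setT (f \o @cons_pair k) by exact: measurableT_comp.
by rewrite fubini_tonelli1// => x; exact: f0.
Qed.

Lemma measurable_integral_tuple_prob k (f : k.+1.-tuple T -> \bar R) :
  measurable_fun setT f -> (forall x, 0 <= f x)%E ->
  measurable_fun setT (fun x => \int[tuple_prob k]_t f [tuple of x :: t])%E.
Proof.
move=> mf f0.
apply: (@measurable_fun_fubini_tonelli_F _ _ _ _ _ (tuple_prob k) (f \o @cons_pair k)).
  exact: measurableT_comp.
by move=> x; exact: f0.
Qed.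

Lemma Ex_cons k (f : k.+1.-tuple T -> R) : bdm f ->
  Ex (tuple_prob k.+1) f =
  Ex U (fun x => Ex (tuple_prob k) (fun t => f [tuple of x :: t])).
Proof.
move=> bf; rewrite [LHS]Ex_distribution// Ex_fubini//.
exact: bdm_comp.
Qed.

Lemma measurable_cat_tuple k m (d' : measure_display) (T' : measurableType d')
  (f : T' -> k.-tuple T) (g : T' -> m.-tuple T) :
  measurable_fun setT f -> measurable_fun setT g ->
  measurable_fun setT (fun x => [tuple of f x ++ g x]).
Proof.
move=> mf mg; apply/measurable_fun_tnthP => i /=.
case: (split_ordP i) => j ->.
  rewrite (_ : _ \o _ = (fun x => tnth (f x) j)); last first.
    by apply/funext => x /=; rewrite tnth_lshift.
  apply: (measurableT_comp (measurable_tnth j) mf).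
rewrite (_ : _ \o _ = (fun x => tnth (g x) j)); last first.
  by apply/funext => x /=; rewrite tnth_rshift.
exact: (measurableT_comp (measurable_tnth j) mg).
Qed.

Lemma Ex_cat k m (f : (k + m).-tuple T -> R) : bdm f ->
  Ex (tuple_prob (k + m)) f =
  Ex (tuple_prob k) (fun x => Ex (tuple_prob m) (fun z => f [tuple of x ++ z])).
Proof.
elim: k f => [|k IH] f bf.
  rewrite {2}/Ex /Rintegral integral_tuple_prob0 /=.
  by apply: eq_Ex => z; congr f; apply: val_inj.
rewrite [LHS]Ex_cons// Ex_cons; last first.
  apply: (bdm_Ex2 (tuple_prob k.+1) (tuple_prob m) (f := fun p => f [tuple of p.1 ++ p.2])).
  by apply: bdm_comp => //; exact: measurable_cat_tuple.
apply: eq_Ex => x.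
rewrite IH; last by apply: bdm_comp => //; exact: measurable_cons.
by apply: eq_Ex => t; apply: eq_Ex => z; congr f; apply: val_inj.
Qed.

Lemma bdm_tnth r (f : T -> R) (t : 'I_r) : bdm f ->
  bdm (fun z : r.-tuple T => f (tnth z t)).
Proof. by move=> bf; apply: bdm_comp bf _; exact: measurable_tnth. Qed.

Lemma Ex_tuple_prod r (f : 'I_r -> T -> R) : (forall t, bdm (f t)) ->
  Ex (tuple_prob r) (fun z => \prod_t f t (tnth z t)) = \prod_t Ex U (f t).
Proof.
elim: r f => [|r IH] f bf.
  rewrite big_ord0 -[RHS](Ex_cst (tuple_prob 0)); apply: eq_Ex => z.
  by rewrite big_ord0.
rewrite Ex_cons; last by apply: bdm_prod => t _; exact: bdm_tnth.
have E x : Ex (tuple_prob r) (fun t =>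
    \prod_(i < r.+1) f i (tnth [tuple of x :: t] i)) =
    (\prod_(i < r) Ex U (f (lift ord0 i))) * f ord0 x.
  rewrite -IH; last by move=> t; exact: bf.
  rewrite mulrC -ExZl; last first.
    by apply: bdm_integrable; apply: bdm_prod => t _; exact: bdm_tnth.
  apply: eq_Ex => t; rewrite big_ord_recl; congr (_ * _).
  by apply: eq_bigr => i _; rewrite tnthS.
under eq_Ex do rewrite E.
by rewrite ExZl ?big_ord_recl 1?mulrC//; exact: bdm_integrable.
Qed.

(** The shape of the integral over the new vertices: the first two are ends of the switched edges,
    and each further one is joined to a single old vertex, so it integrates separately. *)
Lemma Ex_pair_tuple_prod r (f : T -> T -> R) (g : 'I_r -> T -> R) :
  bdm (fun p : T * T => f p.1 p.2) -> (forall t, bdm (g t)) ->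
  Ex (tuple_prob r.+2) (fun z => f (tnth z ord0) (tnth z (lift ord0 ord0)) *
     \prod_t g t (tnth z (lift ord0 (lift ord0 t)))) =
  Ex U (fun x => Ex U (f x)) * \prod_t Ex U (g t).
Proof.
move=> bf bg.
have bfx x : bdm (f x).
  apply: (bdm_comp bf (g := fun y => (x, y))).
  exact: measurable_pair1.
have bG : bdm (fun z : r.+2.-tuple T => f (tnth z ord0) (tnth z (lift ord0 ord0)) *
     \prod_t g t (tnth z (lift ord0 (lift ord0 t)))).
  apply: bdmM; last by apply: bdm_prod => t _; exact: bdm_tnth.
  apply: (bdm_comp bf (g := fun z : r.+2.-tuple T => (tnth z ord0, tnth z (lift ord0 ord0)))).
  by apply: measurable_fun_pair; exact: measurable_tnth.
have bGx x : bdm (fun t : r.+1.-tuple T => f x (tnth t ord0) *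
     \prod_i g i (tnth t (lift ord0 i))).
  apply: bdmM; first exact: bdm_tnth.
  by apply: bdm_prod => t _; exact: bdm_tnth.
have bgp : bdm (fun z : r.-tuple T => \prod_t g t (tnth z t)).
  by apply: bdm_prod => t _; exact: bdm_tnth.
rewrite Ex_cons//.
have E x : Ex (tuple_prob r.+1) (fun t => f (tnth [tuple of x :: t] ord0)
      (tnth [tuple of x :: t] (lift ord0 ord0)) *
    \prod_i g i (tnth [tuple of x :: t] (lift ord0 (lift ord0 i)))) =
    (\prod_t Ex U (g t)) * Ex U (f x).
  transitivity (Ex (tuple_prob r.+1) (fun t => f x (tnth t ord0) *
     \prod_i g i (tnth t (lift ord0 i)))).
    apply: eq_Ex => t; congr (f _ _ * _); first by rewrite tnthS.
    by apply: eq_bigr => i _; rewrite !tnthS.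
  rewrite Ex_cons// -ExZl; last exact: bdm_integrable.
  apply: eq_Ex => y; rewrite mulrC -Ex_tuple_prod// -ExZl; last exact: bdm_integrable.
  by apply: eq_Ex => t; congr (_ * _); apply: eq_bigr => i _; rewrite !tnthS.
under eq_Ex do rewrite E.
rewrite ExZl 1?mulrC//; apply: bdm_integrable.
exact: (bdm_Ex2 U U bf).
Qed.

End TupleMeasure.

(** * Densities of edge patterns *)

(* A loop [edgemx i i] has diagonal entry 2. *)
Definition edgemx k (i j : 'I_k) : 'M[nat]_k :=
  \matrix_(a, b) ((a == i) && (b == j) + (a == j) && (b == i))%N.

Definition sorted_pair k (i j : 'I_k) : 'I_k * 'I_k :=
  if (i <= j)%N then (i, j) else (j, i).

Lemma sorted_pairP k (i j : 'I_k) : ((sorted_pair i j).1 <= (sorted_pair i j).2)%N.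
Proof. by rewrite /sorted_pair; case: (leqP i j) => [//|/ltnW]. Qed.

Lemma sorted_pairC k (i j : 'I_k) : sorted_pair i j = sorted_pair j i.
Proof.
rewrite /sorted_pair; case: (ltngtP i j) => // /ord_inj ->.
by [].
Qed.

Lemma sorted_pair_id k (p : 'I_k * 'I_k) : (p.1 <= p.2)%N ->
  sorted_pair p.1 p.2 = p.
Proof. by rewrite /sorted_pair => ->; case: p. Qed.

Lemma edgemx_sym k (i j a b : 'I_k) : edgemx i j a b = edgemx i j b a.
Proof. by rewrite !mxE addnC (andbC (b == j)) (andbC (b == i)). Qed.

Lemma edgemx_eq0 k (i j : 'I_k) (p : 'I_k * 'I_k) : (p.1 <= p.2)%N ->
  (edgemx i j p.1 p.2 == 0%N) = (p != sorted_pair i j).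
Proof.
case: p => a b /= ab; rewrite !mxE /sorted_pair -(inj_eq val_inj) -!(inj_eq val_inj a) -!(inj_eq val_inj b) /=.
case: ifP => ij; rewrite xpair_eqE -!(inj_eq val_inj a) -!(inj_eq val_inj b) /=; lia.
Qed.

(** The multiplicity factor of a pair with [a] edges that receives [e] more, and 1 if it receives
    none. It spreads the coefficient of the switching identity over all pairs, so that sums over
    multiplicities factorize. *)
Definition shift_coef (e a : nat) : nat := if e == 0%N then 1%N else (a + e)%N.

Definition mxsym k (A : 'M[nat]_k) := forall i j, A i j = A j i.

Lemma mxsymD k (A B : 'M[nat]_k) : mxsym A -> mxsym B -> mxsym (A + B).
Proof. by move=> sA sB i j; rewrite !mxE sA sB. Qed.

Lemma mxsym_edgemx k (i j : 'I_k) : mxsym (edgemx i j).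
Proof. by move=> a b; exact: edgemx_sym. Qed.

Lemma mxsym_sorted k (A : 'M[nat]_k) i j : mxsym A ->
  A (sorted_pair i j).1 (sorted_pair i j).2 = A i j.
Proof. by move=> sA; rewrite /sorted_pair; case: ifP. Qed.

Lemma prod_shift_coef k (A : 'M[nat]_k) (i j l m : 'I_k) : mxsym A ->
  sorted_pair i j != sorted_pair l m ->
  (\prod_(p : 'I_k * 'I_k | (p.1 <= p.2)%N)
     shift_coef ((edgemx i j + edgemx l m)%R p.1 p.2) (A p.1 p.2))%N =
  ((A + edgemx i j + edgemx l m)%R i j * (A + edgemx i j + edgemx l m)%R l m)%N.
Proof.
move=> sA ne.
set B := A + _ + _.
have sB : mxsym B by do !apply: mxsymD => //; exact: mxsym_edgemx.
rewrite (bigD1 (sorted_pair i j)) ?sorted_pairP//=.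
rewrite (bigD1 (sorted_pair l m)) ?sorted_pairP//=; last by rewrite eq_sym ne.
rewrite big1 ?muln1 => [|p /andP[/andP[pl p1] p2]]; last first.
  by rewrite /shift_coef mxE -[_ + _]/(_ + _)%N addn_eq0 !edgemx_eq0// p1 p2.
have h (p : 'I_k * 'I_k) : (p.1 <= p.2)%N -> (p == sorted_pair i j) || (p == sorted_pair l m) ->
  shift_coef ((edgemx i j + edgemx l m)%R p.1 p.2) (A p.1 p.2) = B p.1 p.2.
  move=> pl pe; rewrite /shift_coef.
  rewrite [X in X == _]mxE -[X in X == _]/(_ + _)%N addn_eq0 !edgemx_eq0// -negb_or pe /=.
  by rewrite /B -addrA [in RHS]mxE.
by rewrite !h ?eqxx ?orbT ?sorted_pairP// !mxsym_sorted.
Qed.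

Definition prod_pairs (R : realType) (T : Type) k
  (F : 'I_k * 'I_k -> T -> T -> R) (x : k.-tuple T) : R :=
  \prod_(p : 'I_k * 'I_k | (p.1 <= p.2)%N) F p (tnth x p.1) (tnth x p.2).

Section Kernel.
Context (d : measure_display) (T : measurableType d) (R : realType).
Variables (U : probability T R) (V : T -> T -> nat -> R).

Definition pattern_prob k (A : 'M[nat]_k) : k.-tuple T -> R :=
  prod_pairs (fun p x y => V x y (A p.1 p.2)).

Definition density k (A : 'M[nat]_k) : R := Ex (tuple_prob U k) (pattern_prob A).

(** The contribution of one pair to the switching identity, its multiplicity before the [e] edges
    are added being summed out with weight [w]. *)
Definition shifted_sum N (w : nat -> R) (e : nat) (x y : T) : R :=
  \sum_(a < N.+1) w a * ((shift_coef e a)%:R * V x y (a + e)%N).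

Hypothesis mV : forall a, measurable_fun setT (fun p : T * T => V p.1 p.2 a).
Hypothesis V_ge0 : forall x y a, 0 <= V x y a.
Hypothesis V_le1 : forall x y a, V x y a <= 1.

Lemma bdm_V (d' : measure_display) (T' : measurableType d') (f g : T' -> T) a :
  measurable_fun setT f -> measurable_fun setT g ->
  bdm (fun x => V (f x) (g x) a).
Proof.
move=> mf mg; split.
  apply: (measurableT_comp (mV a) (g := fun x => (f x, g x))).
  exact: measurable_fun_pair.
by exists 1 => x; rewrite ger0_norm.
Qed.

Lemma bdm_prod_pairs k (F : 'I_k * 'I_k -> T -> T -> R) :
  (forall p, bdm (fun z : T * T => F p z.1 z.2)) -> bdm (prod_pairs F).
Proof.
move=> bF; apply: bdm_prod => p _.
have h : measurable_fun setT (fun x : k.-tuple T => (tnth x p.1, tnth x p.2)).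
  by apply: measurable_fun_pair; exact: measurable_tnth.
exact: (bdm_comp (bF p) h).
Qed.

Lemma bdm_V2 a : bdm (fun z : T * T => V z.1 z.2 a).
Proof. by apply: bdm_V; [exact: measurable_fst|exact: measurable_snd]. Qed.

Lemma bdm_pattern_prob k (A : 'M[nat]_k) : bdm (pattern_prob A).
Proof. by apply: bdm_prod_pairs => p; exact: bdm_V2. Qed.

Hypothesis V_odd : forall x a, odd a -> V x x a = 0.

Lemma density_odd k (A : 'M[nat]_k) i : odd (A i i) -> density A = 0.
Proof.
move=> oA; rewrite -[RHS](Ex_cst (tuple_prob U k)); apply: eq_Ex => x.
by rewrite /pattern_prob /prod_pairs (bigD1 (i, i))//= V_odd// mul0r.
Qed.

Hypothesis switching : forall k (A : 'M[nat]_k) (i j l m : 'I_k), adjmx A ->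
  [&& l != m, l != i, l != j, m != i & m != j] ->
  ((A + edgemx i j + edgemx l m)%R i j * (A + edgemx i j + edgemx l m)%R l m)%:R
    * density (A + edgemx i j + edgemx l m) =
  ((A + edgemx i l + edgemx j m)%R i l * (A + edgemx i l + edgemx j m)%R j m)%:R
    * density (A + edgemx i l + edgemx j m).

Lemma edgemx_even k (i j a : 'I_k) : ~~ odd (edgemx i j a a).
Proof. by rewrite mxE; case: (a == i); case: (a == j). Qed.

(** Added edges change diagonal entries by 0 or 2 each, so an odd entry stays odd and both densities
    vanish. Such matrices do occur when multiplicities are summed pair by pair. *)
Lemma switching_sym k (A : 'M[nat]_k) (i j l m : 'I_k) : mxsym A ->
  [&& l != m, l != i, l != j, m != i & m != j] ->
  ((A + edgemx i j + edgemx l m)%R i j * (A + edgemx i j + edgemx l m)%R l m)%:R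
    * density (A + edgemx i j + edgemx l m) =
  ((A + edgemx i l + edgemx j m)%R i l * (A + edgemx i l + edgemx j m)%R j m)%:R
    * density (A + edgemx i l + edgemx j m).
Proof.
move=> sA ne; have [eA|/existsNP[a /negP/negPn oA]] :=
  pselect (forall a, ~~ odd (A a a)).
  exact: switching.
have h i1 j1 i2 j2 : density (A + edgemx i1 j1 + edgemx i2 j2) = 0.
  apply: (@density_odd _ _ a); rewrite mxE [X in X + _]mxE.
  by rewrite -![_ + _]/(_ + _)%N !oddD oA !(negbTE (edgemx_even _ _ _)).
by rewrite !h !mulr0.
Qed.

Definition sym_of k N (g : {ffun 'I_k * 'I_k -> 'I_N}) : 'M[nat]_k :=
  \matrix_(a, b) (g (sorted_pair a b) : nat).

(** The product of sums is distributed. The choice functions [g], frozen at 0 on unsorted pairs,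
    enumerate the symmetric matrices with entries at most [N]. *)
Lemma prod_shifted_sum k N (w : 'I_k * 'I_k -> nat -> R) (i j l m : 'I_k) (x : k.-tuple T) :
  prod_pairs (fun p => shifted_sum N (w p) ((edgemx i j + edgemx l m)%R p.1 p.2)) x =
  \sum_(g in pfamily ord0 (fun p : 'I_k * 'I_k => (p.1 <= p.2)%N) (fun=> predT : pred 'I_N.+1))
    (\prod_(p : 'I_k * 'I_k | (p.1 <= p.2)%N) w p (g p)) *
    ((\prod_(p : 'I_k * 'I_k | (p.1 <= p.2)%N)
       shift_coef ((edgemx i j + edgemx l m)%R p.1 p.2) (sym_of g p.1 p.2))%N%:R *
     pattern_prob (sym_of g + edgemx i j + edgemx l m) x).
Proof.
rewrite /prod_pairs /shifted_sum (big_distr_big_dep ord0).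
apply: eq_bigr => g _; rewrite !big_split/=; congr (_ * _).
have gE (p : 'I_k * 'I_k) : (p.1 <= p.2)%N -> sym_of g p.1 p.2 = g p.
  by move=> pl; rewrite mxE sorted_pair_id.
rewrite natr_prod; congr (_ * _).
  by apply: eq_bigr => p pl; rewrite gE.
apply: eq_bigr => p pl; congr (V _ _ _).
by rewrite -addrA [in RHS]mxE gE.
Qed.

(** The weights see only the matrix before the two edges are added, which both sides of a switching
    share; hence the identity holds term by term. *)
Lemma Ex_prod_shifted_sum k N (w : 'I_k * 'I_k -> nat -> R) (i j l m : 'I_k) :
  [&& l != m, l != i, l != j, m != i & m != j] ->
  Ex (tuple_prob U k) (prod_pairs (fun p =>
    shifted_sum N (w p) ((edgemx i j + edgemx l m)%R p.1 p.2))) =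
  Ex (tuple_prob U k) (prod_pairs (fun p =>
    shifted_sum N (w p) ((edgemx i l + edgemx j m)%R p.1 p.2))).
Proof.
move=> ne.
under eq_Ex do rewrite prod_shifted_sum.
under [RHS]eq_Ex do rewrite prod_shifted_sum.
have b i1 j1 i2 j2 (g : {ffun 'I_k * 'I_k -> 'I_N.+1}) (c1 c2 : R) :
    bdm (fun x => c1 * (c2 * pattern_prob (sym_of g + edgemx i1 j1 + edgemx i2 j2) x)).
  apply: bdmM; first exact: bdm_cst.
  by apply: bdmM; [exact: bdm_cst|exact: bdm_pattern_prob].
rewrite !Ex_sum; try by move=> g _; exact/bdm_integrable/b.
apply: eq_bigr => g _.
have b' i1 j1 i2 j2 (c2 : R) :
    bdm (fun x => c2 * pattern_prob (sym_of g + edgemx i1 j1 + edgemx i2 j2) x).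
  by apply: bdmM; [exact: bdm_cst|exact: bdm_pattern_prob].
rewrite !ExZl; try exact/bdm_integrable/b'; try exact/bdm_integrable/bdm_pattern_prob.
congr (_ * _).
have sg : mxsym (sym_of g) by move=> a b'' ; rewrite !mxE sorted_pairC.
rewrite !prod_shift_coef//; first exact: switching_sym.
- move: ne => /and5P[lm li lj mi mj]; rewrite /sorted_pair.
  by do 2 case: ifP => _; rewrite xpair_eqE; apply/negP => /andP[/eqP a /eqP b''];
  move: lm li lj mi mj; rewrite ?a ?b'' ?eqxx.
- move: ne => /and5P[lm li lj mi mj]; rewrite /sorted_pair.
  by do 2 case: ifP => _; rewrite xpair_eqE; apply/negP => /andP[/eqP a /eqP b''];
  move: lm li lj mi mj; rewrite -?a -?b'' ?eqxx.
Qed.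

(** * Truncated degrees and masses *)

Definition edge_mean M (x y : T) : R := \sum_(c < M) c%:R * V x y c.

Definition mass N (x y : T) : R := \sum_(c < N) V x y c.

Definition trunc_deg M (x : T) : R := Ex U (edge_mean M x).

Lemma bdm_edge_mean M : bdm (fun z : T * T => edge_mean M z.1 z.2).
Proof. by apply: bdm_sum => a _; apply: bdmM; [exact: bdm_cst|exact: bdm_V2]. Qed.

Lemma edge_mean_ge0 M x y : 0 <= edge_mean M x y.
Proof. by apply: sumr_ge0 => c _; apply: mulr_ge0. Qed.

Lemma edge_mean_nd x y : nondecreasing_seq (fun M => edge_mean M x y).
Proof.
apply/nondecreasing_seqP => n; rewrite /edge_mean big_ord_recr/= lerDl.
exact: mulr_ge0.
Qed.

Lemma mass_ge0 N x y : 0 <= mass N x y.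
Proof. exact: sumr_ge0. Qed.

Lemma bdm_mass N : bdm (fun z : T * T => mass N z.1 z.2).
Proof. by apply: bdm_sum => a _; exact: bdm_V2. Qed.

Hypothesis mass_cvg : forall x y, mass N x y @[N --> \oo] --> (1 : R).

Lemma mass_le1 N x y : mass N x y <= 1.
Proof.
have nd : nondecreasing_seq (fun N => mass N x y).
  by apply/nondecreasing_seqP => n; rewrite /mass big_ord_recr/= lerDl.
rewrite -(cvg_lim _ (mass_cvg x y))//.
by apply: nondecreasing_cvgn_le => //; apply: cvgP (mass_cvg x y).
Qed.

(** Old vertices precede new ones, so a sorted pair is old-old, old-new or new-new, but never
    new-old. *)
Lemma prod_pairs_split k m (F : 'I_(k + m) * 'I_(k + m) -> T -> T -> R)
  (y : (k + m).-tuple T) :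
  prod_pairs F y =
  (\prod_(p : 'I_k * 'I_k | (p.1 <= p.2)%N)
     F (lshift m p.1, lshift m p.2) (tnth y (lshift m p.1)) (tnth y (lshift m p.2))) *
  (\prod_(a < k) \prod_(t < m)
     F (lshift m a, rshift k t) (tnth y (lshift m a)) (tnth y (rshift k t))) *
  (\prod_(p : 'I_m * 'I_m | (p.1 <= p.2)%N)
     F (rshift k p.1, rshift k p.2) (tnth y (rshift k p.1)) (tnth y (rshift k p.2))).
Proof.
pose G a b := F (a, b) (tnth y a) (tnth y b).
have pairE n (H : 'I_n -> 'I_n -> R) :
    \prod_(p : 'I_n * 'I_n | (p.1 <= p.2)%N) H p.1 p.2 =
    \prod_(a < n) \prod_(b < n | (a <= b)%N) H a b.
  by rewrite pair_big_dep.
rewrite /prod_pairs (pairE _ (fun a b => G (lshift m a) (lshift m b))).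
rewrite (pairE _ (fun a b => G (rshift k a) (rshift k b))).
transitivity (\prod_(p : 'I_(k + m) * 'I_(k + m) | (p.1 <= p.2)%N) G p.1 p.2).
  by apply: eq_bigr => -[].
rewrite pairE big_split_ord /=; congr (_ * _).
  rewrite -big_split/=; apply: eq_bigr => a _; rewrite big_split_ord/=; congr (_ * _).
  by apply: eq_bigl => t; rewrite (leq_trans (ltnW (ltn_ord a)))// leq_addr.
apply: eq_bigr => a _; rewrite big_split_ord/= big_pred0 ?mul1r.
  by apply: eq_bigl => t; rewrite leq_add2l.
by move=> b; apply/negbTE; rewrite -ltnNge (leq_trans (ltn_ord b))// leq_addr.
Qed.

(** * Attaching new vertices to a pattern *)

Section Extras.
Variables (k r : nat) (A0 : 'M[nat]_k) (i j : 'I_k) (s : r.-tuple 'I_k) (M : nat).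
Hypothesis sA0 : mxsym A0.

Let K := (k + r.+2)%N.
Let ord1 : 'I_r.+2 := lift ord0 ord0.
Let li : 'I_K := lshift r.+2 i.
Let lj : 'I_K := lshift r.+2 j.
Let vl : 'I_K := rshift k (ord0 : 'I_r.+2).
Let vm : 'I_K := rshift k ord1.

(* The vertex [t.+2] among the last [r.+2] ones is attached to [tnth s t]. *)
Let word (a : 'I_k) (t : 'I_r.+2) := (1 < t)%N && (a == nth i s (t - 2)%N).

(** On old pairs the weight pins the multiplicity to [A0]; on an edge of the word it produces an
    edge mean truncated at [M]; elsewhere it lets the multiplicity be summed out. *)
Let weight (p : 'I_K * 'I_K) (c : nat) : R :=
  match fintype.split p.1, fintype.split p.2 with
  | inl a, inl b => (c == A0 a b)%:R
  | inl a, inr t => if word a t then c%:R * (c < M)%N%:R else 1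
  | _, _ => 1
  end.

(** [main] is the part of a weighted sum that is nondecreasing in [N], and [rest] the part in [0, 1]
    that tends to 1. They take the two roles of [Ex_cutoff_limit]. *)
Let main N (e : nat) (p : 'I_K * 'I_K) (x y : T) : R :=
  match fintype.split p.1, fintype.split p.2 with
  | inl a, inl b => (shift_coef e (A0 a b))%:R * V x y (A0 a b + e)
  | inl a, inr t => if word a t then edge_mean M x y else
                    if e == 0%N then 1 else edge_mean N.+2 x y
  | _, _ => if e == 0%N then 1 else edge_mean N.+2 x y
  end.

Let rest N (e : nat) (p : 'I_K * 'I_K) (x y : T) : R :=
  match fintype.split p.1, fintype.split p.2 with
  | inl a, inl b => 1
  | inl a, inr t => if word a t then 1 else if e == 0%N then mass N.+1 x y else 1
  | _, _ => if e == 0%N then mass N.+1 x y else 1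
  end.

Let small (e : nat) (p : 'I_K * 'I_K) : bool :=
  match fintype.split p.1, fintype.split p.2 with
  | inl a, inl b => true
  | inl a, inr t => (e <= ~~ word a t)%N
  | _, _ => (e <= 1)%N
  end.

(** From this bound on, the sums up to [N] reach every entry of [A0] and all multiplicities below
    [M]. *)
Let N0 := (M + \sum_a \sum_b A0 a b)%N.

Lemma shifted_sum_mass N e x y : (e <= 1)%N ->
  shifted_sum N (fun=> 1) e x y =
  (if e == 0%N then 1 else edge_mean N.+2 x y) * (if e == 0%N then mass N.+1 x y else 1).
Proof.
case: e => [|[|//]] _ /=; rewrite /shifted_sum.
  by rewrite mul1r; apply: eq_bigr => c _; rewrite mul1r /shift_coef/= mul1r addn0.
(* With one edge added, the multiplicities run from 1 to [N.+1], hence the bound [N.+2];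
   multiplicity 0 has coefficient 0 in the mean. *)
rewrite mulr1 /edge_mean [RHS]big_ord_recl mul0r add0r.
by apply: eq_bigr => c _; rewrite mul1r /shift_coef/= /bump /= add1n addn1.
Qed.

Lemma shifted_sum_weight N e p x y : (N0 <= N)%N -> small e p ->
  shifted_sum N (weight p) e x y = main N e p x y * rest N e p x y.
Proof.
move=> NN; rewrite /small /main /rest /weight.
case: (fintype.split p.1) => [a|t]; case: (fintype.split p.2) => [b|u]; try exact: shifted_sum_mass.
  move=> _; rewrite mulr1 /shifted_sum.
  have Aab : (A0 a b < N.+1)%N.
    rewrite ltnS (leq_trans _ NN)// /N0 (bigD1 a)//= (bigD1 b)//= -addnA addnCA.
    exact: leq_addr.
  rewrite (bigD1 (Ordinal Aab))//= eqxx mul1r big1 ?addr0// => c cA.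
  rewrite (_ : (c : nat) == A0 a b = false) ?mul0r//.
  by apply/negbTE; apply: contraNneq cA => cA; apply/eqP/val_inj.
case: ifP => _; last by move=> /= e1; exact: shifted_sum_mass.
rewrite /= leqn0 => /eqP ->; rewrite mulr1 /shifted_sum /edge_mean.
have MN : (M <= N.+1)%N by rewrite (leq_trans _ (leqW NN))// leq_addr.
rewrite (big_ord_widen _ (fun c => c%:R * V x y c) MN) [RHS]big_mkcond/=.
apply: eq_bigr => c _; rewrite /shift_coef/= mul1r addn0.
by case: ifP => _; rewrite ?mulr1// mulr0 mul0r.
Qed.

Lemma rest01 N e p x y : 0 <= rest N e p x y <= 1.
Proof.
rewrite /rest; case: (fintype.split p.1) => [a|t]; case: (fintype.split p.2) => [b|u];
  do ?case: ifP => _; by rewrite ?mass_ge0 ?mass_le1 ?ler01 ?lexx.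
Qed.

Lemma rest_cvg e p x y : rest N e p x y @[N --> \oo] --> (1 : R).
Proof.
have h : mass N.+1 x y @[N --> \oo] --> (1 : R).
  by rewrite (cvg_shiftS (fun N => mass N x y)).
have hc : (fun=> 1 : R) @ \oo --> (1 : R) by exact: cvg_cst.
rewrite /rest; case: (fintype.split p.1) => [a|t]; case: (fintype.split p.2) => [b|u] //.
- by case: (word a u) => //; case: (e == 0%N).
- by case: (e == 0%N).
- by case: (e == 0%N).
Qed.

Lemma bdm_rest N e p : bdm (fun z : T * T => rest N e p z.1 z.2).
Proof.
rewrite /rest; case: (fintype.split p.1) => [a|t]; case: (fintype.split p.2) => [b|u];
  [exact: bdm_cst|case: (word a u)| | ]; try exact: bdm_cst;
  case: (e == 0%N); by [exact: bdm_mass|exact: bdm_cst].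
Qed.

Lemma main_ge0 N e p x y : 0 <= main N e p x y.
Proof.
rewrite /main; case: (fintype.split p.1) => [a|t]; case: (fintype.split p.2) => [b|u];
  do ?case: ifP => _; try exact: edge_mean_ge0; try exact: ler01.
exact: mulr_ge0.
Qed.

Lemma main_nd e p x y : nondecreasing_seq (fun N => main N e p x y).
Proof.
move=> N N' NN'; rewrite /main; case: (fintype.split p.1) => [a|t]; case: (fintype.split p.2) => [b|u];
  [by []|case: (word a u) => //| | ]; case: (e == 0%N) => //;
  by apply: (@edge_mean_nd x y N.+2 N'.+2); rewrite !ltnS.
Qed.

Lemma bdm_main N e p : bdm (fun z : T * T => main N e p z.1 z.2).
Proof.
rewrite /main; case: (fintype.split p.1) => [a|t]; case: (fintype.split p.2) => [b|u];
  [|case: (word a u)| | ]; try exact: bdm_edge_mean;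
  try by case: (e == 0%N); [exact: bdm_cst|exact: bdm_edge_mean].
by apply: bdmM; [exact: bdm_cst|exact: bdm_V2].
Qed.

Let eL (p : 'I_K * 'I_K) : nat := (edgemx li lj + edgemx vl vm)%R p.1 p.2.
Let eR (p : 'I_K * 'I_K) : nat := (edgemx li vl + edgemx lj vm)%R p.1 p.2.

Lemma split_l a : fintype.split (lshift r.+2 a : 'I_K) = inl a.
Proof. exact: (unsplitK (inl a)). Qed.

Lemma split_r t : fintype.split (rshift k t : 'I_K) = inr t.
Proof. exact: (unsplitK (inr t)). Qed.

Let eqs := (eq_lshift, eq_rshift, eq_lrshift, eq_rlshift).

Lemma eL_ll a b : eL (lshift _ a, lshift _ b) = edgemx i j a b.
Proof. by rewrite /eL /= mxE [in X in X + _]mxE [in X in _ + X]mxE !eqs mxE addr0. Qed.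

Lemma eL_lr a t : eL (lshift _ a, rshift _ t) = 0%N.
Proof. by rewrite /eL /= mxE [in X in X + _]mxE [in X in _ + X]mxE !eqs !andbF. Qed.

Lemma eL_rr t u : eL (rshift _ t, rshift _ u) = edgemx ord0 ord1 t u.
Proof. by rewrite /eL /= mxE [in X in X + _]mxE [in X in _ + X]mxE !eqs mxE add0r. Qed.

Lemma eR_ll a b : eR (lshift _ a, lshift _ b) = 0%N.
Proof. by rewrite /eR /= mxE [in X in X + _]mxE [in X in _ + X]mxE !eqs !andbF. Qed.

Lemma eR_lr a t : eR (lshift _ a, rshift _ t) =
  ((a == i) && (t == ord0) + (a == j) && (t == ord1))%N.
Proof. by rewrite /eR /= mxE [in X in X + _]mxE [in X in _ + X]mxE !eqs !andbF !addn0. Qed.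

Lemma eR_rr t u : eR (rshift _ t, rshift _ u) = 0%N.
Proof. by rewrite /eR /= mxE [in X in X + _]mxE [in X in _ + X]mxE !eqs !andbF. Qed.

Lemma edgemx01_le1 (t u : 'I_r.+2) : (edgemx ord0 ord1 t u <= 1)%N.
Proof.
rewrite mxE; have [->|t0] := eqVneq t ord0; have [->|u0] := eqVneq u ord0 => //=; lia.
Qed.

Lemma small_eL (p : 'I_K * 'I_K) : (p.1 <= p.2)%N -> small (eL p) p.
Proof.
case: p => a b /=; rewrite /small /=.
case: (split_ordP a) => a' ->; case: (split_ordP b) => b' ->; rewrite ?split_l ?split_r//.
- by rewrite eL_lr.
- by move=> /=; rewrite leqNgt (leq_trans (ltn_ord b'))// leq_addr.
- by rewrite eL_rr edgemx01_le1.
Qed.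

Lemma small_eR (p : 'I_K * 'I_K) : (p.1 <= p.2)%N -> small (eR p) p.
Proof.
case: p => a b /=; rewrite /small /=.
case: (split_ordP a) => a' ->; case: (split_ordP b) => b' ->; rewrite ?split_l ?split_r//.
- rewrite eR_lr /word => _; have [->|b0] := eqVneq b' ord0.
    by rewrite /= andbT andbF addn0; case: (_ == _).
  rewrite andbF add0n; have [->|b1] := eqVneq b' ord1; last by rewrite andbF.
  by rewrite andbT /=; case: (_ == _).
- by move=> /=; rewrite leqNgt (leq_trans (ltn_ord b'))// leq_addr.
- by rewrite eR_rr.
Qed.

Lemma wordS a (t : 'I_r) : word a (lift ord0 (lift ord0 t)) = (a == tnth s t).
Proof. by rewrite /word /= /bump /= !add1n /= subSS subSS subn0 (tnth_nth i). Qed.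

Let prefix (y : K.-tuple T) : k.-tuple T := [tuple tnth y (lshift _ a) | a < k].

Lemma prefix_cat (x : k.-tuple T) (z : r.+2.-tuple T) : prefix [tuple of x ++ z] = x.
Proof. by apply: eq_from_tnth => a; rewrite tnth_mktuple tnth_lshift. Qed.

Lemma prod_pred1 (n : nat) (a : 'I_n) (f : 'I_n -> R) :
  \prod_b (if b == a then f b else 1) = f a.
Proof. by rewrite -big_mkcond big_pred1_eq. Qed.

Let word_prod (y : K.-tuple T) : R := \prod_(t < r)
  edge_mean M (tnth y (lshift _ (tnth s t))) (tnth y (rshift k (lift ord0 (lift ord0 t)))).

(** The edge between the two new vertices touches no old one. It splits off as a separate factor,
    whose mean tends to rho, while the edge from [i] to [j] stays in the pattern with its
    multiplicity. *)
Lemma prod_main_L N y :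
  prod_pairs (fun p => main N (eL p) p) y =
  (((A0 + edgemx i j)%R i j)%:R * pattern_prob (A0 + edgemx i j) (prefix y)) *
  word_prod y * edge_mean N.+2 (tnth y vl) (tnth y vm).
Proof.
rewrite prod_pairs_split; congr (_ * _ * _).
- rewrite /pattern_prob /prod_pairs.
  transitivity ((\prod_(p : 'I_k * 'I_k | (p.1 <= p.2)%N)
      shift_coef (edgemx i j p.1 p.2) (A0 p.1 p.2))%N%:R *
    \prod_(p : 'I_k * 'I_k | (p.1 <= p.2)%N)
      V (tnth (prefix y) p.1) (tnth (prefix y) p.2) ((A0 + edgemx i j)%R p.1 p.2)).
    rewrite natr_prod -big_split/=; apply: eq_bigr => p pl.
    rewrite /main /= !split_l eL_ll !tnth_mktuple.
    by congr (_ * V _ _ _); rewrite [RHS]mxE.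
  congr (_%:R * _).
  rewrite (bigD1 (sorted_pair i j)) ?sorted_pairP//= big1 ?muln1; last first.
    by move=> p /andP[pl p1]; rewrite /shift_coef edgemx_eq0// p1.
  rewrite /shift_coef edgemx_eq0 ?sorted_pairP// eqxx /=.
  rewrite !mxsym_sorted//; last exact: mxsym_edgemx.
  by rewrite [in RHS]mxE.
- rewrite exchange_big/= big_ord_recl big1 ?mul1r; last first.
    by move=> a _; rewrite /main /= split_l split_r eL_lr.
  rewrite big_ord_recl big1 ?mul1r; last first.
    by move=> a _; rewrite /main /= split_l split_r eL_lr.
  apply: eq_bigr => t _.
  rewrite -(prod_pred1 (tnth s t) (fun a => edge_mean M (tnth y (lshift _ a)) _)).
  by apply: eq_bigr => a _; rewrite /main /= split_l split_r eL_lr wordS.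
- rewrite (bigD1 (ord0, ord1))//= big1 ?mulr1; last first.
    move=> p /andP[pl p1]; rewrite /main /= split_r eL_rr edgemx_eq0//.
    by rewrite p1.
  by rewrite /main /= split_r eL_rr !mxE.
Qed.

(** Here both edges leave the old vertices, so the pattern remains [A0] and they integrate to the
    degrees at [i] and [j]. The case [i = j] is the same, as the new ends are distinct. *)
Lemma prod_main_R N y :
  prod_pairs (fun p => main N (eR p) p) y =
  pattern_prob A0 (prefix y) * word_prod y *
  (edge_mean N.+2 (tnth y li) (tnth y vl) * edge_mean N.+2 (tnth y lj) (tnth y vm)).
Proof.
rewrite prod_pairs_split -[RHS]mulr1 -[X in _ = X * 1]mulrA; congr (_ * _ * _).
- apply: eq_bigr => p pl.
  by rewrite /main /= !split_l eR_ll mul1r !tnth_mktuple addn0.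
- rewrite exchange_big/= big_ord_recl mulrC [X in _ = _ * X]mulrC mulrA.
  congr (_ * _); last first.
    rewrite -(prod_pred1 i (fun a => edge_mean N.+2 (tnth y (lshift _ a)) _)).
    apply: eq_bigr => a _; rewrite /main /= split_l split_r eR_lr.
    by case: (a == i) => //=; rewrite ?andbF.
  rewrite big_ord_recl mulrC; congr (_ * _); last first.
    rewrite -(prod_pred1 j (fun a => edge_mean N.+2 (tnth y (lshift _ a)) _)).
    apply: eq_bigr => a _; rewrite /main /= split_l split_r eR_lr andbF.
    by case: (a == j).
  apply: eq_bigr => t _.
  rewrite -(prod_pred1 (tnth s t) (fun a => edge_mean M (tnth y (lshift _ a)) _)).
  by apply: eq_bigr => a _; rewrite /main /= split_l split_r eR_lr !andbF wordS.
- by rewrite big1// => p pl; rewrite /main /= split_r eR_rr.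
Qed.

Lemma cvg_bigprod (I : Type) (l : seq I) (Q : pred I) (F : nat -> I -> R) (f : I -> R) :
  (forall p, F n p @[n --> \oo] --> f p) ->
  \prod_(p <- l | Q p) F n p @[n --> \oo] --> \prod_(p <- l | Q p) f p.
Proof.
move=> Ff; elim: l => [|p l IH].
  by under eq_fun do rewrite big_nil; rewrite big_nil; exact: cvg_cst.
under eq_fun do rewrite big_cons; rewrite big_cons.
by case: (Q p) => //; apply: cvgM.
Qed.

Let rest_prod (e : 'I_K * 'I_K -> nat) N (y : K.-tuple T) :=
  prod_pairs (fun p => rest N (e p) p) y.
Let main_prod (e : 'I_K * 'I_K -> nat) N (y : K.-tuple T) :=
  prod_pairs (fun p => main N (e p) p) y.

Lemma rest_prod01 e N y : 0 <= rest_prod e N y <= 1.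
Proof.
apply/andP; split.
  by apply: prodr_ge0 => p _; case/andP: (rest01 N (e p) p (tnth y p.1) (tnth y p.2)).
by apply: prodr_ile1 => p _; exact: rest01.
Qed.

Lemma rest_prod_cvg e y : rest_prod e N y @[N --> \oo] --> (1 : R).
Proof.
have h := @cvg_bigprod _ (index_enum ('I_K * 'I_K)%type)
  (fun p : 'I_K * 'I_K => (p.1 <= p.2)%N) _ _
  (fun p => rest_cvg (e p) p (tnth y p.1) (tnth y p.2)).
by rewrite big1_eq in h.
Qed.

Lemma main_prod_nd e y : nondecreasing_seq (fun N => main_prod e N y).
Proof.
move=> N N' NN'; apply: ler_prod => p _.
by rewrite main_ge0 main_nd.
Qed.

Lemma main_rest_prod (e : 'I_K * 'I_K -> nat) N y : (N0 <= N)%N ->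
  (forall p : 'I_K * 'I_K, (p.1 <= p.2)%N -> small (e p) p) ->
  prod_pairs (fun p => shifted_sum N (weight p) (e p)) y =
  main_prod e N y * rest_prod e N y.
Proof.
move=> NN se; rewrite /main_prod /rest_prod /prod_pairs -big_split/=.
by apply: eq_bigr => p pl; rewrite shifted_sum_weight// se.
Qed.

Let word_deg (x : k.-tuple T) : R := \prod_(t < r) trunc_deg M (tnth x (tnth s t)).

Lemma bdm_trunc_deg N : bdm (trunc_deg N).
Proof. exact: (bdm_Ex2 U U (bdm_edge_mean N)). Qed.

Lemma bdm_edge_mean1 N x : bdm (edge_mean N x).
Proof.
apply: (bdm_comp (bdm_edge_mean N) (g := fun y => (x, y))).
exact: measurable_pair1.
Qed.

Lemma bdm_main_prod e N : bdm (main_prod e N).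
Proof. by apply: bdm_prod_pairs => p; exact: bdm_main. Qed.

Lemma Ex_main_L N : Ex (tuple_prob U K) (main_prod eL N) =
  (((A0 + edgemx i j)%R i j)%:R *
   Ex (tuple_prob U k) (fun x => pattern_prob (A0 + edgemx i j) x * word_deg x)) *
  Ex U (trunc_deg N.+2).
Proof.
rewrite Ex_cat; last exact: bdm_main_prod.
have bw : bdm (fun x => pattern_prob (A0 + edgemx i j) x * word_deg x).
  apply: bdmM; first exact: bdm_pattern_prob.
  by apply: bdm_prod => t _; apply: bdm_tnth; exact: bdm_trunc_deg.
have Ec := ExZl (((A0 + edgemx i j)%R i j)%:R * Ex U (trunc_deg N.+2))
  (bdm_integrable (tuple_prob U k) bw).
rewrite [RHS]mulrAC -Ec.
apply: eq_Ex => x; under eq_Ex do rewrite /main_prod prod_main_L prefix_cat.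
transitivity (Ex (tuple_prob U r.+2) (fun z =>
  ((A0 + edgemx i j)%R i j)%:R * pattern_prob (A0 + edgemx i j) x *
  (edge_mean N.+2 (tnth z ord0) (tnth z (lift ord0 ord0)) *
   \prod_(t < r) edge_mean M (tnth x (tnth s t)) (tnth z (lift ord0 (lift ord0 t)))))).
  apply: eq_Ex => z; rewrite -mulrA; congr (_ * _); rewrite mulrC !tnth_rshift.
  by congr (_ * _); apply: eq_bigr => t _; rewrite tnth_lshift tnth_rshift.
rewrite ExZl; last first.
  apply: bdm_integrable; apply: bdmM.
    apply: (bdm_comp (bdm_edge_mean N.+2)
      (g := fun z : r.+2.-tuple T => (tnth z ord0, tnth z (lift ord0 ord0)))).
    by apply: measurable_fun_pair; exact: measurable_tnth.
  by apply: bdm_prod => t _; apply: bdm_tnth; exact: bdm_edge_mean1.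
rewrite (Ex_pair_tuple_prod U (f := edge_mean N.+2)
  (g := fun t => edge_mean M (tnth x (tnth s t)))) //; last 2 first.
- exact: bdm_edge_mean.
- by move=> t; exact: bdm_edge_mean1.
rewrite /word_deg /trunc_deg; ring.
Qed.

Lemma Ex_main_R N : Ex (tuple_prob U K) (main_prod eR N) =
  Ex (tuple_prob U k) (fun x => pattern_prob A0 x * word_deg x *
    (trunc_deg N.+2 (tnth x i) * trunc_deg N.+2 (tnth x j))).
Proof.
rewrite Ex_cat; last exact: bdm_main_prod.
apply: eq_Ex => x; under eq_Ex do rewrite /main_prod prod_main_R prefix_cat.
pose f z1 z2 := edge_mean N.+2 (tnth x i) z1 * edge_mean N.+2 (tnth x j) z2.
have bf : bdm (fun z : T * T => f z.1 z.2).
  apply: bdmM.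
    exact: (bdm_comp (bdm_edge_mean1 N.+2 (tnth x i)) measurable_fst).
  exact: (bdm_comp (bdm_edge_mean1 N.+2 (tnth x j)) measurable_snd).
transitivity (Ex (tuple_prob U r.+2) (fun z =>
  pattern_prob A0 x *
  (f (tnth z ord0) (tnth z (lift ord0 ord0)) *
   \prod_(t < r) edge_mean M (tnth x (tnth s t)) (tnth z (lift ord0 (lift ord0 t)))))).
  apply: eq_Ex => z; rewrite -mulrA; congr (_ * _).
  rewrite mulrC /f !tnth_rshift !tnth_lshift.
  by congr (_ * _); apply: eq_bigr => t _; rewrite tnth_lshift tnth_rshift.
rewrite ExZl; last first.
  apply: bdm_integrable; apply: bdmM.
    apply: (bdm_comp bf
      (g := fun z : r.+2.-tuple T => (tnth z ord0, tnth z (lift ord0 ord0)))).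
    by apply: measurable_fun_pair; exact: measurable_tnth.
  by apply: bdm_prod => t _; apply: bdm_tnth; exact: bdm_edge_mean1.
rewrite (Ex_pair_tuple_prod U (f := f)
  (g := fun t => edge_mean M (tnth x (tnth s t)))) //; last first.
  by move=> t; exact: bdm_edge_mean1.
rewrite -[RHS]mulrA; congr (_ * _); rewrite mulrC; congr (_ * _).
have E1 z : Ex U (f z) = trunc_deg N.+2 (tnth x j) * edge_mean N.+2 (tnth x i) z.
  by rewrite mulrC; apply: (ExZl _ (bdm_integrable U (bdm_edge_mean1 _ _))).
under eq_Ex do rewrite E1.
by rewrite (ExZl _ (bdm_integrable U (bdm_edge_mean1 _ _))) mulrC.
Qed.

(** The side with the isolated edge has a limit because the mean truncated degree has one;
    [Ex_cutoff_limit] carries this limit over to the side with the two degrees. The level [M] of the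
    word stays fixed. *)
Lemma trunc_switching (rho : R) :
  Ex U (trunc_deg N) @[N --> \oo] --> rho ->
  Ex (tuple_prob U k) (fun x => pattern_prob A0 x * word_deg x *
    (trunc_deg N (tnth x i) * trunc_deg N (tnth x j))) @[N --> \oo] -->
  ((A0 + edgemx i j)%R i j)%:R *
   Ex (tuple_prob U k) (fun x => pattern_prob (A0 + edgemx i j) x * word_deg x) * rho.
Proof.
move=> hrho.
(* The shift by 2 matches the bound [N.+2] of the edge means in [main]. *)
rewrite -(cvg_shiftn 2); under eq_fun do rewrite addn2 -Ex_main_R.
apply: (@Ex_cutoff_limit _ _ _ _ (main_prod eL) _ (rest_prod eL) (rest_prod eR) _ N0).
- by move=> n; exact: bdm_main_prod.
- by move=> n; exact: bdm_main_prod.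
- by move=> n; apply: bdm_prod_pairs => p; exact: bdm_rest.
- by move=> n; apply: bdm_prod_pairs => p; exact: bdm_rest.
- by move=> n y; apply: prodr_ge0 => p _; exact: main_ge0.
- by move=> n y; apply: prodr_ge0 => p _; exact: main_ge0.
- by move=> n y; exact: rest_prod01.
- by move=> n y; exact: rest_prod01.
- exact: main_prod_nd.
- exact: main_prod_nd.
- exact: rest_prod_cvg.
- exact: rest_prod_cvg.
- move=> N NN; under eq_Ex do rewrite -(main_rest_prod _ NN small_eL).
  under [RHS]eq_Ex do rewrite -(main_rest_prod _ NN small_eR).
  apply: Ex_prod_shifted_sum.
  by rewrite !(eq_lrshift, eq_rlshift, eq_rshift).
- under eq_fun do rewrite Ex_main_L.
  apply: cvgM; first exact: cvg_cst.
  by move: hrho; rewrite -(cvg_shiftn 2); under eq_fun do rewrite addn2.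
Qed.

End Extras.

End Kernel.

(** * Words and exponentials *)

Section ExpSeries.
Context (R : realType).
Implicit Types x y : R.

Definition exp_sum n x : R := \sum_(a < n) x ^+ a / a`!%:R.

Lemma exp_sum_cvg x : exp_sum n x @[n --> \oo] --> expR x.
Proof.
rewrite (_ : (fun n => exp_sum n x) = series (exp_coeff x)).
  exact: is_cvg_series_exp_coeff.
by apply/funext => n; rewrite /exp_sum /series /= big_mkord.
Qed.

Lemma exp_sum_nd x : 0 <= x -> nondecreasing_seq (fun n => exp_sum n x).
Proof.
move=> x0; apply/nondecreasing_seqP => n; rewrite /exp_sum big_ord_recr/= lerDl.
by rewrite divr_ge0// exprn_ge0.
Qed.

Lemma exp_sum_le x n : 0 <= x -> exp_sum n x <= expR x.
Proof.
move=> x0; rewrite -(cvg_lim _ (@exp_sum_cvg x))//.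
by apply: nondecreasing_cvgn_le; [exact: exp_sum_nd|exact: cvgP (@exp_sum_cvg x)].
Qed.

Lemma norm_exp_sum_le x n : `|exp_sum n x| <= expR `|x|.
Proof.
apply: le_trans (exp_sum_le n (normr_ge0 x)).
apply: le_trans (ler_norm_sum _ _ _) _; apply: ler_sum => a _.
by rewrite normrM normrX normfV (ger0_norm (ler0n _ _)).
Qed.

(** As exp(t) is at least 1 + t, it suffices that (1 + 1/e)(1 + e y^2) is at least 1 + y^2, hence at
    least y. *)
Lemma lin_exp_bound (e y : R) : 0 < e -> 0 <= y ->
  y * expR (- (e * y ^+ 2)) <= 1 + e^-1.
Proof.
move=> e0 y0; rewrite expRN ler_pdivrMr ?expR_gt0//.
have h : 1 + e * y ^+ 2 <= expR (e * y ^+ 2) by exact: expR_ge1Dx.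
apply: (@le_trans _ _ ((1 + e^-1) * (1 + e * y ^+ 2))); last first.
  by apply: ler_wpM2l => //; rewrite addr_ge0// invr_ge0 ltW.
have -> : (1 + e^-1) * (1 + e * y ^+ 2) = 1 + e * y ^+ 2 + e^-1 + y ^+ 2.
  by field; rewrite gt_eqF.
have : 0 < e^-1 by rewrite invr_gt0.
have : 0 <= e * y ^+ 2 by rewrite mulr_ge0 ?sqr_ge0// ltW.
nra.
Qed.

End ExpSeries.

Section VanishingExp.
Context (d : measure_display) (T : measurableType d) (R : realType).
Variables (P : probability T R) (k : nat) (F : T -> R) (f : 'I_k -> T -> R).
Variables (lam : 'I_k * 'I_k -> R) (S : pred ('I_k * 'I_k)).
Hypothesis intF : P.-integrable setT (EFin \o F).
Hypothesis bf : forall a, bdm (f a).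
Hypothesis F_words : forall s : seq 'I_k, Ex P (fun x => F x * \prod_(a <- s) f a x) = 0.

Let L x := \sum_(p | S p) lam p * (f p.1 x * f p.2 x).

Lemma bdm_quadratic : bdm L.
Proof.
apply: bdm_sum => p _; apply: bdmM; first exact: bdm_cst.
exact: bdmM.
Qed.

Lemma bdm_word (s : seq 'I_k) : bdm (fun x => \prod_(a <- s) f a x).
Proof. exact: bdm_prod. Qed.

Lemma bdmX (g : T -> R) n : bdm g -> bdm (fun x => g x ^+ n).
Proof.
move=> bg; elim: n => [|n IH]; first by under eq_fun do rewrite expr0; exact: bdm_cst.
by under eq_fun do rewrite exprS; exact: bdmM.
Qed.

(** Each factor of the quadratic form [L] prolongs the word by two letters, so a word times a power
    of [L] is a combination of words. *)
Lemma Ex_word_power n s : Ex P (fun x => F x * (\prod_(a <- s) f a x * L x ^+ n)) = 0.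
Proof.
elim: n s => [|n IH] s.
  by rewrite -[RHS](F_words s); apply: eq_Ex => x; rewrite expr0 mulr1.
pose G (p : 'I_k * 'I_k) x := F x * (\prod_(a <- p.1 :: p.2 :: s) f a x * L x ^+ n).
have iG p : P.-integrable setT (EFin \o G p).
  apply: (integrableM_bdm intF); apply: bdmM; first exact: bdm_word.
  by apply: bdmX; exact: bdm_quadratic.
have E x : F x * (\prod_(a <- s) f a x * L x ^+ n.+1) = \sum_(p | S p) lam p * G p x.
  rewrite exprS {1}/L mulr_suml mulr_sumr mulr_sumr; apply: eq_bigr => p _.
  by rewrite /G !big_cons; ring.
under eq_Ex do rewrite E.
rewrite Ex_sum; last first.
  by move=> p _; have := integrableZl measurableT (lam p) (iG p); apply: eq_integrable.
rewrite big1// => p _; rewrite ExZl; last exact: iG.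
by rewrite IH mulr0.
Qed.

(** The exponential series converges dominatedly because the letters, hence [L], are bounded; this
    is why it is used for truncated degrees only. *)
Lemma Ex_word_exp (c : R) s :
  Ex P (fun x => F x * (\prod_(a <- s) f a x * expR (c * L x))) = 0.
Proof.
have [_ [B LB]] := bdm_quadratic.
have [_ [C wC]] := bdm_word s.
case/integrableP: (intF) => /measurable_EFinP mF _.
have bE n : bdm (fun x => \prod_(a <- s) f a x * exp_sum n (c * L x)).
  apply: bdmM; first exact: bdm_word.
  apply: bdm_sum => m _; apply: bdmM; last exact: bdm_cst.
  apply: bdmX; apply: bdmM; [exact: bdm_cst|exact: bdm_quadratic].
have E0 n : Ex P (fun x => F x * (\prod_(a <- s) f a x * exp_sum n (c * L x))) = 0.
  have E x : F x * (\prod_(a <- s) f a x * exp_sum n (c * L x)) =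
      \sum_(m < n) (c ^+ m / m`!%:R) * (F x * (\prod_(a <- s) f a x * L x ^+ m)).
    rewrite /exp_sum mulr_sumr mulr_sumr; apply: eq_bigr => m _.
    by rewrite exprMn; ring.
  under eq_Ex do rewrite E.
  have iG (m : nat) : P.-integrable setT
      (EFin \o (fun x => F x * (\prod_(a <- s) f a x * L x ^+ m))).
    apply: (integrableM_bdm intF); apply: bdmM; first exact: bdm_word.
    by apply: bdmX; exact: bdm_quadratic.
  rewrite Ex_sum; last first.
    by move=> m _; have := integrableZl measurableT (c ^+ m / m`!%:R) (iG m); apply: eq_integrable.
  rewrite big1// => m _; rewrite ExZl; last exact: iG.
  by rewrite Ex_word_power mulr0.
have h : Ex P (fun x => F x * (\prod_(a <- s) f a x * exp_sum n (c * L x))) @[n --> \oo]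
    --> Ex P (fun x => F x * (\prod_(a <- s) f a x * expR (c * L x))).
  apply: (Ex_dct (g := fun x => `|F x| * (C * expR (`|c| * B)))).
  - by move=> n; apply: measurable_funM => //; case: (bE n).
  - apply: integrableM_bdm; last exact: bdm_cst.
    have := integrable_abse intF; apply: eq_integrable => //.
  - move=> n x; rewrite normrM; apply: ler_wpM2l => //.
    rewrite normrM; apply: ler_pM => //.
    apply: (le_trans (norm_exp_sum_le _ _)); rewrite ler_expR normrM.
    exact: ler_wpM2l.
  - move=> x; apply: cvgM; first exact: cvg_cst.
    apply: cvgM; [exact: cvg_cst|exact: exp_sum_cvg].
apply: (cvg_unique _ h) => //.
rewrite (_ : (fun n => Ex P _) = fun=> 0); first exact: cvg_cst.
by apply/funext => n; exact: E0.
Qed.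

End VanishingExp.

(** * Poisson weights *)

Section Poisson.
Context (R : realType).
Implicit Types (rho l : R).

(* A Poisson weight without its exponential factor [expR (- half_if diag l)]; on
   the diagonal [a] is twice the number of loops, which has half the rate. *)
Definition poisson_coef (diag : bool) (l : R) (a : nat) : R :=
  if diag then (~~ odd a)%:R * ((l / 2) ^+ a./2 / (a./2)`!%:R)
  else l ^+ a / a`!%:R.

Definition half_if (diag : bool) (l : R) : R := if diag then l / 2 else l.

Lemma poisson_coef_ge0 diag l a : 0 <= l -> 0 <= poisson_coef diag l a.
Proof.
move=> l0; rewrite /poisson_coef; case: diag; last by rewrite divr_ge0 ?exprn_ge0.
by rewrite mulr_ge0// divr_ge0 ?exprn_ge0// divr_ge0.
Qed.

Lemma poisson_coefS l a : poisson_coef false l a.+1 * a.+1%:R = l * poisson_coef false l a.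
Proof.
rewrite /poisson_coef exprS factS natrM; field.
by rewrite addrC natr1 !pnatr_eq0 -lt0n fact_gt0.
Qed.

(** With m loops, the new entry 2 (m + 1) cancels both the factorial and the halving of the rate, so
    loops obey the recursion of ordinary edges with the entry raised by 2. *)
Lemma poisson_coefSS l a : poisson_coef true l a.+2 * a.+2%:R = l * poisson_coef true l a.
Proof.
rewrite /poisson_coef /= negbK; case: (boolP (odd a)) => oa; first by rewrite !mul0r mulr0.
rewrite !mul1r factS natrM exprS.
have -> : a.+2%:R = 2 * (a./2).+1%:R :> R.
  by rewrite -{1}[a]odd_double_half (negbTE oa) add0n -doubleS -muln2 natrM mulrC.
field.
by rewrite addrC natr1 !pnatr_eq0 -lt0n fact_gt0.
Qed.

(** Only even entries contribute, and [uphalf n] counts those below [n]. *)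
Lemma sum_poisson_coef_diag l n :
  \sum_(a < n) poisson_coef true l a = exp_sum (uphalf n) (l / 2).
Proof.
elim: n => [|n IH]; first by rewrite !big_ord0 /exp_sum big_ord0.
rewrite big_ord_recr/= IH /exp_sum /poisson_coef.
rewrite uphalf_half; case: (boolP (odd n)) => on /=; last first.
  by rewrite mul1r add0n big_ord_recr/=.
by rewrite mul0r addr0 add1n.
Qed.

Lemma sum_poisson_coef_cvg diag l :
  \sum_(a < n) poisson_coef diag l a @[n --> \oo] --> expR (half_if diag l).
Proof.
case: diag; last exact: exp_sum_cvg.
under eq_fun do rewrite sum_poisson_coef_diag.
apply: (@cvg_comp _ _ _ uphalf (fun n => exp_sum n (l / 2)) _ \oo); last exact: exp_sum_cvg.
apply/cvgnyPge => A; near=> n.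
have : (A.*2 <= n)%N by near: n; exact: nbhs_infty_ge.
by move/uphalf_leq; rewrite uphalf_double.
Unshelve. all: by end_near. Qed.

Lemma sum_poisson_coef_le diag l n : 0 <= l ->
  \sum_(a < n) poisson_coef diag l a <= expR (half_if diag l).
Proof.
move=> l0; case: diag; last exact: exp_sum_le.
by rewrite sum_poisson_coef_diag exp_sum_le// divr_ge0.
Qed.

(** * Products of Poisson weights over pairs of vertices *)

Section Pairs.
Variables (k : nat) (rho : R).
Hypothesis rho_gt0 : 0 < rho.
Implicit Types (y : 'I_k -> R) (A : 'M[nat]_k).

Definition pair_rate y (p : 'I_k * 'I_k) : R := y p.1 * y p.2 / rho.

Definition poisson_prod A y : R :=
  \prod_(p : 'I_k * 'I_k | (p.1 <= p.2)%N)
    poisson_coef (p.1 == p.2) (pair_rate y p) (A p.1 p.2).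

Definition total_rate y : R :=
  \sum_(p : 'I_k * 'I_k | (p.1 <= p.2)%N) half_if (p.1 == p.2) (pair_rate y p).

Lemma pair_rate_ge0 y p : (forall a, 0 <= y a) -> 0 <= pair_rate y p.
Proof. by move=> y0; rewrite divr_ge0 ?mulr_ge0// ltW. Qed.

Lemma half_if_ge0 diag l : 0 <= l -> 0 <= half_if diag l.
Proof. by case: diag => //= l0; rewrite divr_ge0. Qed.

Lemma poisson_prod0 y : poisson_prod 0 y = 1.
Proof.
apply: big1 => p _; rewrite mxE /poisson_coef; case: ifP => _ /=;
by rewrite expr0 fact0 divr1 ?mulr1.
Qed.

(** The Poisson counterpart of the switching identity, with the same coefficient, so that the two
    can be compared edge by edge. *)
Lemma poisson_prod_edge A (i j : 'I_k) y : mxsym A ->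
  poisson_prod (A + edgemx i j) y * ((A + edgemx i j)%R i j)%:R =
  y i * y j / rho * poisson_prod A y.
Proof.
move=> sA; set p0 := sorted_pair i j.
have sB : mxsym (A + edgemx i j) by apply: mxsymD => //; exact: mxsym_edgemx.
rewrite /poisson_prod (bigD1 p0) ?sorted_pairP//= [in RHS](bigD1 p0) ?sorted_pairP//=.
rewrite (eq_bigr (fun p => poisson_coef (p.1 == p.2) (pair_rate y p) (A p.1 p.2))); last first.
  by move=> p /andP[pl pn]; rewrite mxE (eqP (_ : edgemx i j p.1 p.2 == 0%N)) ?addr0// edgemx_eq0.
rewrite mulrAC [RHS]mulrA; congr (_ * _).
rewrite !mxsym_sorted//.
have -> : pair_rate y p0 = y i * y j / rho.
  by rewrite /pair_rate /p0 /sorted_pair; case: ifP => //= _; rewrite [y j * _]mulrC.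
have -> : (p0.1 == p0.2) = (i == j).
  by rewrite /p0 /sorted_pair; case: ifP => //= _; rewrite eq_sym.
rewrite mxE [in X in _ + X]mxE !eqxx [j == i]eq_sym.
case: (i == j) => /=.
  by rewrite -[_ + _]/(_ + _)%N addn2; exact: poisson_coefSS.
by rewrite -[_ + _]/(_ + _)%N addn1; exact: poisson_coefS.
Qed.

(** The loop at [a] alone contributes this square. It is why exp(- c L) damps every single
    degree. *)
Lemma total_rate_diag y a : (forall b, 0 <= y b) -> (2 * rho)^-1 * y a ^+ 2 <= total_rate y.
Proof.
move=> y0; rewrite /total_rate (bigD1 (a, a))//= eqxx /pair_rate /=.
have -> : (2 * rho)^-1 * y a ^+ 2 = y a * y a / rho / 2.
  by field; rewrite gt_eqF.
rewrite lerDl; apply: sumr_ge0 => p _; apply: half_if_ge0; exact: pair_rate_ge0.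
Qed.

Lemma total_rate_ge0 y : (forall b, 0 <= y b) -> 0 <= total_rate y.
Proof.
move=> y0; apply: sumr_ge0 => p _; apply: half_if_ge0; exact: pair_rate_ge0.
Qed.

(** Half of the damping pays for the first letter, the other half for the remaining word. That [C]
    does not depend on [y] gives dominations uniform in the truncation level. *)
Lemma word_exp_bound (c : R) (s : seq 'I_k) : 0 < c -> exists C, forall y,
  (forall b, 0 <= y b) -> \prod_(a <- s) y a * expR (- (c * total_rate y)) <= C.
Proof.
elim: s c => [|a s IH] c c0.
  exists 1 => y y0; rewrite big_nil mul1r -expR0 ler_expR oppr_le0.
  by rewrite mulr_ge0 ?total_rate_ge0// ltW.
have c2 : 0 < c / 2 by rewrite divr_gt0.
have [C HC] := IH _ c2.
(* The half [c / 2] times the coefficient of the square in [total_rate_diag]. *)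
pose e := c / 2 / (2 * rho).
have e0 : 0 < e by rewrite divr_gt0// mulr_gt0.
exists ((1 + e^-1) * C) => y y0; rewrite big_cons.
have -> : y a * \prod_(b <- s) y b * expR (- (c * total_rate y)) =
    (y a * expR (- (c / 2 * total_rate y))) *
    (\prod_(b <- s) y b * expR (- (c / 2 * total_rate y))).
  by rewrite mulrACA -expRD; congr (_ * expR _); field.
apply: ler_pM; last exact: HC.
- by rewrite mulr_ge0 ?expR_ge0.
- by rewrite mulr_ge0 ?expR_ge0// prodr_ge0.
apply: le_trans (lin_exp_bound e0 (y0 a)).
apply: ler_wpM2l => //; rewrite ler_expR lerN2 /e -mulrA.
by apply: ler_wpM2l; [exact: ltW|exact: total_rate_diag].
Qed.

(** Without its exponential factor, a product of Poisson weights is a monomial in the degrees, so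
    the results on words apply to it. *)
Lemma poisson_prod_word A : exists b s, 0 <= b /\
  forall y, poisson_prod A y = b * \prod_(a <- s) y a.
Proof.
have prodw (I : Type) (l : seq I) (Q : pred I) (G : I -> ('I_k -> R) -> R) :
    (forall p, Q p -> exists b s, 0 <= b /\ forall y, G p y = b * \prod_(a <- s) y a) ->
    exists b s, 0 <= b /\ forall y, \prod_(p <- l | Q p) G p y = b * \prod_(a <- s) y a.
  move=> HG; elim: l => [|p l [b [s [b0 IH]]]].
    by exists 1, [::]; split=> // y; rewrite !big_nil mulr1.
  case: (boolP (Q p)) => Qp; last first.
    by exists b, s; split=> // y; rewrite big_cons (negbTE Qp).
  have [b' [s' [b'0 E]]] := HG p Qp.
  exists (b' * b), (s' ++ s); split=> [|y]; first exact: mulr_ge0.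
  by rewrite big_cons Qp IH E big_cat/= mulrACA.
apply: prodw => p _.
have pw (c : R) n : 0 <= c -> exists b s, 0 <= b /\
    forall y, (y p.1 * y p.2 * c) ^+ n = b * \prod_(a <- s) y a.
  move=> c0; elim: n => [|n [b [s [b0 IH]]]].
    by exists 1, [::]; split=> // y; rewrite big_nil mulr1.
  exists (c * b), (p.1 :: p.2 :: s); split=> [|y]; first exact: mulr_ge0.
  by rewrite exprS IH !big_cons; ring.
rewrite /poisson_coef /pair_rate; case: (p.1 == p.2).
- have [|b [s [b0 E]]] := pw (rho^-1 / 2) (A p.1 p.2)./2.
    by rewrite divr_ge0// invr_ge0 ltW.
  exists ((~~ odd (A p.1 p.2))%:R * (b / ((A p.1 p.2)./2)`!%:R)), s.
  split=> [|y]; first by rewrite mulr_ge0// divr_ge0.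
  by rewrite -[y p.1 * _ / rho / 2]mulrA E; ring.
- have [|b [s [b0 E]]] := pw rho^-1 (A p.1 p.2); first by rewrite invr_ge0 ltW.
  exists (b / (A p.1 p.2)`!%:R), s; split=> [|y]; first by rewrite divr_ge0.
  by rewrite E; ring.
Qed.

End Pairs.
End Poisson.

Lemma cvg_bigsum (R : realType) (I : Type) (l : seq I) (Q : pred I) (F : nat -> I -> R)
  (f : I -> R) : (forall p, F n p @[n --> \oo] --> f p) ->
  \sum_(p <- l | Q p) F n p @[n --> \oo] --> \sum_(p <- l | Q p) f p.
Proof.
move=> Ff; elim: l => [|p l IH].
  by under eq_fun do rewrite big_nil; rewrite big_nil; exact: cvg_cst.
under eq_fun do rewrite big_cons; rewrite big_cons.
by case: (Q p) => //; apply: cvgD.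
Qed.

Lemma measurable_bigsum (d : measure_display) (T : measurableType d) (R : realType)
  (I : Type) (l : seq I) (Q : pred I) (h : I -> T -> R) :
  (forall i, measurable_fun setT (h i)) ->
  measurable_fun setT (fun x => \sum_(i <- l | Q i) h i x).
Proof.
move=> mh; under eq_fun do rewrite big_mkcond.
by apply: measurable_sum => i; case: (Q i).
Qed.

Lemma adjmx_edge_ind (k : nat) (Q : 'M[nat]_k -> Prop) : Q 0 ->
  (forall A i j, adjmx A -> Q A -> Q (A + edgemx i j)) -> forall A, adjmx A -> Q A.
Proof.
move=> Q0 QS A; have [n] := ubnP (\sum_a \sum_b A a b)%N; elim: n A => // n IH A + aA.
rewrite ltnS => An; case: (aA) => sA eA.
have [/existsP[i /existsP[j Aij]]|] := boolP [exists i, exists j, A i j != 0%N]; last first.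
  move=> /existsPn h; rewrite (_ : A = 0)//; apply/matrixP => a b; rewrite mxE.
  by have /existsPn/(_ b)/negPn/eqP := h a.
pose B : 'M[nat]_k := \matrix_(a, b) (A a b - edgemx i j a b)%N.
have le a b : (edgemx i j a b <= A a b)%N.
  rewrite mxE; have [ai|ai] := eqVneq a i; have [bj|bj] := eqVneq b j;
  have [aj|aj] := eqVneq a j; have [bi|bi] := eqVneq b i; subst => //=;
  rewrite ?addn0 ?add0n ?lt0n //; try by rewrite sA.
  (* The removal of a loop: a nonzero even diagonal entry is at least 2. *)
  by have := eA j; move: Aij; case: (A j j) => [|[]].
have AB : A = B + edgemx i j.
  by apply/matrixP => a b; rewrite mxE [in RHS]mxE -[RHS]/(_ + _)%N subnK.
have aB : adjmx B.
  split=> [a b|a]; first by rewrite mxE [RHS]mxE sA edgemx_sym.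
  by rewrite mxE oddB// (negbTE (eA a)) (negbTE (edgemx_even _ _ _)).
rewrite AB; apply: QS => //.
apply: IH => //.
  apply: leq_trans An; rewrite AB.
  rewrite (bigD1 i)//= [X in (_ < X)%N](bigD1 i)//= -addSn; apply: leq_add.
    rewrite (bigD1 j)//= [X in (_ < X)%N](bigD1 j)//= -addSn; apply: leq_add.
      rewrite [X in (_ < X)%N]mxE -[_ + _]/(_ + _)%N -addn1 leq_add2l.
      by rewrite mxE !eqxx.
    by apply: leq_sum => b _; rewrite [X in (_ <= X)%N]mxE leq_addr.
  by apply: leq_sum => a _; apply: leq_sum => b _; rewrite [X in (_ <= X)%N]mxE leq_addr.
Qed.

(** * From switchings to Poisson weights *)

Section PoissonLimit.
Context (d : measure_display) (T : measurableType d) (R : realType).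
Variables (U : probability T R) (V : T -> T -> nat -> R).
Hypothesis mV : forall a, measurable_fun setT (fun p : T * T => V p.1 p.2 a).
Hypothesis V_ge0 : forall x y a, 0 <= V x y a.
Hypothesis V_le1 : forall x y a, V x y a <= 1.
Hypothesis V_odd : forall x a, odd a -> V x x a = 0.
Hypothesis mass_cvg : forall x y, mass V N x y @[N --> \oo] --> (1 : R).
Hypothesis switching : forall k (A : 'M[nat]_k) (i j l m : 'I_k), adjmx A ->
  [&& l != m, l != i, l != j, m != i & m != j] ->
  ((A + edgemx i j + edgemx l m)%R i j * (A + edgemx i j + edgemx l m)%R l m)%:R
    * density U V (A + edgemx i j + edgemx l m) =
  ((A + edgemx i l + edgemx j m)%R i l * (A + edgemx i l + edgemx j m)%R j m)%:R
    * density U V (A + edgemx i l + edgemx j m).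

Variables (deg : T -> R) (rho : R).
Hypothesis deg_cvg : forall x, trunc_deg U V N x @[N --> \oo] --> deg x.
Hypothesis rho_cvg : Ex U (trunc_deg U V N) @[N --> \oo] --> rho.
Hypothesis rho_gt0 : 0 < rho.

Let tdeg N := trunc_deg U V N.

Lemma bdm_tdeg N : bdm (tdeg N).
Proof. exact: (bdm_trunc_deg U mV). Qed.

Lemma tdeg_ge0 N x : 0 <= tdeg N x.
Proof. by apply: Ex_ge0 => y; exact: edge_mean_ge0. Qed.

Lemma tdeg_nd x : nondecreasing_seq (fun N => tdeg N x).
Proof.
move=> N N' NN'; apply: le_Ex.
- by apply: bdm_integrable; exact: bdm_edge_mean1.
- by apply: bdm_integrable; exact: bdm_edge_mean1.
- by move=> y; exact: edge_mean_nd.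
Qed.

Lemma measurable_deg : measurable_fun setT deg.
Proof.
apply: (@measurable_fun_cvg _ _ _ _ tdeg) => //.
by move=> n; case: (bdm_tdeg n).
Qed.

Lemma deg_ge0 x : 0 <= deg x.
Proof.
rewrite -(cvg_lim _ (@deg_cvg x))//.
by apply: limr_ge; [exact: cvgP (@deg_cvg x)|apply: nearW => n; exact: tdeg_ge0].
Qed.

Section Pattern.
Variable k : nat.
Let mu := tuple_prob U k.
Let q := @pattern_prob _ T R V k.
Let degs (x : k.-tuple T) (a : 'I_k) : R := deg (tnth x a).

Lemma pattern_prob_ge0 A x : 0 <= q A x.
Proof. by apply: prodr_ge0. Qed.

Lemma pattern_prob_le1 A x : q A x <= 1.
Proof. by apply: prodr_ile1 => p _; rewrite V_ge0 V_le1. Qed.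

Lemma bdm_q A : bdm (q A).
Proof. exact: bdm_pattern_prob. Qed.

Lemma bdm_tdegs N (s : seq 'I_k) :
  bdm (fun x : k.-tuple T => \prod_(a <- s) tdeg N (tnth x a)).
Proof. by apply: bdm_prod => a _; apply: bdm_tnth; exact: bdm_tdeg. Qed.

(** Monotone convergence in the two degrees at [i] and [j] only. The finite limit provided by
    [trunc_switching] yields the integrability. *)
Lemma switching_trunc_word (A : 'M[nat]_k) (i j : 'I_k) (s : seq 'I_k) M : mxsym A ->
  mu.-integrable setT (EFin \o (fun x =>
    q A x * (\prod_(a <- s) tdeg M (tnth x a)) * (degs x i * degs x j))) /\
  Ex mu (fun x => q A x * (\prod_(a <- s) tdeg M (tnth x a)) * (degs x i * degs x j)) =
  ((A + edgemx i j)%R i j)%:R *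
    Ex mu (fun x => q (A + edgemx i j) x * \prod_(a <- s) tdeg M (tnth x a)) * rho.
Proof.
move=> sA.
have h := @trunc_switching _ _ _ U _ mV V_ge0 V_le1 V_odd switching mass_cvg
  k (size s) A i j (in_tuple s) M sA rho rho_cvg.
have E x : \prod_(t < size s) trunc_deg U V M (tnth x (tnth (in_tuple s) t)) =
    \prod_(a <- s) tdeg M (tnth x a) by rewrite [RHS](big_tnth _ _ s).
apply: (Ex_mct (F := fun N x => q A x * (\prod_(a <- s) tdeg M (tnth x a)) *
   (tdeg N (tnth x i) * tdeg N (tnth x j)))).
- move=> N; apply: bdmM; first by apply: bdmM; [exact: bdm_q|exact: bdm_tdegs].
  by apply: bdmM; apply: bdm_tnth; exact: bdm_tdeg.
- move=> N x; rewrite !mulr_ge0 ?pattern_prob_ge0 ?tdeg_ge0//.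
  by apply: prodr_ge0 => a _; exact: tdeg_ge0.
- move=> x N N' NN'; apply: ler_wpM2l.
    rewrite mulr_ge0 ?pattern_prob_ge0//.
    by apply: prodr_ge0 => a _; exact: tdeg_ge0.
  by apply: ler_pM; rewrite ?tdeg_ge0 ?tdeg_nd.
- move=> x; apply: cvgM; first exact: cvg_cst.
  by apply: cvgM; exact: deg_cvg.
- move: h; under eq_fun do under eq_Ex do rewrite E.
  by under eq_Ex do rewrite E.
Qed.

Let defect (A : 'M[nat]_k) (i j : 'I_k) (x : k.-tuple T) : R :=
  q A x * (degs x i * degs x j) -
  ((A + edgemx i j)%R i j)%:R * rho * q (A + edgemx i j) x.

Lemma integrable_deg_pattern A i j : mxsym A ->
  mu.-integrable setT (EFin \o (fun x => q A x * (degs x i * degs x j))).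
Proof.
move=> sA; have [h _] := @switching_trunc_word A i j [::] 0 sA.
by apply: eq_integrable h => // x _; rewrite /= big_nil mulr1.
Qed.

Lemma integrable_defect A i j : mxsym A ->
  mu.-integrable setT (EFin \o defect A i j).
Proof.
move=> sA.
have b : bdm (fun x => ((A + edgemx i j)%R i j)%:R * rho * q (A + edgemx i j) x).
  by apply: bdmM; [exact: bdm_cst|exact: bdm_q].
have := integrableB measurableT (integrable_deg_pattern i j sA) (bdm_integrable mu b).
by apply: eq_integrable.
Qed.

Lemma defect_words A i j M (s : seq 'I_k) : mxsym A ->
  Ex mu (fun x => defect A i j x * \prod_(a <- s) tdeg M (tnth x a)) = 0.
Proof.
move=> sA; have [h1 h2] := @switching_trunc_word A i j s M sA.
have b : bdm (fun x => q (A + edgemx i j) x * \prod_(a <- s) tdeg M (tnth x a)).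
  by apply: bdmM; [exact: bdm_q|exact: bdm_tdegs].
pose c := ((A + edgemx i j)%R i j)%:R * rho.
have b' : bdm (fun x => c * (q (A + edgemx i j) x * \prod_(a <- s) tdeg M (tnth x a))).
  by apply: bdmM; [exact: bdm_cst|].
have E x : defect A i j x * \prod_(a <- s) tdeg M (tnth x a) =
    q A x * (\prod_(a <- s) tdeg M (tnth x a)) * (degs x i * degs x j) -
    c * (q (A + edgemx i j) x * \prod_(a <- s) tdeg M (tnth x a)).
  by rewrite /defect /c; ring.
under eq_Ex do rewrite E.
rewrite ExB//; last exact: bdm_integrable.
rewrite h2 ExZl; last exact: bdm_integrable.
by rewrite /c; ring.
Qed.

Let rate (x : k.-tuple T) : R := total_rate rho (degs x).

Let tdegs N (x : k.-tuple T) (a : 'I_k) : R := tdeg N (tnth x a).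

Lemma total_rateE (y : 'I_k -> R) : total_rate rho y =
  \sum_(p : 'I_k * 'I_k | (p.1 <= p.2)%N)
    (half_if (p.1 == p.2) rho^-1) * (y p.1 * y p.2).
Proof.
apply: eq_bigr => p _; rewrite /pair_rate; case: (p.1 == p.2) => /=; ring.
Qed.

Lemma total_rate_cvg x : total_rate rho (tdegs N x) @[N --> \oo] --> rate x.
Proof.
rewrite /rate total_rateE; under eq_fun do rewrite total_rateE.
apply: cvg_bigsum => p; apply: cvgM; first exact: cvg_cst.
by apply: cvgM; exact: deg_cvg.
Qed.

Lemma measurable_degs a : measurable_fun setT (fun x => degs x a).
Proof. exact: (measurableT_comp measurable_deg (measurable_tnth a)). Qed.

Lemma measurable_rate : measurable_fun setT rate.
Proof.
rewrite /rate; under eq_fun do rewrite total_rateE.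
apply: measurable_bigsum => p; apply: measurable_funM => //.
by apply: measurable_funM; exact: measurable_degs.
Qed.

Lemma bdm_word_exp c s : 0 < c ->
  bdm (fun x => \prod_(a <- s) degs x a * expR (- (c * rate x))).
Proof.
move=> c0; split.
  apply: measurable_funM; first by apply: measurable_prod => a _; exact: measurable_degs.
  apply: measurableT_comp => //; apply: measurableT_comp => //.
  by apply: measurable_funM => //; exact: measurable_rate.
have [C HC] := word_exp_bound rho_gt0 s c0; exists C => x.
rewrite ger0_norm; first by apply: HC => a; exact: deg_ge0.
by rewrite mulr_ge0 ?expR_ge0//; apply: prodr_ge0 => a _; exact: deg_ge0.
Qed.

(** At a fixed truncation level this is [Ex_word_exp]. The level then tends to infinity, with
    domination by [defect] times the uniform constant of [word_exp_bound]. *)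
Lemma defect_word_exp A i j c s : mxsym A -> 0 < c ->
  Ex mu (fun x => defect A i j x * (\prod_(a <- s) degs x a * expR (- (c * rate x)))) = 0.
Proof.
move=> sA c0; have iF := integrable_defect i j sA.
have [C HC] := word_exp_bound rho_gt0 s c0.
have tdegs_ge0 N x a : 0 <= tdegs N x a by exact: tdeg_ge0.
have h : Ex mu (fun x => defect A i j x *
    (\prod_(a <- s) tdegs N x a * expR (- (c * total_rate rho (tdegs N x))))) @[N --> \oo]
    --> Ex mu (fun x => defect A i j x *
    (\prod_(a <- s) degs x a * expR (- (c * rate x)))).
  apply: (Ex_dct (g := fun x => `|defect A i j x| * C)).
  - move=> N; apply: measurable_funM.
      by case/integrableP: iF => /measurable_EFinP.
    have mt a : measurable_fun setT (fun x => tdegs N x a).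
      by case: (bdm_tnth a (bdm_tdeg N)).
    apply: measurable_funM; first by apply: measurable_prod => a _; exact: mt.
    apply: measurableT_comp => //; apply: measurableT_comp => //.
    apply: measurable_funM => //; under eq_fun do rewrite total_rateE.
    apply: measurable_bigsum => p; apply: measurable_funM => //.
    by apply: measurable_funM; exact: mt.
  - apply: integrableM_bdm; last exact: bdm_cst.
    have := integrable_abse iF; exact: eq_integrable.
  - move=> N x; rewrite normrM; apply: ler_wpM2l => //.
    rewrite ger0_norm; first exact: HC.
    by rewrite mulr_ge0 ?expR_ge0//; apply: prodr_ge0.
  - move=> x; apply: cvgM; first exact: cvg_cst.
    apply: cvgM.
      apply: cvg_bigprod => a; exact: deg_cvg.
    apply: continuous_cvg; first exact: continuous_expR.
    apply: cvgN; apply: cvgM; [exact: cvg_cst|exact: total_rate_cvg].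
apply: (cvg_unique _ h) => //.
rewrite (_ : (fun n => Ex mu _) = fun=> 0); first exact: cvg_cst.
apply/funext => N.
have := @Ex_word_exp _ _ _ mu k (defect A i j) (fun a x => tdegs N x a)
  (fun p => half_if (p.1 == p.2) rho^-1) (fun p => (p.1 <= p.2)%N) iF
  (fun a => bdm_tnth a (bdm_tdeg N)) (fun s => defect_words i j N s sA) (- c) s.
by move=> <-; apply: eq_Ex => x; rewrite total_rateE mulNr.
Qed.

Lemma switching_word_exp A i j c s : mxsym A -> 0 < c ->
  Ex mu (fun x => q A x * (\prod_(a <- i :: j :: s) degs x a * expR (- (c * rate x)))) =
  ((A + edgemx i j)%R i j)%:R * rho *
  Ex mu (fun x => q (A + edgemx i j) x * (\prod_(a <- s) degs x a * expR (- (c * rate x)))).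
Proof.
move=> sA c0.
have b1 : bdm (fun x => q A x * (\prod_(a <- i :: j :: s) degs x a * expR (- (c * rate x)))).
  by apply: bdmM; [exact: bdm_q|exact: bdm_word_exp].
have b2 : bdm (fun x => q (A + edgemx i j) x *
    (\prod_(a <- s) degs x a * expR (- (c * rate x)))).
  by apply: bdmM; [exact: bdm_q|exact: bdm_word_exp].
have b3 : bdm (fun x => (((A + edgemx i j)%R i j)%:R * rho) * (q (A + edgemx i j) x *
    (\prod_(a <- s) degs x a * expR (- (c * rate x))))).
  by apply: bdmM; [exact: bdm_cst|].
rewrite -ExZl; last exact: bdm_integrable.
apply/eqP; rewrite -subr_eq0 -ExB; try exact: bdm_integrable.
apply/eqP; rewrite -[RHS](defect_word_exp i j s sA c0).
by apply: eq_Ex => x; rewrite /defect !big_cons; ring.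
Qed.

Lemma bdm_poisson_word_exp A c s : 0 < c ->
  bdm (fun x => poisson_prod rho A (degs x) *
    (\prod_(a <- s) degs x a * expR (- (c * rate x)))).
Proof.
move=> c0; have [b [s' [b0 E]]] := poisson_prod_word rho_gt0 A.
have h : bdm (fun x => b * (\prod_(a <- s' ++ s) degs x a * expR (- (c * rate x)))).
  by apply: bdmM; [exact: bdm_cst|exact: bdm_word_exp].
rewrite (_ : (fun x => _) =
  (fun x => b * (\prod_(a <- s' ++ s) degs x a * expR (- (c * rate x)))))//.
by apply/funext => x; rewrite E big_cat/=; ring.
Qed.

(** Induction on the edges of [A], for all words at once: removing an edge between [i] and [j]
    prepends these two letters to the word, and [poisson_prod_edge] absorbs them. *)
Lemma pattern_to_empty A c s : adjmx A -> 0 < c ->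
  Ex mu (fun x => q A x * (\prod_(a <- s) degs x a * expR (- (c * rate x)))) =
  Ex mu (fun x => q 0 x * (poisson_prod rho A (degs x) *
    (\prod_(a <- s) degs x a * expR (- (c * rate x))))).
Proof.
move=> aA c0; move: s; pattern A; move: A aA.
apply: adjmx_edge_ind => [s|A i j [sA _] IH s].
  by apply: eq_Ex => x; rewrite poisson_prod0 mul1r.
have Aij : ((A + edgemx i j)%R i j)%:R * rho != 0.
  rewrite mulf_neq0 ?gt_eqF// ltr0n mxE [in X in _ + X]mxE !eqxx.
  by apply/ltn_addl/ltn_addr.
apply: (mulfI Aij); rewrite -switching_word_exp// IH -ExZl; last first.
  by apply: bdm_integrable; apply: bdmM; [exact: bdm_q|exact: bdm_poisson_word_exp].
apply: eq_Ex => x; rewrite !big_cons.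
have E := poisson_prod_edge rho i j (degs x) sA.
transitivity (q 0 x * rho * (degs x i * degs x j / rho * poisson_prod rho A (degs x)) *
   (\prod_(a <- s) degs x a * expR (- (c * rate x)))).
  by field; rewrite gt_eqF.
by rewrite -E; ring.
Qed.

(** At an odd diagonal entry both sides vanish, the left by [V_odd] and the right by the parity
    factor of [poisson_coef]. *)
Lemma pattern_to_empty_sym A c s : mxsym A -> 0 < c ->
  Ex mu (fun x => q A x * (\prod_(a <- s) degs x a * expR (- (c * rate x)))) =
  Ex mu (fun x => q 0 x * (poisson_prod rho A (degs x) *
    (\prod_(a <- s) degs x a * expR (- (c * rate x))))).
Proof.
move=> sA c0; have [eA|/existsNP[a /negP/negPn oA]] :=
  pselect (forall a, ~~ odd (A a a)); first exact: pattern_to_empty.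
apply: eq_Ex => x.
rewrite /q /pattern_prob /prod_pairs /poisson_prod (bigD1 (a, a))//= V_odd// !mul0r.
by rewrite [X in _ * (X * _)](bigD1 (a, a))//= /poisson_coef eqxx oA !mul0r mulr0.
Qed.

(** [masses] and [poisson_masses] are the sums, over all symmetric matrices with entries below [N],
    of the pattern probabilities and of the Poisson products. They tend to 1 and to the exponential
    of the total rate. *)
Let masses N (x : k.-tuple T) : R := prod_pairs (fun _ y z => mass V N y z) x.
Let poisson_masses N (x : k.-tuple T) : R :=
  \prod_(p : 'I_k * 'I_k | (p.1 <= p.2)%N)
    \sum_(a < N) poisson_coef (p.1 == p.2) (pair_rate rho (degs x) p) a.

Lemma sum_patterns N c s : 0 < c ->
  Ex mu (fun x => masses N.+1 x * (\prod_(a <- s) degs x a * expR (- (c * rate x)))) =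
  Ex mu (fun x => q 0 x * (poisson_masses N.+1 x *
    (\prod_(a <- s) degs x a * expR (- (c * rate x))))).
Proof.
move=> c0.
pose S := [pred g : {ffun 'I_k * 'I_k -> 'I_N.+1} |
  g \in pfamily ord0 (fun p : 'I_k * 'I_k => (p.1 <= p.2)%N) (fun=> predT : pred 'I_N.+1)].
have symE (g : {ffun 'I_k * 'I_k -> 'I_N.+1}) (p : 'I_k * 'I_k) : (p.1 <= p.2)%N ->
    sym_of g p.1 p.2 = g p by move=> pl; rewrite mxE sorted_pair_id.
have E1 x : masses N.+1 x = \sum_(g | S g) q (sym_of g) x.
  rewrite /masses /prod_pairs /mass (big_distr_big_dep ord0).
  by apply: eq_bigr => g _; apply: eq_bigr => p pl; rewrite symE.
have E2 x : poisson_masses N.+1 x = \sum_(g | S g) poisson_prod rho (sym_of g) (degs x).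
  rewrite /poisson_masses (big_distr_big_dep ord0).
  by apply: eq_bigr => g _; apply: eq_bigr => p pl; rewrite symE.
transitivity (\sum_(g | S g)
  Ex mu (fun x => q (sym_of g) x * (\prod_(a <- s) degs x a * expR (- (c * rate x))))).
  rewrite -Ex_sum; last first.
    by move=> g _; apply: bdm_integrable; apply: bdmM; [exact: bdm_q|exact: bdm_word_exp].
  by apply: eq_Ex => x; rewrite E1 mulr_suml.
under eq_bigr => g _.
  rewrite pattern_to_empty_sym//; last by move=> a b; rewrite !mxE sorted_pairC.
  over.
rewrite -Ex_sum; last first.
  by move=> g _; apply: bdm_integrable; apply: bdmM; [exact: bdm_q|exact: bdm_poisson_word_exp].
by apply: eq_Ex => x; rewrite E2 mulr_suml mulr_sumr.
Qed.

Lemma expR_rate x : expR (rate x) = \prod_(p : 'I_k * 'I_k | (p.1 <= p.2)%N)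
  expR (half_if (p.1 == p.2) (pair_rate rho (degs x) p)).
Proof. by rewrite /rate /total_rate expR_sum. Qed.

(** [sum_patterns] is applied with [1 + c] in place of [c], and [N] tends to infinity in it. *)
Lemma empty_pattern c s : 0 < c ->
  Ex mu (fun x => q 0 x * (\prod_(a <- s) degs x a * expR (- (c * rate x)))) =
  Ex mu (fun x => \prod_(a <- s) degs x a * expR (- ((1 + c) * rate x))).
Proof.
move=> c0; have c1 : 0 < 1 + c by rewrite addr_gt0.
have [C HC] := word_exp_bound rho_gt0 s c0.
have [C1 HC1] := word_exp_bound rho_gt0 s c1.
(* The extra factor exp(- L) compensates the growth of the Poisson masses up to exp(L); what is left
   is a word still damped by [c], hence bounded. *)
pose w x := \prod_(a <- s) degs x a * expR (- ((1 + c) * rate x)).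
have bw : bdm w by exact: bdm_word_exp.
have w0 x : 0 <= w x.
  by rewrite mulr_ge0 ?expR_ge0//; apply: prodr_ge0 => a _; exact: deg_ge0.
have degs0 x a : 0 <= degs x a by exact: deg_ge0.
have mp N : measurable_fun setT (poisson_masses N).
  have mr p : measurable_fun setT (fun x => pair_rate rho (degs x) p).
    rewrite /pair_rate; apply: measurable_funM => //.
    by apply: measurable_funM; exact: measurable_degs.
  rewrite /poisson_masses; under eq_fun do rewrite big_mkcond.
  apply: measurable_prod => p _; case: (p.1 <= p.2)%N; last exact: measurable_cst.
  apply: measurable_bigsum => a; rewrite /poisson_coef; case: (p.1 == p.2).
    apply: measurable_funM => //; apply: measurable_funM => //.
    by apply: measurable_funX; apply: measurable_funM.
  by apply: measurable_funM => //; exact: measurable_funX.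
have pm_ge0 N x : 0 <= poisson_masses N x.
  apply: prodr_ge0 => p _; apply: sumr_ge0 => a _.
  by apply: poisson_coef_ge0; exact: pair_rate_ge0.
have pm_le N x : poisson_masses N x <= expR (rate x).
  rewrite expR_rate; apply: ler_prod => p _.
  rewrite sum_poisson_coef_le ?andbT; last exact: pair_rate_ge0.
  apply: sumr_ge0 => a _.
  by apply: poisson_coef_ge0; exact: pair_rate_ge0.
have wE x : expR (rate x) * w x = \prod_(a <- s) degs x a * expR (- (c * rate x)).
  by rewrite /w mulrCA -expRD; congr (_ * expR _); ring.
have h1 : Ex mu (fun x => masses N.+1 x * w x) @[N --> \oo] --> Ex mu w.
  apply: (Ex_bct (C := C1)).
  - move=> N; apply: measurable_funM; last by case: bw.
    have b : bdm (masses N.+1) by apply: bdm_prod_pairs => p; exact: bdm_mass.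
    by case: b.
  - move=> N x; rewrite normrM (ger0_norm (w0 x)) -[leRHS]mul1r.
    apply: ler_pM => //; last exact: HC1.
    rewrite ger0_norm; first by apply: prodr_ile1 => p _; rewrite mass_ge0//= mass_le1.
    by apply: prodr_ge0 => p _; exact: mass_ge0.
  - move=> x; rewrite -[X in _ --> X]mul1r; apply: cvgM; last exact: cvg_cst.
    have := @cvg_bigprod _ _ (index_enum ('I_k * 'I_k)%type)
      (fun p : 'I_k * 'I_k => (p.1 <= p.2)%N)
      (fun N p => mass V N.+1 (tnth x p.1) (tnth x p.2)) (fun=> 1).
    rewrite big1_eq; apply=> p.
    by rewrite (cvg_shiftS (fun N => mass V N (tnth x p.1) (tnth x p.2))).
have h2 : Ex mu (fun x => q 0 x * (poisson_masses N.+1 x * w x)) @[N --> \oo] -->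
    Ex mu (fun x => q 0 x * (expR (rate x) * w x)).
  apply: (Ex_bct (C := C)).
  - move=> N; apply: measurable_funM; first by case: (bdm_q 0).
    by apply: measurable_funM => //; case: bw.
  - move=> N x; rewrite normrM -[leRHS]mul1r.
    apply: ler_pM => //; first by rewrite ger0_norm ?pattern_prob_ge0 ?pattern_prob_le1.
    rewrite ger0_norm; last by rewrite mulr_ge0.
    apply: (@le_trans _ _ (expR (rate x) * w x)); first exact: ler_wpM2r.
    by rewrite wE; exact: HC.
  - move=> x; apply: cvgM; first exact: cvg_cst.
    apply: cvgM; last exact: cvg_cst.
    rewrite expR_rate; apply: cvg_bigprod => p.
    rewrite (cvg_shiftS (fun N => \sum_(a < N)
      poisson_coef (p.1 == p.2) (pair_rate rho (degs x) p) a)).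
    exact: sum_poisson_coef_cvg.
under [LHS]eq_Ex do rewrite -wE.
apply: (cvg_unique _ h2) => //.
by move: h1; under eq_fun do rewrite (sum_patterns _ _ c1).
Qed.

Theorem density_poisson (A : 'M[nat]_k) : adjmx A ->
  density U V A = Ex mu (fun x => poisson_prod rho A (degs x) * expR (- rate x)).
Proof.
move=> aA; have [b [s [b0 E]]] := poisson_prod_word rho_gt0 A.
pose c (n : nat) : R := n.+1%:R^-1.
have c0 n : 0 < c n by rewrite invr_gt0.
have c_cvg : c n @[n --> \oo] --> (0 : R) by exact: cvg_harmonic.
have expc x : expR (- (c n * rate x)) @[n --> \oo] --> (1 : R).
  rewrite -expR0 -oppr0 -(mul0r (rate x)).
  apply: continuous_cvg; first exact: continuous_expR.
  by apply: cvgN; apply: cvgM => //; exact: cvg_cst.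
have rate0 x : 0 <= rate x by apply: total_rate_ge0 => // a; exact: deg_ge0.
have expc_le n x : expR (- (c n * rate x)) <= 1.
  by rewrite -expR0 ler_expR oppr_le0 mulr_ge0// ltW.
(* The factor exp(- L) is itself a damping with [c = 1], so this bound survives when [c] tends to
   0. *)
have bp : bdm (fun x => poisson_prod rho A (degs x) * expR (- rate x)).
  have := bdm_poisson_word_exp A [::] ltr01.
  by under eq_fun do rewrite big_nil !mul1r.
(* The Poisson product is [b] times the word [s], to which [empty_pattern] applies; the exponent
   [1 + c n] splits into the missing Poisson factor and the damping. *)
have key n : Ex mu (fun x => q A x * expR (- (c n * rate x))) =
    Ex mu (fun x => (poisson_prod rho A (degs x) * expR (- rate x)) * expR (- (c n * rate x))).
  have := pattern_to_empty [::] aA (c0 n).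
  under eq_Ex do rewrite big_nil mul1r; move=> ->.
  transitivity (b * Ex mu (fun x => q 0 x *
      (\prod_(a <- s) degs x a * expR (- (c n * rate x))))).
    rewrite -ExZl; last first.
      by apply: bdm_integrable; apply: bdmM; [exact: bdm_q|exact: bdm_word_exp].
    by apply: eq_Ex => x; rewrite big_nil E; ring.
  rewrite empty_pattern// -ExZl; last first.
    by apply: bdm_integrable; apply: bdm_word_exp; rewrite addr_gt0.
  apply: eq_Ex => x; rewrite E mulrDl mul1r opprD expRD; ring.
have me n : measurable_fun setT (fun x => expR (- (c n * rate x))).
  have := bdm_word_exp [::] (c0 n); under eq_fun do rewrite big_nil mul1r.
  by case.
have h1 : Ex mu (fun x => q A x * expR (- (c n * rate x))) @[n --> \oo] --> density U V A.
  apply: (Ex_bct (C := 1)).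
  - by move=> n; apply: measurable_funM => //; case: (bdm_q A).
  - move=> n x; rewrite ger0_norm; last by rewrite mulr_ge0 ?expR_ge0 ?pattern_prob_ge0.
    by rewrite mulr_ile1 ?expR_ge0 ?pattern_prob_ge0 ?pattern_prob_le1.
  - by move=> x; rewrite -[X in _ --> X]mulr1; apply: cvgM => //; exact: cvg_cst.
move: h1; under eq_fun do rewrite key.
move=> h1; apply: (cvg_unique _ h1) => //.
have [mp [C HC]] := bp.
apply: (Ex_bct (C := C)).
- by move=> n; exact: measurable_funM.
- move=> n x; rewrite normrM -[leRHS]mulr1; apply: ler_pM => //.
  by rewrite ger0_norm ?expR_ge0.
- by move=> x; rewrite -[X in _ --> X]mulr1; apply: cvgM => //; exact: cvg_cst.
Qed.

End Pattern.
End PoissonLimit.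

Lemma eq_set2 (T : finType) (p q i j : T) :
  ([set p; q]%SET == [set i; j]%SET) = (i == p) && (j == q) || (i == q) && (j == p).
Proof.
apply/eqP/orP => [E|[/andP[/eqP-> /eqP->]|/andP[/eqP-> /eqP->]]//]; last by rewrite finset.setUC.
have : p \in [set i; j]%SET by rewrite -E !inE eqxx.
have : q \in [set i; j]%SET by rewrite -E !inE eqxx orbT.
have : i \in [set p; q]%SET by rewrite E !inE eqxx.
have : j \in [set p; q]%SET by rewrite E !inE eqxx orbT.
by rewrite !inE !(eq_sym p) !(eq_sym q); case: (j == p); case: (j == q);
  case: (i == p); case: (i == q) => //=; auto.
Qed.

(** * Switchings in the configuration model *)

Section Matchings.
Variables (n : nat) (D : {ffun 'I_n -> nat}).
Local Notation stub := (stub D).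
Implicit Types (M : {set {set stub}}) (e : {set stub}) (s t u v : stub).
Local Open Scope nat_scope.

Definition edge_weight (i j : 'I_n) e : nat :=
  (if i == j then 2 else 1) * ([set tag x | x in e]%SET == [set i; j]%SET).

Lemma matching_adjmxE M i j :
  matching_adjmx M i j = \sum_(e in M) edge_weight i j e.
Proof.
rewrite mxE /edges_between cardsE -sum1_card big_distrr/=.
rewrite big_mkcondr/=; apply: eq_bigr => e _; rewrite /edge_weight.
by case: (_ == [set i; j]%SET); rewrite ?muln1 ?muln0.
Qed.

Lemma edge_weight_set2 i j s t : edge_weight i j [set s; t] = edgemx (tag s) (tag t) i j.
Proof.
rewrite /edge_weight imsetU1 imset_set1 mxE; set p := tag s; set q := tag t.
rewrite eq_set2.
have [->|ij] := eqVneq i j; first by case: (j == p); case: (j == q).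
have h r : (i == r) && (j == r) = false.
  by apply/negP => /andP[/eqP ir /eqP jr]; move: ij; rewrite ir jr eqxx.
by move: (h p) (h q); case: (i == p); case: (j == p); case: (i == q); case: (j == q).
Qed.

Lemma perfect_matchingP M : reflect
  [/\ forall e, e \in M -> #|e| = 2, forall x, exists2 e, e \in M & x \in e &
      forall e e' x, e \in M -> e' \in M -> x \in e -> x \in e' -> e = e']
  (M \in perfect_matchings D).
Proof.
rewrite inE; apply: (iffP andP) => [[/and3P[/eqP cM tM M0] /forall_inP M2]|[M2 cM tM]].
  split=> [e /M2/eqP //|x|e e' x eM e'M xe xe'].
    have : x \in finset.cover M by rewrite cM inE.
    by case/finset.bigcupP => e eM xe; exists e.
  by rewrite -(def_pblock tM eM xe) (def_pblock tM e'M xe').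
split; last by apply/forall_inP => e /M2 ->.
apply/and3P; split.
- apply/eqP/finset.setP => x; rewrite inE; have [e eM xe] := cM x.
  by apply/finset.bigcupP; exists e.
- apply/finset.trivIsetP => e e' eM e'M; apply: contraNT => /pred0Pn[x /andP[xe xe']].
  by apply/eqP; exact: (tM e e' x).
- by apply/negP => /M2; rewrite cards0.
Qed.

(** A switching is encoded as the action of a transposition of two stubs, so that it visibly
    preserves perfect matchings and is its own inverse. *)
Definition relabel (f : {perm stub}) M : {set {set stub}} :=
  [set [set f x | x in e]%SET | e : {set stub} in M]%SET.

Lemma relabel_matching (f : {perm stub}) M :
  M \in perfect_matchings D -> relabel f M \in perfect_matchings D.
Proof.
move=> /perfect_matchingP[M2 cM tM]; apply/perfect_matchingP; split.
- by move=> _ /imsetP[e eM ->]; rewrite card_imset ?M2//; exact: perm_inj.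
- move=> x; have [e eM xe] := cM ((f^-1)%g x).
  exists [set f y | y in e]%SET; first exact: imset_f.
  by apply/imsetP; exists ((f^-1)%g x); rewrite // permKV.
- move=> _ _ x /imsetP[e eM ->] /imsetP[e' e'M ->] /imsetP[y ye ->] /imsetP[z ze' /perm_inj yz].
  by rewrite (tM e e' y)// yz.
Qed.

Lemma relabelK t u : involutive (relabel (tperm t u)).
Proof.
have K : involutive (fun e : {set stub} => [set tperm t u x | x in e]%SET).
  move=> e; rewrite -imset_comp -[RHS]imset_id.
  by apply: eq_imset => x /=; rewrite tpermK.
by move=> M; rewrite /relabel -imset_comp -[RHS]imset_id; apply: eq_imset => e /=; rewrite K.
Qed.

Lemma tperm_set2 t u s : s != t -> s != u ->
  [set tperm t u x | x in [set s; t]]%SET = [set s; u]%SET.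
Proof.
by move=> st su; rewrite imsetU1 imset_set1 tpermL tpermD// eq_sym.
Qed.

Lemma adjmx_relabel M s t u v : M \in perfect_matchings D ->
  [set s; t]%SET \in M -> [set u; v]%SET \in M -> [set s; t]%SET != [set u; v]%SET ->
  (relabel (tperm t u) M \in perfect_matchings D) /\
  exists A0 : 'M[nat]_n,
  [/\ matching_adjmx M = (A0 + edgemx (tag s) (tag t) + edgemx (tag u) (tag v))%R,
      matching_adjmx (relabel (tperm t u) M) =
        (A0 + edgemx (tag s) (tag u) + edgemx (tag t) (tag v))%R,
      [set s; u]%SET \in relabel (tperm t u) M & [set t; v]%SET \in relabel (tperm t u) M].
Proof.
move=> PM stM uvM stuv; split; first exact: relabel_matching.
have [M2 cM tM] := perfect_matchingP _ PM.
have disj x : x \in [set s; t]%SET -> x \in [set u; v]%SET -> False.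
  by move=> xs xu; case/eqP: stuv; exact: (tM _ _ x).
have ne x y : x \in [set s; t]%SET -> y \in [set u; v]%SET -> x != y.
  by move=> xs yu; apply/eqP => xy; apply: (disj x) => //; rewrite xy.
have st : s != t by have := M2 _ stM; rewrite cards2; case: eqP.
have uv : u != v by have := M2 _ uvM; rewrite cards2; case: eqP.
have [su sv tu tv] : [/\ s != u, s != v, t != u & t != v].
  by split; apply: ne; rewrite !inE eqxx ?orbT.
have Est : [set tperm t u x | x in [set s; t]]%SET = [set s; u]%SET by exact: tperm_set2.
have Euv : [set tperm t u x | x in [set u; v]]%SET = [set t; v]%SET.
  rewrite tpermC finset.setUC tperm_set2 1?finset.setUC//; first by rewrite eq_sym.
  by rewrite eq_sym.
(* The adjacency matrix of the edges that the switching leaves alone. *)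
exists (\matrix_(i, j) \sum_(e in M | (e != [set s; t]%SET) && (e != [set u; v]%SET))
  edge_weight i j e).
split.
- apply/matrixP => i j.
  rewrite matching_adjmxE [RHS]mxE [X in _ = (X + _)%R]mxE [X in _ = (X + _ + _)%R]mxE.
  rewrite (bigD1 [set s; t]%SET)//= (bigD1 [set u; v]%SET)/=; last first.
    by rewrite uvM eq_sym stuv.
  rewrite !edge_weight_set2 -![(_ + _)%R]/(_ + _) addnA addnC addnA.
  by congr (_ + _ + _); apply: eq_bigl => e; rewrite andbA.
- apply/matrixP => i j.
  rewrite matching_adjmxE [RHS]mxE [X in _ = (X + _)%R]mxE [X in _ = (X + _ + _)%R]mxE.
  rewrite big_imset/=; last first.
    by move=> e e' _ _; apply: imset_inj; exact: perm_inj.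
  rewrite (bigD1 [set s; t]%SET)//= (bigD1 [set u; v]%SET)/=; last first.
    by rewrite uvM eq_sym stuv.
  rewrite Est Euv !edge_weight_set2 -![(_ + _)%R]/(_ + _) addnA addnC addnA.
  congr (_ + _ + _).
  rewrite [LHS](eq_bigl (fun e => [&& e \in M, e != [set s; t]%SET & e != [set u; v]%SET])); last first.
    by move=> e; rewrite andbA.
  apply: eq_bigr => e /and3P[eM est euv]; congr edge_weight.
  (* An edge containing [t] or [u] would be one of the two switched ones; every other edge is fixed
     pointwise. *)
  rewrite -[RHS]imset_id; apply: eq_in_imset => x xe /=; rewrite tpermD//.
    apply: contraNneq est => tx; apply/eqP; apply: (tM _ _ x) => //.
    by rewrite -tx !inE eqxx orbT.
  apply: contraNneq euv => tx; apply/eqP; apply: (tM _ _ x) => //.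
  by rewrite -tx !inE eqxx.
- by rewrite -Est; exact: imset_f.
- by rewrite -Euv; exact: imset_f.
Qed.

(** A loop is found from either of its two stubs, in agreement with the 2 it contributes to the
    diagonal. *)
Lemma sum_matched_pairs M i j : M \in perfect_matchings D ->
  \sum_(s | tag s == i) \sum_(t | tag t == j) ([set s; t]%SET \in M : nat) =
  matching_adjmx M i j.
Proof.
move=> /perfect_matchingP[M2 cM tM]; rewrite matching_adjmxE.
transitivity (\sum_(e in M) \sum_(s | tag s == i) \sum_(t | tag t == j)
    (e == [set s; t]%SET : nat)).
  rewrite [RHS]exchange_big; apply: eq_bigr => s _.
  rewrite [RHS]exchange_big; apply: eq_bigr => t _.
  case: (boolP ([set s; t]%SET \in M)) => stM.
    rewrite (bigD1 [set s; t]%SET)//= eqxx big1 ?addn0// => e /andP[_ /negbTE -> //].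
  rewrite big1// => e eM; case: eqP => // est; move: stM; by rewrite -est eM.
apply: eq_bigr => e eM.
have /eqP/cards2P[p [q [pq ->]]] := M2 _ eM.
rewrite edge_weight_set2 mxE.
pose G s t := (tag s == i) && (tag t == j) && ([set p; q]%SET == [set s; t]%SET).
transitivity (\sum_s \sum_t (G s t : nat)).
  rewrite big_mkcond/=; apply: eq_bigr => s _; case: ifP => si.
    rewrite big_mkcond/=; apply: eq_bigr => t _; case: ifP => tj; by rewrite /G si tj.
  by rewrite big1// => t _; rewrite /G si.
have G1 s : s != p -> s != q -> \sum_t (G s t : nat) = 0.
  by move=> sp sq; apply: big1 => t _; rewrite /G eq_set2 (negbTE sp) (negbTE sq) andbF.
have qp : q != p by rewrite eq_sym.
rewrite (bigD1 p)//= (bigD1 q qp)/= [X in _ + (_ + X)]big1 => [|s /andP[sp sq]]; last exact: G1.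
rewrite addn0; congr (_ + _).
  rewrite (bigD1 q)//= big1 ?addn0; last first.
    by move=> t tq; rewrite /G eq_set2 eqxx (negbTE tq) (negbTE pq) /= andbF.
  by rewrite /G eq_set2 !eqxx /= andbT (eq_sym i) (eq_sym j).
rewrite (bigD1 p)//= big1 ?addn0; last first.
  by move=> t tp; rewrite /G eq_set2 eqxx (negbTE tp) (negbTE qp) /= andbF.
by rewrite /G eq_set2 !eqxx orbT andbT (eq_sym i) (eq_sym j).
Qed.

Local Notation num_matchings B := #|[set M in perfect_matchings D | matching_adjmx M == B]%SET|.

(** Double counting of matchings with two marked edges whose ends are ordered: the origin of the
    coefficients of the switching identity. *)
Lemma matched_quadruples (B : 'M[nat]_n) (a b c e : 'I_n) :
  B a b * B c e * num_matchings B =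
  \sum_(s | tag s == a) \sum_(t | tag t == b) \sum_(u | tag u == c) \sum_(v | tag v == e)
    #|[set M in perfect_matchings D | [&& matching_adjmx M == B,
        [set s; t]%SET \in M & [set u; v]%SET \in M]]%SET|.
Proof.
transitivity (\sum_(M in [set M in perfect_matchings D | matching_adjmx M == B]%SET)
  (\sum_(s | tag s == a) \sum_(t | tag t == b) ([set s; t]%SET \in M : nat)) *
  (\sum_(u | tag u == c) \sum_(v | tag v == e) ([set u; v]%SET \in M : nat))).
  rewrite mulnC -sum_nat_const; apply: eq_bigr => M; rewrite inE => /andP[PM /eqP MB].
  by rewrite !sum_matched_pairs// MB.
under eq_bigr do rewrite big_distrl/=.
rewrite exchange_big/=; apply: eq_bigr => s _.
under eq_bigr do rewrite big_distrl/=.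
rewrite exchange_big/=; apply: eq_bigr => t _.
under eq_bigr do rewrite big_distrr/=.
rewrite exchange_big/=; apply: eq_bigr => u _.
under eq_bigr do rewrite big_distrr/=.
rewrite exchange_big/=; apply: eq_bigr => v _.
rewrite -sum1_card big_mkcond [RHS]big_mkcond/=; apply: eq_bigr => M _.
rewrite !finset.in_set; case: (finset.partition _ _ && _) => //=.
case: (matching_adjmx M == B) => //=.
by case: ([set s; t]%SET \in M); case: ([set u; v]%SET \in M).
Qed.

Lemma addmxI (A B C : 'M[nat]_n) : (A + C)%R = (B + C)%R -> A = B.
Proof.
move/matrixP => E; apply/matrixP => i j; have := E i j.
by rewrite mxE [in X in _ = X -> _]mxE => /addIn.
Qed.

(** For fixed stubs [s], [t], [u], [v], the transposition of [t] and [u] maps the matchings counted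
    on each side injectively into those counted on the other. *)
Lemma num_matchings_switch (B0 : 'M[nat]_n) (a b c e : 'I_n) :
  [&& c != e, c != a, c != b, e != a & e != b] ->
  let B := (B0 + edgemx a b + edgemx c e)%R in
  let B' := (B0 + edgemx a c + edgemx b e)%R in
  B a b * B c e * num_matchings B = B' a c * B' b e * num_matchings B'.
Proof.
move=> ne B B'; rewrite !matched_quadruples.
apply: eq_bigr => s /eqP sa; rewrite exchange_big/=.
apply: eq_bigr => u /eqP uc; apply: eq_bigr => t /eqP tb; apply: eq_bigr => v /eqP ve.
have tags : [/\ tag s != tag u, tag s != tag v, tag t != tag u, tag t != tag v & tag u != tag v].
  by case/and5P: ne => ce ca cb ea eb; rewrite sa tb uc ve !(eq_sym a) !(eq_sym b).
case: tags => su sv tu tv uv.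
have neq (x y z w : stub) : tag x != tag z -> tag x != tag w -> [set x; y]%SET != [set z; w]%SET.
  move=> xz xw; apply/eqP => E; have : x \in [set z; w]%SET by rewrite -E !inE eqxx.
  by rewrite !inE => /orP[] /eqP xe; [move: xz|move: xw]; rewrite xe eqxx.
apply/eqP; rewrite eqn_leq; apply/andP; split.
  rewrite -(card_imset _ (inv_inj (relabelK t u))); apply: subset_leq_card.
  apply/fintype.subsetP => _ /imsetP[M + ->]; rewrite finset.in_set => /andP[PM /and3P[/eqP MB stM uvM]].
  have [PM' [A0 [E1 E2 suM tvM]]] := adjmx_relabel PM stM uvM (neq _ _ _ _ su sv).
  rewrite finset.in_set PM' suM tvM /= andbT; apply/eqP.
  (* Cancelling the two edges identifies the untouched part [A0] with [B0]. *)
  have := E1; rewrite MB /B E2 /B' sa tb uc ve => /addmxI/addmxI ->//.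
rewrite -(card_imset _ (inv_inj (relabelK u t))); apply: subset_leq_card.
apply/fintype.subsetP => _ /imsetP[M + ->]; rewrite finset.in_set => /andP[PM /and3P[/eqP MB suM tvM]].
have st : [set s; u]%SET != [set t; v]%SET.
  rewrite finset.setUC; apply: neq; first by rewrite eq_sym.
  exact: uv.
have [PM' [A0 [E1 E2 stM uvM]]] := adjmx_relabel PM suM tvM st.
rewrite finset.in_set PM' stM uvM /= andbT; apply/eqP.
have := E1; rewrite MB /B' E2 /B sa tb uc ve => /addmxI/addmxI ->//.
Qed.

End Matchings.

Section ConfigModel.
Variables (R : realType) (n : nat).

Lemma config_model_switch (D : {ffun 'I_n -> nat}) (B0 : 'M[nat]_n) (a b c e : 'I_n) :
  [&& c != e, c != a, c != b, e != a & e != b] ->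
  let B := B0 + edgemx a b + edgemx c e in
  let B' := B0 + edgemx a c + edgemx b e in
  (B a b * B c e)%:R * config_model R D B = (B' a c * B' b e)%:R * config_model R D B'.
Proof.
move=> ne B B'; rewrite /config_model !mulrA -!natrM; congr (_%:R / _).
exact: num_matchings_switch.
Qed.

Lemma degseq_edge (B : 'M[nat]_n) (a b i : 'I_n) :
  degseq (B + edgemx a b) i = (degseq B i + (i == a) + (i == b))%N.
Proof.
rewrite !ffunE.
under eq_bigr do rewrite mxE -[_ + _]/(_ + _)%N [X in (_ + X)%N]mxE.
rewrite !big_split/= -addnA; congr (_ + _)%N.
have E x y : (\sum_j ((i == x) && (j == y)))%N = (i == x) :> nat.
  rewrite (bigD1 y)//= eqxx andbT big1 ?addn0// => j jy.
  by rewrite (negbTE jy) andbF.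
by rewrite !E.
Qed.

Lemma degseq_switch (B0 : 'M[nat]_n) (a b c e : 'I_n) :
  degseq (B0 + edgemx a b + edgemx c e) = degseq (B0 + edgemx a c + edgemx b e).
Proof.
by apply/ffunP => i; rewrite !degseq_edge; lia.
Qed.

End ConfigModel.

(** * Sampling vertices *)

Section Sampling.
Context (d : measure_display) (T : measurableType d) (R : realType).
Variables (P : probability T R) (n : nat) (X : T -> 'M[nat]_n).
Hypothesis X_random : random_adjmx X.
Hypothesis X_stat : edge_stationary P X.

Lemma measurable_adjmx_preimage (S : set 'M[nat]_n) : measurable (X @^-1` S).
Proof.
rewrite (_ : _ @^-1` _ = \bigcup_(B : 'M[nat]_n) (if `[< S B >] then X @^-1` [set B] else set0)).
  apply: countable_bigcupT_measurable => [|B]; first exact: countableP.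
  by case: ifP => // _; exact: (X_random.2).
apply/seteqP; split => [w Sw|w [B _]].
  by exists (X w) => //; rewrite asboolT.
by case: asboolP => // SB /= ->.
Qed.

Let p (B : 'M[nat]_n) : R := fine (P [set w | X w = B]).

Lemma prob_fin (S : set T) : measurable S -> P S \is a fin_num.
Proof. by move=> mS; exact: fin_num_measure. Qed.

(** Edge stationarity with the conditioning multiplied out. A degree sequence of probability 0,
    about which the hypothesis is silent, makes both sides 0. *)
Lemma adjmx_prob_config (B : 'M[nat]_n) :
  p B = fine (P [set w | degseq (X w) = degseq B]) * config_model R (degseq B) B.
Proof.
set D := degseq B.
have mD : measurable [set w | degseq (X w) = D].
  exact: (measurable_adjmx_preimage [set C | degseq C = D]).
have mB : measurable [set w | X w = B] by exact: (measurable_adjmx_preimage [set B]).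
have BD : [set w | X w = B] `&` [set w | degseq (X w) = D] = [set w | X w = B].
  by apply/seteqP; split => [w []//|w /= XB]; rewrite XB.
have [P0|P0] := eqVneq (P [set w | degseq (X w) = D]) 0%E.
  rewrite /p P0 mul0r; suff -> : P [set w | X w = B] = 0%E by [].
  by apply: (subset_measure0 mB mD _ P0) => w /= ->.
have := X_stat P0 B; rewrite BD => <-; rewrite mulrC divfK//.
by rewrite fine_eq0// prob_fin.
Qed.

Lemma adjmx_prob_switch (B0 : 'M[nat]_n) (a b c e : 'I_n) :
  [&& c != e, c != a, c != b, e != a & e != b] ->
  let B := B0 + edgemx a b + edgemx c e in
  let B' := B0 + edgemx a c + edgemx b e in
  (B a b * B c e)%:R * p B = (B' a c * B' b e)%:R * p B'.
Proof.
move=> ne B B'; rewrite !adjmx_prob_config mulrCA [RHS]mulrCA.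
rewrite (degseq_switch B0 a b c e : degseq B = degseq B'); congr (_ * _).
exact: config_model_switch.
Qed.

Variable k : nat.

Definition sampled (phi : {ffun 'I_k -> 'I_n}) (A : 'M[nat]_k) (B : 'M[nat]_n) : bool :=
  [forall i, forall j, A i j == B (phi i) (phi j)].

Lemma sampled_edgemx (phi : {ffun 'I_k -> 'I_n}) i j a b : injective phi ->
  edgemx (phi i) (phi j) (phi a) (phi b) = edgemx i j a b.
Proof. by move=> inj; rewrite !mxE !(inj_eq inj). Qed.

Lemma edgemx_image (phi : {ffun 'I_k -> 'I_n}) i j x y :
  edgemx (phi i) (phi j) x y != 0%N -> exists a b, x = phi a /\ y = phi b.
Proof.
rewrite mxE addn_eq0 negb_and => /orP[]; rewrite eqb0 negbK => /andP[/eqP-> /eqP->].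
  by exists i, j.
by exists j, i.
Qed.

Lemma sampledD (phi : {ffun 'I_k -> 'I_n}) (A0 : 'M[nat]_k) B0 i j l m : injective phi ->
  sampled phi (A0 + edgemx i j + edgemx l m)
    (B0 + edgemx (phi i) (phi j) + edgemx (phi l) (phi m)) = sampled phi A0 B0.
Proof.
move=> inj; apply: eq_forallb => a; apply: eq_forallb => b.
rewrite [X in X == _]mxE [X in (X + _)%R == _]mxE.
rewrite [X in _ == X]mxE [X in _ == (X + _)%R]mxE !sampled_edgemx//.
by rewrite -![(_ + _)%R]/(_ + _)%N !eqn_add2r.
Qed.

(* The event that [X] restricted to [phi] is [A0 + edges], as a disjoint union
   over the matrices [B0] left after removing the two edges from [X]. *)
Let piece (phi : {ffun 'I_k -> 'I_n}) (A0 : 'M[nat]_k) (E : 'M[nat]_n) (m : nat) : set T :=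
  if (pickle_inv m : option 'M[nat]_n) is Some B0 then
    if sampled phi A0 B0 then [set w | X w = B0 + E] else set0 else set0.

Lemma measurable_piece phi A0 E m : measurable (piece phi A0 E m).
Proof.
rewrite /piece; case: pickle_inv => // B0; case: ifP => // _.
exact: (measurable_adjmx_preimage [set B0 + E]).
Qed.

Lemma prob_sampled (phi : {ffun 'I_k -> 'I_n}) (A0 : 'M[nat]_k) i j l m : injective phi ->
  P [set w | sampled phi (A0 + edgemx i j + edgemx l m) (X w)] =
  (\sum_(0 <= N <oo) P (piece phi A0
    (edgemx (phi i) (phi j) + edgemx (phi l) (phi m))%R N))%E.
Proof.
move=> inj; set E := _ + edgemx (phi l) (phi m).
have -> : [set w | sampled phi (A0 + edgemx i j + edgemx l m) (X w)] =
    \bigcup_N piece phi A0 E N.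
  apply/seteqP; split => [w /= sw|w [N _]]; last first.
    rewrite /piece; case: pickle_inv => // B0; case: ifP => // sB /= ->.
    by rewrite addrA sampledD.
  (* The subtraction of naturals is exact: off the image of [phi] the matrix [E] vanishes, and on it
     [X w] equals [A0] plus the two edges. *)
  pose B0 : 'M[nat]_n := \matrix_(a, b) (X w a b - E a b)%N.
  have XE : X w = B0 + E.
    apply/matrixP => x y; rewrite [RHS]mxE mxE -[RHS]/(_ + _)%N subnK//.
    have [->//|Exy] := eqVneq (E x y) 0%N.
    have [a [b [-> ->]]] : exists a b, x = phi a /\ y = phi b.
      move: Exy; rewrite /E mxE -[_ + _]/(_ + _)%N addn_eq0 negb_and => /orP[]; exact: edgemx_image.
    move/forallP/(_ a)/forallP/(_ b)/eqP: sw => <-.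
    rewrite /E [X in (X <= _)%N]mxE !sampled_edgemx// [X in (_ <= X)%N]mxE [X in (_ <= X + _)%N]mxE.
    by rewrite -![(_ + _)%R]/(_ + _)%N -addnA leq_addl.
  exists (pickle B0) => //; rewrite /piece pickleK_inv.
  have -> : sampled phi A0 B0.
    by have := sampledD A0 B0 i j l m inj; rewrite -[X in sampled _ _ X = _]addrA -/E -XE => <-.
  exact: XE.
rewrite measure_bigcup.
- by apply: eq_eseriesl => N; rewrite in_setT.
- by move=> N _; exact: measurable_piece.
- apply/trivIsetP => N N' _ _; apply: contraNeq => /set0P[w []].
  rewrite /piece; case E1: (pickle_inv N) => [B|]//; case: ifP => // _ /= XB.
  case E2: (pickle_inv N') => [B'|]//; case: ifP => // _ /= XB'.
  have BB' : B = B' by apply: (@addmxI _ _ _ E); rewrite -XB -XB'.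
  have := @pickle_invK 'M[nat]_n N; rewrite E1 /= => <-.
  by have := @pickle_invK 'M[nat]_n N'; rewrite E2 /= => <-; rewrite BB'.
Qed.

Let prs phi A : R := fine (P [set w | sampled phi A (X w)]).

(** The entries entering the coefficients lie on the image of [phi], so they are those of the
    pattern for every remainder [B0], and the switching of probabilities can be summed over [B0]. *)
Lemma prob_sampled_switch (phi : {ffun 'I_k -> 'I_n}) (A0 : 'M[nat]_k) i j l m :
  injective phi ->
  [&& l != m, l != i, l != j, m != i & m != j] ->
  let A := A0 + edgemx i j + edgemx l m in
  let A' := A0 + edgemx i l + edgemx j m in
  (A i j * A l m)%:R * prs phi A = (A' i l * A' j m)%:R * prs phi A'.
Proof.
move=> inj ne A A'.
have mS B : measurable [set w | sampled phi B (X w)].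
  exact: (measurable_adjmx_preimage [set C | sampled phi B C]).
suff : ((A i j * A l m)%:R%:E * P [set w | sampled phi A (X w)] =
    (A' i l * A' j m)%:R%:E * P [set w | sampled phi A' (X w)])%E.
  move=> h; have := congr1 fine h.
  by rewrite !fineM//; exact: prob_fin.
rewrite !prob_sampled// -!nneseriesZl; try by move=> *; exact: measure_ge0.
apply: eq_eseriesr => N _; rewrite /piece.
case: pickle_inv => [B0|]; last by rewrite !measure0 !mule0.
case: (boolP (sampled _ _ _)) => sB; last by rewrite !measure0 !mule0.
have ne' : [&& phi l != phi m, phi l != phi i, phi l != phi j, phi m != phi i & phi m != phi j].
  by rewrite !(inj_eq inj).
have := adjmx_prob_switch B0 ne'; rewrite /= /p.
have AB i1 j1 i2 j2 a b : (B0 + edgemx (phi i1) (phi j1) + edgemx (phi i2) (phi j2)) (phi a) (phi b) =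
    (A0 + edgemx i1 j1 + edgemx i2 j2) a b.
  have := sampledD A0 B0 i1 j1 i2 j2 inj; rewrite sB.
  by move/forallP/(_ a)/forallP/(_ b)/eqP => ->.
rewrite !AB -/A -/A' !addrA => h.
have mX B : measurable [set w | X w = B] by exact: (measurable_adjmx_preimage [set B]).
by have := congr1 EFin h; rewrite !EFinM !fineK//; exact: prob_fin.
Qed.

Definition mean_density (A : 'M[nat]_k) : R := Ex P (fun w => hom_density R A (X w)).

Lemma indic_sampledE phi (A : 'M[nat]_k) : (fun w => (sampled phi A (X w))%:R : R) =
  \1_[set w | sampled phi A (X w)].
Proof.
apply/funext => w; rewrite indicE; congr (_%:R).
by case: (boolP (sampled _ _ _)) => h; [rewrite mem_set|rewrite memNset//; apply/negP].
Qed.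

Lemma bdm_sampled phi (A : 'M[nat]_k) : bdm (fun w => (sampled phi A (X w))%:R : R).
Proof.
split; last by exists 1 => w; case: sampled; rewrite ?normr1 ?normr0.
rewrite indic_sampledE; apply: measurable_indic.
exact: (measurable_adjmx_preimage [set C | sampled phi A C]).
Qed.

Lemma bdm_hom_density (A : 'M[nat]_k) : bdm (fun w => hom_density R A (X w)).
Proof.
apply: bdmM; last exact: bdm_cst.
by apply: bdm_sum => phi _; exact: bdm_sampled.
Qed.

Lemma mean_densityE (A : 'M[nat]_k) : mean_density A = (\sum_phi prs phi A) / n%:R ^+ k.
Proof.
have bs phi : P.-integrable setT (EFin \o (fun w => (sampled phi A (X w))%:R : R)).
  by apply: bdm_integrable; exact: bdm_sampled.
transitivity (Ex P (fun w => n%:R ^- k * \sum_(phi : {ffun 'I_k -> 'I_n})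
    (sampled phi A (X w))%:R)).
  by apply: eq_Ex => w; rewrite mulrC.
rewrite ExZl; last first.
  by apply: bdm_integrable; apply: bdm_sum => phi _; exact: bdm_sampled.
rewrite mulrC Ex_sum//; congr (_ / _); apply: eq_bigr => phi _.
rewrite /prs indic_sampledE /Ex /Rintegral integral_indic//; first by rewrite setIT.
exact: (measurable_adjmx_preimage [set C | sampled phi A C]).
Qed.

Lemma prs01 phi (A : 'M[nat]_k) : 0 <= prs phi A <= 1.
Proof.
rewrite fine_ge0//= -lee_fin fineK; last first.
  by apply: prob_fin; exact: (measurable_adjmx_preimage [set C | sampled phi A C]).
by apply: probability_le1; exact: (measurable_adjmx_preimage [set C | sampled phi A C]).
Qed.

(** Injective samples cancel exactly. The others form the proportion on the right, and each of them
    costs at most [c + c']. *)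
Lemma mean_density_switch (A0 : 'M[nat]_k) i j l m : (0 < n)%N ->
  [&& l != m, l != i, l != j, m != i & m != j] ->
  let A := A0 + edgemx i j + edgemx l m in
  let A' := A0 + edgemx i l + edgemx j m in
  let c := (A i j * A l m)%:R in let c' := (A' i l * A' j m)%:R in
  `|c * mean_density A - c' * mean_density A'| <=
  (c + c') * (1 - (n ^_ k)%:R / n%:R ^+ k).
Proof.
move=> n0 ne; cbv zeta.
set A := A0 + edgemx i j + edgemx l m; set A' := A0 + edgemx i l + edgemx j m.
set c := (A i j * A l m)%:R; set c' := (A' i l * A' j m)%:R; rewrite !mean_densityE.
have nk : 0 < n%:R ^+ k :> R by rewrite exprn_gt0// ltr0n.
have -> : c * ((\sum_phi prs phi A) / n%:R ^+ k) - c' * ((\sum_phi prs phi A') / n%:R ^+ k) =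
    (\sum_phi (c * prs phi A - c' * prs phi A')) / n%:R ^+ k.
  by rewrite sumrB -!mulr_sumr; ring.
have -> : 1 - (n ^_ k)%:R / n%:R ^+ k =
    (\sum_(phi : {ffun 'I_k -> 'I_n} | ~~ injectiveb phi) 1) / n%:R ^+ k :> R.
  have E : \sum_(phi : {ffun 'I_k -> 'I_n}) 1 = n%:R ^+ k :> R.
    by rewrite sumr_const card_ffun !card_ord -natrX.
  rewrite -E (bigID (fun phi : {ffun 'I_k -> 'I_n} => injectiveb phi))/= in nk *.
  have <- : \sum_(phi : {ffun 'I_k -> 'I_n} | injectiveb phi) 1 = (n ^_ k)%:R :> R.
    have := card_inj_ffuns 'I_k 'I_n; rewrite !card_ord => <-.
    by rewrite sumr_const cardsE.
  by field; rewrite gt_eqF.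
rewrite normrM [X in _ * X]ger0_norm ?invr_ge0 ?(ltW nk)// mulrA.
apply: ler_wpM2r; first by rewrite invr_ge0 ltW.
rewrite (bigID (fun phi : {ffun 'I_k -> 'I_n} => injectiveb phi))/= big1 ?add0r; last first.
  move=> phi /injectiveP inj; apply/eqP; rewrite subr_eq0; apply/eqP.
  exact: prob_sampled_switch.
apply: le_trans (ler_norm_sum _ _ _) _; rewrite mulr_sumr; apply: ler_sum => phi _.
have /andP[a0 a1] := prs01 phi A; have /andP[b0 b1] := prs01 phi A'.
have c0 : 0 <= c by exact: ler0n.
have c'0 : 0 <= c' by exact: ler0n.
rewrite mulr1; apply: le_trans (ler_normB _ _) _.
by rewrite !normrM !ger0_norm//; apply: lerD; rewrite -[leRHS]mulr1 ler_wpM2l.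
Qed.

End Sampling.

(** * From samples of finite multigraphs to the limit *)

Section SampleLimit.
Context (R : realType).

Lemma ffact_ratio_cvg k : (n ^_ k)%:R / n%:R ^+ k @[n --> \oo] --> (1 : R).
Proof.
have h : \prod_(i < k) (1 - i%:R / n%:R) @[n --> \oo] --> (1 : R).
  have := @cvg_bigprod R _ (index_enum 'I_k) predT (fun n i => 1 - i%:R / n%:R) (fun=> 1).
  rewrite big1_eq; apply=> i; rewrite -[X in _ --> X]subr0; apply: cvgB; first exact: cvg_cst.
  rewrite -[X in _ --> X](mulr0 (i%:R)); apply: cvgM; first exact: cvg_cst.
  by rewrite -(cvg_shiftS (fun n => n%:R^-1 : R)); exact: cvg_harmonic.
apply: cvg_trans h; apply: near_eq_cvg; near=> n.
have kn : (k < n)%N by near: n; exact: nbhs_infty_gt.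
have -> : n%:R ^+ k = \prod_(i < k) n%:R :> R by rewrite prodr_const card_ord.
rewrite ffact_prod natr_prod -prodf_div.
apply: eq_bigr => i _; rewrite natrB; last by rewrite ltnW// (ltn_trans _ kn).
by field; rewrite pnatr_eq0 -lt0n (leq_ltn_trans _ kn).
Unshelve. all: by end_near. Qed.

Context (d : nat -> measure_display) (T : forall n, measurableType (d n)).
Unset Implicit Arguments.
Variables (P : forall n, probability (T n) R) (X : forall n, T n -> 'M[nat]_n).
Set Implicit Arguments.
Variable W : R -> R -> nat -> R.
Hypothesis X_random : forall n, (0 < n)%N -> random_adjmx (X n).
Hypothesis X_stationary : forall n, (0 < n)%N -> edge_stationary (P n) (X n).
Hypothesis X_cvg : cvg_in_probability P X W.

(** Homomorphism densities lie in [0, 1], so convergence in probability passes to means: the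
    deviation is at most [e / 2] off an event of small probability, and at most [1 + |g|] on it. *)
Lemma mean_density_cvg k (A : 'M[nat]_k) : (0 < k)%N -> adjmx A ->
  mean_density (P n) (X n) A @[n --> \oo] --> graphon_density A W.
Proof.
move=> k0 aA; set g := graphon_density A W.
apply/cvgrPdist_le => e e0.
have e2 : 0 < e / 2 by rewrite divr_gt0.
have C0 : 0 < 1 + `|g| by rewrite ltr_pwDl.
have := X_cvg k0 aA e2.
rewrite -/g => /fine_cvgP[_ /cvgrPdist_le/(_ (e / 2 / (1 + `|g|)))].
move=> /(_ (divr_gt0 e2 C0)) h; near=> n.
have n0 : (0 < n)%N by near: n; exact: nbhs_infty_gt.
have hn : `|0 - fine (P n [set w | e / 2 <= `|hom_density R A (X n w) - g|])| <=
  e / 2 / (1 + `|g|) by near: n.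
set S := [set w | e / 2 <= `|hom_density R A (X n w) - g|] in hn *.
have mS : measurable S.
  exact: (measurable_adjmx_preimage (X_random n0) [set B | e / 2 <= `|hom_density R A B - g|]).
have bh := bdm_hom_density R (X_random n0) A.
have hd01 (B : 'M[nat]_n) : 0 <= hom_density R A B <= 1.
  rewrite /hom_density; apply/andP; split.
    by rewrite divr_ge0 ?exprn_ge0//; apply: sumr_ge0.
  rewrite ler_pdivrMr ?exprn_gt0 ?ltr0n// mul1r.
  apply: (@le_trans _ _ (\sum_(phi : {ffun 'I_k -> 'I_n}) 1)).
    by apply: ler_sum => phi _; case: [forall _, _].
  by rewrite sumr_const card_ffun !card_ord -natrX.
rewrite distrC /mean_density -[in X in `|_ - X|](Ex_cst (P n) g).
rewrite -ExB; [|exact: bdm_integrable|exact/bdm_integrable/bdm_cst].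
have bd : bdm (fun w => hom_density R A (X n w) - g).
  by apply: bdmD => //; exact: bdm_cst.
apply: (le_trans (le_normr_Rintegral _ _)) => //; first exact: bdm_integrable.
have bS : bdm (\1_S : _ -> R).
  split; first exact: measurable_indic.
  by exists 1 => w; rewrite indicE; case: (_ \in _); rewrite ?normr1 ?normr0.
have bR : bdm (fun w => e / 2 + (1 + `|g|) * \1_S w).
  by apply: bdmD; [exact: bdm_cst|apply: bdmM => //; exact: bdm_cst].
apply: (@le_trans _ _ (Ex (P n) (fun w => e / 2 + (1 + `|g|) * \1_S w))).
  apply: le_Ex; [exact/bdm_integrable/bdm_norm|exact: bdm_integrable|move=> w].
  have [wS|wS] := boolP (w \in S); rewrite indicE.
    rewrite wS mulr1; apply: (@le_trans _ _ (1 + `|g|)); last by rewrite lerDr ltW.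
    apply: le_trans (ler_normB _ _) _; rewrite lerD2r.
    by have /andP[? ?] := hd01 (X n w); rewrite ger0_norm.
  rewrite (negbTE wS) mulr0 addr0; move: wS; rewrite notin_setE /S /=.
  by move=> /negP; rewrite -ltNge => /ltW.
rewrite ExD; [|exact/bdm_integrable/bdm_cst|]; last first.
  by apply: bdm_integrable; apply: bdmM => //; exact: bdm_cst.
rewrite Ex_cst ExZl; last exact: bdm_integrable.
rewrite [leRHS](splitr e) lerD2l /Ex /Rintegral integral_indic// setIT.
rewrite mulrC -ler_pdivlMr//; move: hn; rewrite sub0r normrN ger0_norm//.
by rewrite fine_ge0.
Unshelve. all: by end_near. Qed.

Lemma graphon_density_switch k (A0 : 'M[nat]_k) (i j l m : 'I_k) : adjmx A0 ->
  [&& l != m, l != i, l != j, m != i & m != j] ->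
  let A := A0 + edgemx i j + edgemx l m in
  let A' := A0 + edgemx i l + edgemx j m in
  (A i j * A l m)%:R * graphon_density A W = (A' i l * A' j m)%:R * graphon_density A' W.
Proof.
move=> aA ne A A'.
have k0 : (0 < k)%N by case: k i {j l m A0 aA ne A A'} => [[]|].
have aE (B : 'M[nat]_k) (a b : 'I_k) : adjmx B -> adjmx (B + edgemx a b).
  move=> [sB eB]; split; first by apply: mxsymD => //; exact: mxsym_edgemx.
  move=> x; rewrite mxE -[_ + _]/(_ + _)%N oddD (negbTE (eB x)).
  by rewrite (negbTE (edgemx_even _ _ _)).
have aA1 : adjmx A := aE _ _ _ (aE _ _ _ aA).
have aA2 : adjmx A' := aE _ _ _ (aE _ _ _ aA).
have h1 := mean_density_cvg k0 aA1.
have h2 := mean_density_cvg k0 aA2.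
set c := (A i j * A l m)%:R; set c' := (A' i l * A' j m)%:R.
have h : c * mean_density (P n) (X n) A - c' * mean_density (P n) (X n) A' @[n --> \oo] -->
    c * graphon_density A W - c' * graphon_density A' W.
  by apply: cvgB; apply: cvgM => //; exact: cvg_cst.
suff h0 : c * mean_density (P n) (X n) A - c' * mean_density (P n) (X n) A' @[n --> \oo] -->
    (0 : R).
  by apply/eqP; rewrite -subr_eq0; apply/eqP; apply: (cvg_unique _ h h0).
apply/norm_cvg0P.
apply: (@squeeze_cvgr _ _ _ _ (fun=> 0) (fun n => (c + c') * (1 - (n ^_ k)%:R / n%:R ^+ k))).
- near=> n; rewrite normr_ge0 /=.
  have n0 : (0 < n)%N by near: n; exact: nbhs_infty_gt.
  exact: (@mean_density_switch _ _ _ (P n) n (X n) (X_random n0) (X_stationary n0) _ A0 i j l m n0 ne).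
- exact: cvg_cst.
- rewrite -[X in _ --> X](mulr0 (c + c')); apply: cvgM; first exact: cvg_cst.
  by rewrite -(subrr 1); apply: cvgB; [exact: cvg_cst|exact: ffact_ratio_cvg].
Unshelve. all: by end_near. Qed.

End SampleLimit.

(** * Uniform variables on the unit interval *)

Section UnitCube.
Context (R : realType).

Definition unif01 : probability (measurableTypeR R) R := uniform_prob (@ltr01 R).
Local Notation U := unif01.

Lemma integral_unif01 (f : R -> \bar R) : measurable_fun setT f -> (forall x, 0 <= f x)%E ->
  (\int[U]_x f x = \int[lebesgue_measure]_(x in `[0%R, 1%R]) f x)%E.
Proof. by move=> mf f0; rewrite integral_uniform// subr0 invr1 mul1e. Qed.

Definition in_cube k (x : k.-tuple R) := forall i, `[0, 1]%classic (tnth x i).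

(** Only [g] has to be measurable everywhere, since a multigraphon is controlled on the unit square
    alone. *)
Lemma cube_integralE k (f g : k.-tuple R -> \bar R) :
  measurable_fun setT g -> (forall x, 0 <= g x)%E ->
  (forall x, in_cube x -> f x = g x) ->
  (cube_integral f = \int[tuple_prob U k]_x g x)%E.
Proof.
elim: k f g => [|k IH] f g mg g0 fg.
  by rewrite integral_tuple_prob0 /= fg// => -[].
rewrite integral_tuple_probS// integral_unif01; last 2 first.
- exact: (@measurable_integral_tuple_prob _ _ _ U k g mg g0).
- by move=> x; exact: integral_ge0.
rewrite [LHS]/=; apply: eq_integral => x /set_mem x01.
apply: IH => [|//|t t01].
  by apply: measurableT_comp => //; exact: measurable_cons.
apply: fg => i; case: (unliftP ord0 i) => [j ->|->] //.
by rewrite tnthS; exact: t01.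
Qed.

Lemma unif01E (S : set R) : measurable S ->
  U S = lebesgue_measure (S `&` `[0, 1]%classic).
Proof.
move=> mS; rewrite -[in LHS](setIT S) -integral_indic// integral_unif01.
- by rewrite integral_indic// setIC.
- exact/measurable_EFinP/measurable_indic.
- by move=> x; rewrite lee_fin.
Qed.

Lemma unif01_set1 (x : R) : U [set x] = 0%E.
Proof.
rewrite unif01E//; apply: (@subset_measure0 _ _ _ lebesgue_measure _ [set x]) => //.
- by apply: measurableI.
- exact: lebesgue_measure_set1.
Qed.

Lemma unif01_outside : U [set x | ~~ (0 < x < 1)] = 0%E.
Proof.
have mS : measurable [set x : R | ~~ (0 < x < 1)].
  rewrite (_ : [set x | _] = ~` `]0, 1[%classic); first exact: measurableC.
  by apply/seteqP; split => x /=; rewrite in_itv/= => /negP.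
rewrite unif01E//; apply: (@subset_measure0 _ _ _ lebesgue_measure _ ([set 0] `|` [set 1])).
- exact: measurableI.
- exact: measurableU.
- move=> x [/= + ]; rewrite in_itv/= => /negP x01 /andP[x0 x1].
  have [->|xn0] := eqVneq x 0; first by left.
  have [->|xn1] := eqVneq x 1; first by right.
  by case: x01; rewrite lt_neqAle x0 eq_sym xn0 lt_neqAle xn1 x1.
- apply: countable_lebesgue_measure0; apply: finite_set_countable.
  by rewrite finite_setU; split; exact: finite_set1.
Qed.

Lemma Ex_indic (d : measure_display) (T : measurableType d) (P : probability T R) (S : set T) :
  measurable S -> Ex P (\1_S) = fine (P S).
Proof. by move=> mS; rewrite /Ex /Rintegral integral_indic// setIT. Qed.

Lemma bdm_indic (d : measure_display) (T : measurableType d) (S : set T) : measurable S ->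
  bdm (\1_S : T -> R).
Proof.
move=> mS; split; first exact: measurable_indic.
by exists 1 => w; rewrite indicE; case: (_ \in _); rewrite ?normr1 ?normr0.
Qed.

Lemma Ex_tnth k (f : R -> R) (i : 'I_k) : bdm (f : measurableTypeR R -> R) ->
  Ex (tuple_prob U k) (fun x => f (tnth x i)) = Ex U f.
Proof.
move=> bf; pose g (t : 'I_k) : measurableTypeR R -> R := if t == i then f else fun=> 1.
transitivity (Ex (tuple_prob U k) (fun z => \prod_t g t (tnth z t))).
  apply: eq_Ex => x; rewrite (bigD1 i)//= /g eqxx big1 ?mulr1// => t /negbTE ->.
  by [].
rewrite Ex_tuple_prod; last by move=> t; rewrite /g; case: ifP => // _; exact: bdm_cst.
rewrite (bigD1 i)//= /g eqxx big1 ?mulr1// => t /negbTE ->.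
exact: Ex_cst.
Qed.

Lemma bdm_eq_real (d : measure_display) (T : measurableType d) (f g : T -> R) :
  measurable_fun setT f -> measurable_fun setT g ->
  bdm (fun x => (f x == g x)%:R : R).
Proof.
move=> mf mg; split; last by exists 1 => x; case: eqP; rewrite ?normr1 ?normr0.
rewrite (_ : (fun x => _) = fun x => if f x == g x then 1 else 0); last first.
  by apply/funext => x; case: eqP.
by apply: measurable_fun_ifT => //; exact: measurable_fun_eqr.
Qed.

Lemma measurable_tnth_real k (i : 'I_k) :
  measurable_fun setT (fun x : k.-tuple (measurableTypeR R) => tnth x i : R).
Proof. exact: measurable_tnth. Qed.

Lemma Ex_eq_point (x : R) : Ex U (fun y => (x == y)%:R) = 0.
Proof.
rewrite -[RHS](congr1 fine (unif01_set1 x)) -Ex_indic//; apply: eq_Ex => y.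
rewrite indicE; congr (_%:R); case: eqP => [->|xy]; first by rewrite mem_set.
by rewrite memNset// => /esym.
Qed.

Lemma Ex_tnth_eq k (i j : 'I_k) : i != j ->
  Ex (tuple_prob U k) (fun x => (tnth x i == tnth x j)%:R) = 0.
Proof.
elim: k i j => [[]//|k IH] i j ij.
rewrite Ex_cons; last by apply: bdm_eq_real; exact: measurable_tnth_real.
rewrite -[RHS](Ex_cst U); apply: eq_Ex => x.
move: ij; case: (unliftP ord0 i) => [i' ->|->]; case: (unliftP ord0 j) => [j' ->|->].
- rewrite (inj_eq lift_inj) => ij'; rewrite -[RHS](IH i' j')//.
  by apply: eq_Ex => t; rewrite !tnthS.
- move=> _; rewrite -[RHS](Ex_eq_point x) -(Ex_tnth i'); last first.
    by apply: bdm_eq_real => //; exact: measurable_cst.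
  by apply: eq_Ex => t; rewrite tnthS eq_sym.
- move=> _; rewrite -[RHS](Ex_eq_point x) -(Ex_tnth j'); last first.
    by apply: bdm_eq_real => //; exact: measurable_cst.
  by apply: eq_Ex => t; rewrite tnthS.
- by rewrite eqxx.
Qed.

(** [bad1 + bad2] counts the coordinates in [S] and the coincidences between coordinates. It is at
    least 1 at every exceptional point and has mean 0, so a multiple of it dominates the
    difference. *)
Lemma Ex_eq_generic k (S : set R) (f g : k.-tuple R -> R) :
  measurable S -> U S = 0%E ->
  bdm (f : k.-tuple (measurableTypeR R) -> R) -> bdm (g : k.-tuple (measurableTypeR R) -> R) ->
  (forall x, (forall i, ~ S (tnth x i)) ->
    (forall i j, i != j -> tnth x i != tnth x j) -> f x = g x) ->
  Ex (tuple_prob U k) f = Ex (tuple_prob U k) g.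
Proof.
move=> mS US bf bg fg.
have bS : bdm (\1_S : measurableTypeR R -> R) by exact: bdm_indic.
pose bad1 (x : k.-tuple (measurableTypeR R)) : R := \sum_(i < k) \1_S (tnth x i).
pose bad2 (x : k.-tuple (measurableTypeR R)) : R :=
  \sum_(p : 'I_k * 'I_k | p.1 != p.2) (tnth x p.1 == tnth x p.2)%:R.
have be (p : 'I_k * 'I_k) : bdm (fun x : k.-tuple (measurableTypeR R) => (tnth x p.1 == tnth x p.2)%:R : R).
  by apply: bdm_eq_real; exact: measurable_tnth_real.
have b1 : bdm bad1 by apply: bdm_sum => i _; exact: (bdm_tnth i bS).
have b2 : bdm bad2 by apply: bdm_sum => p _.
have b12 : bdm (fun x => bad1 x + bad2 x) by exact: bdmD.
have E0 : Ex (tuple_prob U k) (fun x => bad1 x + bad2 x) = 0.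
  rewrite ExD; try exact: bdm_integrable.
  rewrite !Ex_sum; try by move=> *; apply: bdm_integrable; first [exact: be|exact: (bdm_tnth _ bS)].
  rewrite !big1 ?addr0// => [p pn|i _]; first exact: Ex_tnth_eq.
  by rewrite (Ex_tnth _ bS) Ex_indic// US.
have bd : bdm (fun x => f x - g x).
  by have := bdmD bf (bdmM (bdm_cst _ (-1)) bg); under eq_fun do rewrite mulN1r.
have [_ [C hC]] := bd.
apply/eqP; rewrite -subr_eq0 -ExB; try exact: bdm_integrable.
rewrite -normr_le0; apply: le_trans (le_normr_Rintegral _ _) _ => //.
  exact: bdm_integrable.
have bCb : bdm (fun x => C * (bad1 x + bad2 x)) by apply: bdmM => //; exact: bdm_cst.
have -> : 0 = Ex (tuple_prob U k) (fun x => C * (bad1 x + bad2 x)).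
  by rewrite ExZl ?E0 ?mulr0//; exact: bdm_integrable.
apply: le_Ex; [exact/bdm_integrable/bdm_norm|exact: bdm_integrable|move=> x].
have C0 : 0 <= C by apply: le_trans (hC x).
have bad10 : 0 <= bad1 x by apply: sumr_ge0.
have bad20 : 0 <= bad2 x by apply: sumr_ge0.
have [h|] := pselect ((forall i, ~ S (tnth x i)) /\
    (forall i j, i != j -> tnth x i != tnth x j)).
  by case: h => h1 h2; rewrite fg// subrr normr0 mulr_ge0// addr_ge0.
move=> /not_andP h; apply: le_trans (hC x) _; rewrite -[leLHS]mulr1 ler_wpM2l//.
case: h => [/existsNP[i /contrapT Si]|/existsNP[i /existsNP[j /not_implyP[ij /negP/negPn eij]]]].
  rewrite ler_wpDr// /bad1 (bigD1 i)//= indicE mem_set// lerDl; exact: sumr_ge0.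
rewrite ler_wpDl// /bad2 (bigD1 (i, j))//= eij lerDl; exact: sumr_ge0.
Qed.

Definition clamp01 (x : R) : R := Num.max 0 (Num.min 1 x).

Lemma clamp01_in x : `[0, 1]%classic (clamp01 x).
Proof.
rewrite /= in_itv/= /clamp01 le_max lexx ge_max ler01 ge_min lexx.
by [].
Qed.

Lemma clamp01_id x : `[0, 1]%classic x -> clamp01 x = x.
Proof. by rewrite /= in_itv/= => /andP[x0 x1]; rewrite /clamp01 min_r// max_r. Qed.

Lemma measurable_clamp01 : measurable_fun setT clamp01.
Proof. by apply: measurable_maxr => //; exact: measurable_minr. Qed.

(** An extension of [W] to the whole plane that leaves the unit square unchanged, so that the
    conditions on a multigraphon hold everywhere. *)
Definition clamped (W : R -> R -> nat -> R) (x y : R) (a : nat) : R :=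
  W (clamp01 x) (clamp01 y) a.

Section Clamped.
Variable W : R -> R -> nat -> R.
Hypothesis gW : multigraphon W.
Let V := clamped W.

Lemma measurable_clamped a :
  measurable_fun setT (fun p : measurableTypeR R * measurableTypeR R => V p.1 p.2 a).
Proof.
case: gW => mW _ _ _ _.
have := @measurable_comp _ _ _ (measurableTypeR R * measurableTypeR R)%type
  (R * R * nat)%type R _ _ setT
  (fun p => ((clamp01 p.1, clamp01 p.2), a)) _ _ mW.
apply.
- by do 2!apply: measurableX => //.
- move=> _ [p _ <-]; split => //=; split; exact: clamp01_in.
- apply: measurable_fun_pair => //; apply: measurable_fun_pair.
    by apply: measurableT_comp measurable_clamp01 _ => //; exact: measurable_fst.
  by apply: measurableT_comp measurable_clamp01 _ => //; exact: measurable_snd.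
Qed.

Lemma clamped_ge0 x y a : 0 <= V x y a.
Proof. by case: gW => _ + _ _ _ => /(_ _ _ a (clamp01_in x) (clamp01_in y))/andP[]. Qed.

Lemma clamped_le1 x y a : V x y a <= 1.
Proof. by case: gW => _ + _ _ _ => /(_ _ _ a (clamp01_in x) (clamp01_in y))/andP[]. Qed.

Lemma clamped_odd x a : odd a -> V x x a = 0.
Proof.
move=> oa; case: gW => _ _ _ _ /(_ _ a./2 (clamp01_in x)).
move=> <-; rewrite /V /clamped; congr (W _ _ _).
by rewrite mul2n addn1 -{1}(odd_double_half a) oa.
Qed.

Lemma mass_clamped_cvg x y : mass V N x y @[N --> \oo] --> (1 : R).
Proof.
case: gW => _ _ _ sW _; have s1 := sW _ _ (clamp01_in x) (clamp01_in y).
have h : (\sum_(0 <= k < N) (V x y k)%:E)%E @[N --> \oo] --> 1%E.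
  rewrite -s1; apply: is_cvg_nneseries => n _ _; rewrite lee_fin; exact: clamped_ge0.
have -> : (fun N => mass V N x y) = fine \o (fun N => \sum_(0 <= k < N) (V x y k)%:E)%E.
  by apply/funext => N /=; rewrite sumEFin /= big_mkord.
exact: fine_cvg h.
Qed.

Lemma graphon_densityE k (A : 'M[nat]_k) : graphon_density A W = density U V A.
Proof.
rewrite /graphon_density /density /Ex /Rintegral; congr fine.
apply: cube_integralE.
- apply/measurable_EFinP.
  by case: (bdm_pattern_prob measurable_clamped clamped_ge0 clamped_le1 A).
- by move=> x; rewrite lee_fin; apply: prodr_ge0 => p _; exact: clamped_ge0.
- move=> x x01; congr EFin; rewrite pair_big_dep/=; apply: eq_bigr => p _.
  by rewrite /V /clamped !clamp01_id//; exact: x01.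
Qed.

End Clamped.
End UnitCube.

(** * Degrees *)

Section DegreeReduction.
Context (R : realType).
Variable W : R -> R -> nat -> R.
Hypothesis gW : multigraphon W.
Hypothesis rho_fin : (0 < edge_density W < +oo)%E.
Local Notation U := (unif01 R).
Let V0 := clamped W.
Let mV0 := measurable_clamped gW.
Let V0_ge0 := clamped_ge0 gW.
Let V0_le1 := clamped_le1 gW.

Definition clamped_degree (x : R) : \bar R := graphon_degree W (clamp01 x).

Lemma edge_mean_EFin N x y :
  (\sum_(0 <= k < N) (k%:R * V0 x y k)%:E)%E = (edge_mean V0 N x y)%:E.
Proof. by rewrite sumEFin big_mkord. Qed.

Lemma edge_mean_ereal_cvg x y : ((edge_mean V0 N x y)%:E @[N --> \oo] -->
  \sum_(0 <= k <oo) (k%:R * V0 x y k)%:E)%E.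
Proof.
under eq_fun do rewrite -edge_mean_EFin.
by apply: is_cvg_nneseries => n _ _; rewrite lee_fin mulr_ge0// V0_ge0.
Qed.

Lemma bdm_trunc_deg0 N : bdm (trunc_deg U V0 N).
Proof. exact: (bdm_trunc_deg U mV0). Qed.

Lemma trunc_deg0_ge0 N x : 0 <= trunc_deg U V0 N x.
Proof. by apply: Ex_ge0 => y; exact: (edge_mean_ge0 V0_ge0). Qed.

Lemma trunc_deg0_nd x : nondecreasing_seq (fun N => trunc_deg U V0 N x).
Proof. by move=> m n; exact: (tdeg_nd U mV0 V0_ge0 V0_le1). Qed.

Lemma trunc_deg0_EFin N x :
  ((trunc_deg U V0 N x)%:E = \int[U]_y (edge_mean V0 N x y)%:E)%E.
Proof.
rewrite /trunc_deg /Ex /Rintegral fineK//; apply: integrable_fin_num => //.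
by apply: bdm_integrable; exact: (bdm_edge_mean1 mV0 V0_ge0 V0_le1).
Qed.

Lemma clamped_degree_cvg x :
  ((trunc_deg U V0 N x)%:E @[N --> \oo] --> clamped_degree x)%E.
Proof.
have mE N : measurable_fun setT (fun y : measurableTypeR R => edge_mean V0 N x y).
  by case: (bdm_edge_mean1 mV0 V0_ge0 V0_le1 N x).
have -> : clamped_degree x = (\int[U]_y \sum_(0 <= k <oo) (k%:R * V0 x y k)%:E)%E.
  rewrite integral_unif01.
  - apply: eq_integral => y /set_mem y01; apply: eq_eseriesr => k _.
    by rewrite /V0 /clamped (clamp01_id y01).
  - apply: (emeasurable_fun_cvg (fun N y => (edge_mean V0 N x y)%:E)) => [N|y _].
      by apply/measurable_EFinP; exact: mE.
    exact: edge_mean_ereal_cvg.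
  - by move=> y; apply: nneseries_ge0 => n _ _; rewrite lee_fin mulr_ge0// V0_ge0.
under eq_fun do rewrite trunc_deg0_EFin.
rewrite (_ : (\int[U]_y _)%E = (\int[U]_y limn (fun N => (edge_mean V0 N x y)%:E))%E).
  apply: cvg_monotone_convergence => //.
  - by move=> N; apply/measurable_EFinP; exact: mE.
  - by move=> N y _; rewrite lee_fin; exact: (edge_mean_ge0 V0_ge0).
  - by move=> y _ m n mn; rewrite lee_fin; exact: (edge_mean_nd V0_ge0).
apply: eq_integral => y _; apply/esym/cvg_lim => //.
exact: edge_mean_ereal_cvg.
Qed.

Lemma measurable_clamped_degree :
  measurable_fun setT (clamped_degree : measurableTypeR R -> \bar R).
Proof.
apply: (emeasurable_fun_cvg (fun N x => (trunc_deg U V0 N x)%:E)) => [N|x _].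
  by apply/measurable_EFinP; case: (bdm_trunc_deg0 N).
exact: clamped_degree_cvg.
Qed.

Lemma clamped_degree_ge0 x : (0 <= clamped_degree x)%E.
Proof.
rewrite -(cvg_lim _ (@clamped_degree_cvg x))//; apply: lime_ge.
  exact: cvgP (@clamped_degree_cvg x).
by apply: nearW => N; rewrite lee_fin trunc_deg0_ge0.
Qed.

Lemma integral_clamped_degree : (\int[U]_x clamped_degree x = edge_density W)%E.
Proof.
rewrite integral_unif01.
- by apply: eq_integral => x /set_mem x01; rewrite /clamped_degree (clamp01_id x01).
- exact: measurable_clamped_degree.
- exact: clamped_degree_ge0.
Qed.

Let rho := fine (edge_density W).

Lemma rhoK : edge_density W = rho%:E.
Proof.
case/andP: rho_fin => r0 r1; rewrite /rho fineK// ge0_fin_numE//; exact: ltW.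
Qed.

Lemma rho_gt0 : 0 < rho.
Proof. by case/andP: rho_fin => + _; rewrite rhoK lte_fin. Qed.

Lemma trunc_rho_cvg : Ex U (trunc_deg U V0 N) @[N --> \oo] --> rho.
Proof.
have h : (\int[U]_x (trunc_deg U V0 N x)%:E @[N --> \oo] --> \int[U]_x clamped_degree x)%E.
  rewrite (_ : (\int[U]_x clamped_degree x)%E =
    (\int[U]_x limn (fun N => (trunc_deg U V0 N x)%:E))%E); last first.
    apply: eq_integral => x _; apply/esym/cvg_lim => //; exact: clamped_degree_cvg.
  apply: cvg_monotone_convergence => //.
  - by move=> N; apply/measurable_EFinP; case: (bdm_trunc_deg0 N).
  - by move=> N x _; rewrite lee_fin trunc_deg0_ge0.
  - by move=> x _ m n mn; rewrite lee_fin trunc_deg0_nd.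
rewrite integral_clamped_degree rhoK in h.
exact: fine_cvg h.
Qed.

Definition infinite_degree : set R := [set x | clamped_degree x = +oo%E].
Let Z := infinite_degree.

Lemma measurable_infinite_degree : measurable (Z : set (measurableTypeR R)).
Proof.
have := measurable_clamped_degree measurableT (emeasurable_set1 +oo%E).
by rewrite setTI.
Qed.

Lemma infinite_degree_null : U Z = 0%E.
Proof.
have int_deg : U.-integrable setT clamped_degree.
  apply/integrableP; split; first exact: measurable_clamped_degree.
  under eq_integral do rewrite gee0_abs ?clamped_degree_ge0//.
  by rewrite integral_clamped_degree; case/andP: rho_fin.
have [N [mN N0 sN]] := integrable_ae measurableT int_deg.
apply: (@subset_measure0 _ _ _ U _ _ measurable_infinite_degree mN _ N0) => x Zx.
by apply: sN => /= /(_ Logic.I); rewrite Zx.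
Qed.

Definition finite_degree (x : R) : R := \1_(~` Z) x.
Let g := finite_degree.

Lemma finite_degreeZ x : Z x -> g x = 0.
Proof. by move=> Zx; rewrite /g /finite_degree indicE memNset. Qed.

Lemma finite_degreeNZ x : ~ Z x -> g x = 1.
Proof. by move=> Zx; rewrite /g /finite_degree indicE mem_set. Qed.

Lemma bdm_finite_degree : bdm (g : measurableTypeR R -> R).
Proof.
by apply: bdm_indic; apply: measurableC; exact: measurable_infinite_degree.
Qed.

(* Vertices of infinite degree are made isolated; they form a null set. *)
Definition finite_graphon (x y : R) (a : nat) : R :=
  g x * g y * V0 x y a + (1 - g x * g y) * (a == 0%N)%:R.
Let V := finite_graphon.

Lemma finite_graphonE x y a : ~ Z x -> ~ Z y -> V x y a = V0 x y a.
Proof. by move=> zx zy; rewrite /V /finite_graphon !finite_degreeNZ//; ring. Qed.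

Lemma finite_graphonZ x y a : Z x \/ Z y -> V x y a = (a == 0%N)%:R.
Proof. by move=> [] z; rewrite /V /finite_graphon (finite_degreeZ z); ring. Qed.

Lemma measurable_finite_graphon a :
  measurable_fun setT (fun p : measurableTypeR R * measurableTypeR R => V p.1 p.2 a).
Proof.
have mg : measurable_fun setT (g : measurableTypeR R -> R) by case: bdm_finite_degree.
have mgg : measurable_fun setT (fun p : measurableTypeR R * measurableTypeR R => g p.1 * g p.2).
  by apply: measurable_funM; apply: (measurableT_comp mg).
apply: measurable_funD; first by apply: measurable_funM => //; exact: mV0.
by apply: measurable_funM => //; exact: measurable_funB.
Qed.

Lemma finite_graphon01 x y a : 0 <= V x y a <= 1.
Proof.
have [z|] := pselect (Z x \/ Z y); first by rewrite finite_graphonZ//; case: eqP; rewrite ?lexx ler01.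
by move=> /not_orP[zx zy]; rewrite finite_graphonE// V0_ge0 V0_le1.
Qed.

Lemma finite_graphon_odd x a : odd a -> V x x a = 0.
Proof.
move=> oa; have [z|z] := pselect (Z x).
  by rewrite finite_graphonZ; [case: a oa|left].
by rewrite finite_graphonE//; exact: (clamped_odd gW).
Qed.

Lemma finite_graphon_mass x y : mass V N x y @[N --> \oo] --> (1 : R).
Proof.
have [z|] := pselect (Z x \/ Z y).
  rewrite -(cvg_shiftS (fun N => mass V N x y)).
  rewrite (_ : (fun n => _) = fun=> 1); first exact: cvg_cst.
  apply/funext => N; rewrite /mass big_ord_recl finite_graphonZ//= big1 ?addr0// => c _.
  by rewrite finite_graphonZ.
move=> /not_orP[zx zy]; rewrite (_ : (fun n => mass V n x y) = fun n => mass V0 n x y).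
  exact: (mass_clamped_cvg gW).
by apply/funext => N; apply: eq_bigr => c _; exact: finite_graphonE.
Qed.

(** The correction made in [finite_graphon] sits at multiplicity 0, which a mean ignores. *)
Lemma edge_mean_finite N x y : edge_mean V N x y = g x * g y * edge_mean V0 N x y.
Proof.
rewrite /edge_mean mulr_sumr; apply: eq_bigr => c _.
rewrite /V /finite_graphon; case: eqP => [->|_]; first by rewrite !mul0r mulr0.
by rewrite mulr0 addr0 mulrCA.
Qed.

Lemma Ex_off_infinite (f f' : measurableTypeR R -> R) : bdm f -> bdm f' ->
  (forall x, ~ Z x -> f x = f' x) -> Ex U f = Ex U f'.
Proof.
move=> bf bf' ff'; rewrite -(Ex_tnth (ord0 : 'I_1) bf) -(Ex_tnth (ord0 : 'I_1) bf').
apply: (Ex_eq_generic measurable_infinite_degree infinite_degree_null).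
- exact: bdm_tnth.
- exact: bdm_tnth.
- by move=> x Zx _; exact/ff'/Zx.
Qed.

Lemma trunc_deg_finite N x : trunc_deg U V N x = g x * trunc_deg U V0 N x.
Proof.
have b0 := bdm_edge_mean1 mV0 V0_ge0 V0_le1 N x.
have b1 : bdm (fun y : measurableTypeR R => g y * edge_mean V0 N x y).
  by apply: bdmM => //; exact: bdm_finite_degree.
transitivity (g x * Ex U (fun y => g y * edge_mean V0 N x y)).
  rewrite -ExZl; last exact: bdm_integrable.
  by apply: eq_Ex => y; rewrite mulrA; exact: edge_mean_finite.
congr (_ * _); apply: Ex_off_infinite => // y zy.
by rewrite finite_degreeNZ// mul1r.
Qed.

Definition real_degree (x : R) : R := g x * fine (clamped_degree x).
Let deg := real_degree.

Lemma real_degree_cvg x : trunc_deg U V N x @[N --> \oo] --> deg x.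
Proof.
under eq_fun do rewrite trunc_deg_finite.
have [z|z] := pselect (Z x).
  rewrite /deg /real_degree finite_degreeZ// mul0r.
  by under eq_fun do rewrite mul0r; exact: cvg_cst.
apply: cvgM; first exact: cvg_cst.
have fd : clamped_degree x \is a fin_num.
  by rewrite ge0_fin_numE ?clamped_degree_ge0// lt_neqAle leey andbT; exact/eqP.
have := @clamped_degree_cvg x; rewrite -(fineK fd).
exact: fine_cvg.
Qed.

Lemma trunc_rho_finite_cvg : Ex U (trunc_deg U V N) @[N --> \oo] --> rho.
Proof.
rewrite (_ : (fun N => _) = fun N => Ex U (trunc_deg U V0 N)); first exact: trunc_rho_cvg.
apply/funext => N; apply: Ex_off_infinite.
- apply: bdm_trunc_deg => [|x y a|x y a]; first exact: measurable_finite_graphon.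
    by case/andP: (finite_graphon01 x y a).
  by case/andP: (finite_graphon01 x y a).
- exact: bdm_trunc_deg0.
- by move=> x zx; rewrite trunc_deg_finite finite_degreeNZ// mul1r.
Qed.

Let mV := measurable_finite_graphon.
Let V_ge0 x y a : 0 <= V x y a. Proof. by case/andP: (finite_graphon01 x y a). Qed.
Let V_le1 x y a : V x y a <= 1. Proof. by case/andP: (finite_graphon01 x y a). Qed.

Lemma density_finite k (A : 'M[nat]_k) : density U V A = graphon_density A W.
Proof.
rewrite (graphon_densityE gW).
apply: (Ex_eq_generic measurable_infinite_degree infinite_degree_null).
- exact: bdm_pattern_prob.
- exact: bdm_pattern_prob.
- move=> x zx _; apply: eq_bigr => p _; exact: finite_graphonE.
Qed.

Theorem graphon_density_poisson :
  (forall k (A : 'M[nat]_k) (i j l m : 'I_k), adjmx A ->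
    [&& l != m, l != i, l != j, m != i & m != j] ->
    ((A + edgemx i j + edgemx l m)%R i j * (A + edgemx i j + edgemx l m)%R l m)%:R
      * graphon_density (A + edgemx i j + edgemx l m) W =
    ((A + edgemx i l + edgemx j m)%R i l * (A + edgemx i l + edgemx j m)%R j m)%:R
      * graphon_density (A + edgemx i l + edgemx j m) W) ->
  forall k (A : 'M[nat]_k), adjmx A ->
  graphon_density A W = Ex (tuple_prob U k) (fun x =>
    poisson_prod rho A (fun a => deg (tnth x a)) *
    expR (- total_rate rho (fun a => deg (tnth x a)))).
Proof.
move=> sw k A aA; rewrite -density_finite.
apply: (density_poisson mV V_ge0 V_le1 finite_graphon_odd finite_graphon_mass) => //.
- by move=> k' A' i j l m aA' ne; rewrite !density_finite; exact: sw.
- exact: real_degree_cvg.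
- exact: trunc_rho_finite_cvg.
- exact: rho_gt0.
Qed.

End DegreeReduction.

(** * Quantiles *)

Section Equimeasurable.
Context (d d' : measure_display) (S : measurableType d) (T : measurableType d') (R : realType).
Variables (U : probability S R) (f g : S -> T).
Hypotheses (mf : measurable_fun setT f) (mg : measurable_fun setT g).
Hypothesis fg : forall A, measurable A -> U (f @^-1` A) = U (g @^-1` A).

Lemma Ex_equimeasurable h : bdm h -> Ex U (h \o f) = Ex U (h \o g).
Proof.
move=> bh.
pose Xf : {RV U >-> T} := HB.pack f (isMeasurableFun.Build _ _ _ _ f mf).
pose Xg : {RV U >-> T} := HB.pack g (isMeasurableFun.Build _ _ _ _ g mg).
rewrite -[LHS](Ex_distribution Xf bh) -[RHS](Ex_distribution Xg bh).
rewrite /Ex /Rintegral; congr fine; apply: eq_measure_integral => A mA _.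
exact: fg.
Qed.

Lemma measurable_map_tuple k (e : S -> T) : measurable_fun setT e ->
  measurable_fun setT (fun x : k.-tuple S => map_tuple e x).
Proof.
move=> me; apply/measurable_fun_tnthP => i.
rewrite (_ : _ \o _ = e \o (fun x : k.-tuple _ => tnth x i)).
  by apply: measurableT_comp => //; exact: measurable_tnth.
by apply/funext => x /=; rewrite tnth_map.
Qed.

(** The tail is replaced by induction with the head fixed, then the head through [h'], the mean over
    the tail. *)
Lemma Ex_tuple_equimeasurable k (h : k.-tuple T -> R) : bdm h ->
  Ex (tuple_prob U k) (fun x => h (map_tuple f x)) =
  Ex (tuple_prob U k) (fun x => h (map_tuple g x)).
Proof.
elim: k h => [|k IH] h bh.
  by apply: eq_Ex => x; congr h; rewrite (tuple0 (map_tuple f x)) (tuple0 (map_tuple g x)).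
have bf := bdm_comp bh (@measurable_map_tuple k.+1 _ mf).
have bg := bdm_comp bh (@measurable_map_tuple k.+1 _ mg).
rewrite (Ex_cons U bf) (Ex_cons U bg).
pose h' (y : T) := Ex (tuple_prob U k) (fun t => h [tuple of y :: map_tuple g t]).
transitivity (Ex U (h' \o f)).
  apply: eq_Ex => x; have /IH E : bdm (fun t : k.-tuple T => h [tuple of f x :: t]).
    by apply: (bdm_comp bh); exact: measurable_cons.
  by rewrite /h' -[RHS]E; apply: eq_Ex => t; congr h; exact: val_inj.
transitivity (Ex U (h' \o g)); last first.
  by apply: eq_Ex => x; apply: eq_Ex => t; congr h; exact: val_inj.
apply: Ex_equimeasurable.
have bh' : bdm (fun p : T * k.-tuple S => h [tuple of p.1 :: map_tuple g p.2]).
  apply: (bdm_comp bh (g := fun p : T * k.-tuple S => [tuple of p.1 :: map_tuple g p.2])).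
  apply: measurable_cons => //.
  by apply: (measurableT_comp (@measurable_map_tuple k _ mg)).
(* [bdm_Ex2] asks for a probability on the first factor; any one serves. *)
by have := bdm_Ex2 (dirac point) (tuple_prob U k) bh'; apply.
Qed.

End Equimeasurable.

(** Open right rays are stable under intersection, exhaust the line and generate its Borel sets, so
    they determine a law. *)
Lemma preimage_ray_equimeasurable (d : measure_display) (S : measurableType d) (R : realType)
  (U : probability S R) (f g : S -> measurableTypeR R) :
  measurable_fun setT f -> measurable_fun setT g ->
  (forall z, U (f @^-1` `]z, +oo[%classic) = U (g @^-1` `]z, +oo[%classic)) ->
  forall A, measurable A -> U (f @^-1` A) = U (g @^-1` A).
Proof.
move=> mf mg fg A mA.
pose Xf : {RV U >-> measurableTypeR R} := HB.pack f (isMeasurableFun.Build _ _ _ (measurableTypeR R) f mf).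
pose Xg : {RV U >-> measurableTypeR R} := HB.pack g (isMeasurableFun.Build _ _ _ (measurableTypeR R) g mg).
rewrite -[LHS]/(distribution U Xf A) -[RHS]/(distribution U Xg A).
apply: (@measure_unique _ R (measurableTypeR R) (@RGenOInfty.G R)
  (fun n => `](- n%:R)%R, +oo[%classic) _ _ _ _ (distribution U Xf) (distribution U Xg) _ _ A mA).
- exact: RGenOInfty.measurableE.
- move=> _ _ [a ->] [b ->]; exists (Num.max a b); apply/seteqP; split => x /=;
    rewrite !in_itv/= !andbT gt_max; [by case=> -> ->|by move/andP].
- by move=> n; exists (- n%:R).
- apply/seteqP; split => // x _; exists (Num.bound `|x|) => //=.
  rewrite in_itv/= andbT ltrNl; apply: le_lt_trans (ler_norm _) _; rewrite normrN.
  by apply: archi_boundP.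
- by move=> _ [z ->]; exact: fg.
- by move=> n; apply: le_lt_trans (probability_le1 _ _) _; rewrite ?ltry.
Qed.

Section Quantile.
Context (R : realType).
Variable W : R -> R -> nat -> R.
Hypothesis gW : multigraphon W.
Hypothesis rho_fin : (0 < edge_density W < +oo)%E.
Local Notation U := (unif01 R).
Local Notation deg := (real_degree W).
Local Notation F := (degree_cdf W).
Local Notation Q := (degree_quantile W).

Lemma real_degree_ge0 x : 0 <= deg x.
Proof.
have fin0 : 0 <= finite_degree W x by rewrite /finite_degree indicE.
by rewrite mulr_ge0// fine_ge0// clamped_degree_ge0.
Qed.

Lemma measurable_real_degree : measurable_fun setT (deg : measurableTypeR R -> measurableTypeR R).
Proof.
apply: measurable_funM; first by case: (bdm_finite_degree gW).
by apply: measurableT_comp => //; exact: measurable_clamped_degree.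
Qed.

Lemma measurable_degree_ray z :
  measurable (deg @^-1` `]-oo, z]%classic : set (measurableTypeR R)).
Proof. by rewrite -[X in measurable X]setTI; apply: measurable_real_degree. Qed.

(** [deg] differs from the degree only on the null set of infinite degrees; hence [F] is a genuine
    distribution function. *)
Lemma degree_cdfE z : ((F z)%:E = U (deg @^-1` `]-oo, z]%classic))%E.
Proof.
have indE (A B : set R) x : (A x <-> B x) -> \1_A x = \1_B x :> R.
  by move=> AB; rewrite !indicE; congr (_%:R); congr nat_of_bool; apply/idP/idP => /set_mem /AB; exact: mem_set.
have mS : measurable [set x : measurableTypeR R | (clamped_degree W x <= z%:E)%E].
  rewrite -[X in measurable X]setTI.
  exact: (emeasurable_fun_infty_c measurableT (measurable_clamped_degree gW) z%:E).
have mD := measurable_degree_ray z.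
rewrite -[RHS]fineK ?fin_num_measure//; congr EFin; rewrite -Ex_indic//.
transitivity (Ex U \1_[set x | (clamped_degree W x <= z%:E)%E]).
  rewrite /degree_cdf /Ex /Rintegral; congr fine.
  rewrite integral_unif01.
  - apply: eq_integral => x /set_mem x01; congr (_%:E).
    by apply: indE; rewrite /= /clamped_degree clamp01_id.
  - exact/measurable_EFinP/measurable_indic.
  - by move=> x; rewrite lee_fin.
apply: (Ex_off_infinite gW rho_fin); try exact: bdm_indic.
move=> x zx; apply: indE; rewrite /= in_itv/= /real_degree finite_degreeNZ// mul1r.
rewrite -lee_fin fineK// ge0_fin_numE ?clamped_degree_ge0// lt_neqAle leey andbT.
exact/eqP.
Qed.

Lemma degree_cdf_nd : {homo F : x y / x <= y}.
Proof.
move=> x y xy; rewrite -lee_fin !degree_cdfE; apply: le_measure.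
- by rewrite in_setE; exact: measurable_degree_ray.
- by rewrite in_setE; exact: measurable_degree_ray.
- by move=> t /=; rewrite !in_itv/= => /le_trans; apply.
Qed.

Lemma degree_cdf_cvg :
  F z @[z --> +oo] --> (1 : R) /\ forall z, F y @[y --> z^'+] --> F z.
Proof.
pose X : {RV U >-> R} := HB.pack deg
  (@isMeasurableFun.Build _ _ (measurableTypeR R) R deg measurable_real_degree).
have FE z : (F z)%:E = cdf X z by rewrite degree_cdfE.
have FE' : F = fine \o cdf X by apply/funext => z; exact: (congr1 fine (FE z)).
split=> [|z].
  by rewrite FE'; apply: fine_cvg; exact: cvg_cdfy1.
have h : cdf X y @[y --> z^'+] --> cdf X z by exact: (@cdf_right_continuous _ _ _ _ X).
by rewrite -FE in h; rewrite {1}FE'; exact: fine_cvg h.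
Qed.

(** The minimum exists, so the default value of [set_min] is not taken: the set is nonempty as [F]
    tends to 1, bounded below by 0, and contains its infimum by right continuity of [F]. *)
Lemma quantile_spec u : 0 < u < 1 ->
  u <= F (Q u) /\ forall z, 0 <= z -> u <= F z -> Q u <= z.
Proof.
move=> /andP[u0 u1]; have [F1 Fr] := degree_cdf_cvg.
set A := [set z | 0 <= z /\ u <= F z].
have A0 : A !=set0.
  have [z [uz z0]] : exists z, u <= F z /\ 0 <= z.
    near (@pinfty_nbhs R) => z; exists z; split; near: z; last exact: nbhs_pinfty_ge.
    by apply: (cvgr_ge _ F1).
  by exists z.
have lA : has_lbound A by exists 0 => z [].
have Am : A (inf A).
  split; first by apply: lb_le_inf => // z [].
  apply: (@cvgr_to_ge _ _ (at_right_proper_filter (inf A)) _ _ _ _ (Fr (inf A))).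
  near=> z.
  have [y [y0 uy] yz] : exists2 y, A y & y < z by apply: inf_lt => //; near: z; exact: nbhs_right_gt.
  by apply: le_trans uy _; apply: degree_cdf_nd; exact: ltW.
have := @xgetPex _ 0 [set z | A z /\ lbound A z].
rewrite -[xget _ _]/(Q u); case.
  by exists (inf A); split => //; exact: ge_inf.
by move=> [_ uQ] lQ; split => // z z0 uz; apply: lQ.
Unshelve. all: by end_near. Qed.

Lemma quantile_ge0 u : 0 <= Q u.
Proof. by rewrite /degree_quantile /set_min; case: xgetP => // y _ [[]]. Qed.

Lemma quantile_le u z : 0 < u < 1 -> 0 <= z -> (Q u <= z) = (u <= F z).
Proof.
move=> /quantile_spec[uQ Qle] z0; apply/idP/idP => [Qz|]; last exact: Qle.
by apply: le_trans uQ _; exact: degree_cdf_nd.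
Qed.

(** The value 0 outside the open interval makes the preimage of every ray an interval or the whole
    line. *)
Definition inner_quantile (x : R) : R := if 0 < x < 1 then Q x else 0.
Local Notation q := inner_quantile.

Lemma inner_quantile_ray z : q @^-1` `]z, +oo[%classic =
  if z < 0 then setT else `](F z), 1[%classic.
Proof.
have F0 : 0 <= F z by rewrite -lee_fin degree_cdfE.
have [z0|z0] := ltP z 0; apply/seteqP; split => x //=;
  rewrite !in_itv/= andbT /inner_quantile.
- by move=> _; apply: lt_le_trans z0 _; case: (0 < x < 1) => //; exact: quantile_ge0.
- case: (boolP (0 < x < 1)) => x01; last by rewrite ltNge z0.
  by rewrite ltNge quantile_le// -ltNge => ->; case/andP: x01.
- move=> /andP[Fx x1]; have x01 : 0 < x < 1 by rewrite x1 (le_lt_trans F0).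
  by rewrite x01 ltNge quantile_le// -ltNge.
Qed.

Lemma measurable_inner_quantile : measurable_fun setT (q : measurableTypeR R -> measurableTypeR R).
Proof.
apply: (measurability (@RGenOInfty.G R)); first exact: RGenOInfty.measurableE.
move=> _ [_ [z ->] <-]; rewrite setTI inner_quantile_ray.
by case: (z < 0); [exact: measurableT|exact: measurable_itv].
Qed.

(** For nonnegative [z], both functions exceed [z] with probability [1 - F z], which for the
    quantile is the length of the interval from [F z] to 1. *)
Lemma degree_quantile_equimeasurable A : measurable (A : set (measurableTypeR R)) ->
  U (deg @^-1` A) = U (q @^-1` A).
Proof.
apply: preimage_ray_equimeasurable; first exact: measurable_real_degree.
  exact: measurable_inner_quantile.
move=> z; rewrite inner_quantile_ray; case: ltP => z0.
  congr (U _); apply/seteqP; split => // x _ /=.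
  by rewrite in_itv/= andbT; apply: lt_le_trans z0 _; exact: real_degree_ge0.
have F01 : 0 <= F z <= 1.
  apply/andP; split; rewrite -lee_fin degree_cdfE//.
  by apply: probability_le1; exact: measurable_degree_ray.
have -> : deg @^-1` `]z, +oo[%classic = ~` (deg @^-1` `]-oo, z]%classic).
  by apply/seteqP; split => x /=; rewrite !in_itv/= andbT ltNge => /negP.
rewrite probability_setC; last exact: measurable_degree_ray.
rewrite -degree_cdfE unif01E; last exact: measurable_itv.
rewrite setIidl; last first.
  move=> x /=; rewrite !in_itv/= => /andP[/ltW Fx /ltW ->]; rewrite andbT.
  by apply: le_trans Fx; case/andP: F01.
rewrite lebesgue_measure_itv/= lte_fin; case: ltP => // F1.
have -> : F z = 1 by apply/eqP; rewrite eq_le F1 andbT; case/andP: F01.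
by rewrite subee.
Qed.

(** * The multigraphon built from the quantile function *)

Let rho := fine (edge_density W).

Definition poisson_kernel (diag : bool) (l : R) (a : nat) : R :=
  poisson_coef diag l a * expR (- half_if diag l).

Lemma poisson_kernel_ge0 diag l a : 0 <= l -> 0 <= poisson_kernel diag l a.
Proof. by move=> l0; rewrite mulr_ge0 ?poisson_coef_ge0 ?expR_ge0. Qed.

Lemma poisson_kernel_le1 diag l a : 0 <= l -> poisson_kernel diag l a <= 1.
Proof.
move=> l0; rewrite /poisson_kernel expRN ler_pdivrMr ?expR_gt0// mul1r.
apply: le_trans (sum_poisson_coef_le diag a.+1 l0).
by rewrite big_ord_recr/= lerDr; apply: sumr_ge0 => b _; exact: poisson_coef_ge0.
Qed.

Lemma poisson_kernel_sum diag l : 0 <= l ->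
  (\sum_(0 <= a <oo) (poisson_kernel diag l a)%:E = 1)%E.
Proof.
move=> l0; apply/cvg_lim => //.
under eq_fun do rewrite sumEFin big_mkord -mulr_suml.
rewrite -(mulfV (lt0r_neq0 (expR_gt0 (half_if diag l)))) -expRN.
apply: cvg_EFin; first exact: nearW.
by apply: cvgM; [exact: sum_poisson_coef_cvg|exact: cvg_cst].
Qed.

Lemma measurable_poisson_kernel (d : measure_display) (T : measurableType d)
  (diag : bool) (l : T -> R) a : measurable_fun setT l ->
  measurable_fun setT (fun x => poisson_kernel diag (l x) a).
Proof.
move=> ml; rewrite /poisson_kernel /poisson_coef /half_if.
have mexp (h : T -> R) : measurable_fun setT h -> measurable_fun setT (fun x => expR (- h x)).
  by move=> mh; apply: measurableT_comp => //; exact: measurableT_comp.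
by case: diag; (apply: measurable_funM; last by apply: mexp; try exact: measurable_funM);
  repeat (apply: measurable_funM => //); apply: measurable_funX => //; exact: measurable_funM.
Qed.

Lemma poisson_prod_kernel k (A : 'M[nat]_k) (y : 'I_k -> R) :
  poisson_prod rho A y * expR (- total_rate rho y) =
  \prod_(p : 'I_k * 'I_k | (p.1 <= p.2)%N)
    poisson_kernel (p.1 == p.2) (pair_rate rho y p) (A p.1 p.2).
Proof.
by rewrite /total_rate -sumrN expR_sum -big_split.
Qed.

Lemma hat_graphonE x y a :
  hat_graphon W x y a = poisson_kernel (x == y) (Q x * Q y / rho) a.
Proof.
rewrite /hat_graphon /poisson_kernel /poisson_coef /poisson_weight /half_if -/rho.
case: (x == y) => /=; last by rewrite -mulrA mulrC.
have -> : Q x * Q y / (2 * rho) = Q x * Q y / rho / 2 by rewrite invfM mulrA mulrAC.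
by rewrite dvdn2 divn2 -[RHS]mulrA; congr (_ * _); rewrite -mulrA mulrC.
Qed.

Lemma clamped_hatE x y a : clamped (hat_graphon W) x y a =
  poisson_kernel (clamp01 x == clamp01 y) (Q (clamp01 x) * Q (clamp01 y) / rho) a.
Proof. exact: hat_graphonE. Qed.

Lemma hat_rate_ge0 x y : 0 <= Q x * Q y / rho.
Proof. by rewrite divr_ge0 ?mulr_ge0 ?quantile_ge0// ltW// rho_gt0. Qed.

Lemma measurable_clamped_quantile :
  measurable_fun setT (fun x : measurableTypeR R => Q (clamp01 x) : measurableTypeR R).
Proof.
rewrite (_ : (fun x => _) = fun x => if 0 < x then if x < 1 then q x else Q 1 else Q 0).
  apply: measurable_fun_ifT => //; first exact: measurable_fun_ltr.
  apply: measurable_fun_ifT => //; first exact: measurable_fun_ltr.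
  exact: measurable_inner_quantile.
apply/funext => x; rewrite /clamp01 /inner_quantile.
have [x0|x0] := ltP 0 x; last by rewrite max_l// ge_min x0 orbT.
have [x1|x1] := ltP x 1; first by rewrite ?min_r ?max_r ?ltW.
by rewrite ?min_l ?max_r.
Qed.

Lemma measurable_fun_prod_nat (d d' : measure_display) (T : measurableType d)
  (T' : measurableType d') (f : T * nat -> T') :
  (forall a, measurable_fun setT (fun x => f (x, a))) -> measurable_fun setT f.
Proof.
move=> mf _ Y mY; rewrite setTI.
rewrite (_ : f @^-1` Y = \bigcup_a (((fun x => f (x, a)) @^-1` Y) `*` [set a])).
  apply: bigcup_measurable => a _; apply: measurableX => //.
  by rewrite -[X in measurable X]setTI; apply: mf.
apply/seteqP; split => [[x a] fY|[x a] [b _ [/= fY ->]]] //.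
by exists a.
Qed.

Lemma hat_multigraphon : multigraphon (hat_graphon W).
Proof.
split.
- have mh : measurable_fun setT (fun p : measurableTypeR R * measurableTypeR R * nat =>
      clamped (hat_graphon W) p.1.1 p.1.2 p.2 : measurableTypeR R).
    apply: measurable_fun_prod_nat => a /=.
    rewrite (_ : (fun x => _) = fun x : measurableTypeR R * measurableTypeR R =>
      if clamp01 x.1 == clamp01 x.2 then
        poisson_kernel true (Q (clamp01 x.1) * Q (clamp01 x.2) / rho) a
      else poisson_kernel false (Q (clamp01 x.1) * Q (clamp01 x.2) / rho) a); last first.
      by apply/funext => x; rewrite clamped_hatE; case: (_ == _).
    have m1 : measurable_fun setT (fun x : measurableTypeR R * measurableTypeR R => Q (clamp01 x.1)).
      exact: (measurableT_comp measurable_clamped_quantile).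
    have m2 : measurable_fun setT (fun x : measurableTypeR R * measurableTypeR R => Q (clamp01 x.2)).
      exact: (measurableT_comp measurable_clamped_quantile).
    have ml : measurable_fun setT (fun x : measurableTypeR R * measurableTypeR R =>
        Q (clamp01 x.1) * Q (clamp01 x.2) / rho).
      by apply: measurable_funM => //; exact: measurable_funM.
    apply: measurable_fun_ifT; [|exact: measurable_poisson_kernel|exact: measurable_poisson_kernel].
    apply: measurable_fun_eqr.
      by apply: (measurableT_comp (@measurable_clamp01 R)).
    by apply: (measurableT_comp (@measurable_clamp01 R)).
  have mD : measurable (`[0 : R, 1]%classic `*` `[0 : R, 1]%classic `*` [set: nat]).
    by do 2!apply: measurableX => //.
  have : measurable_fun (`[0 : R, 1]%classic `*` `[0 : R, 1]%classic `*` [set: nat])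
      (fun p : R * R * nat => clamped (hat_graphon W) p.1.1 p.1.2 p.2).
    exact: (measurable_funS measurableT (@subsetT _ _) mh).
  apply: eq_measurable_fun => p /set_mem[[x01 y01] _].
  by rewrite /clamped !clamp01_id.
- move=> x y a _ _; rewrite hat_graphonE; have := hat_rate_ge0 x y => l0.
  by rewrite poisson_kernel_ge0// poisson_kernel_le1.
- by move=> x y a _ _; rewrite !hat_graphonE eq_sym [Q y * _]mulrC.
- move=> x y _ _; under eq_eseriesr do rewrite hat_graphonE.
  by apply: poisson_kernel_sum; exact: hat_rate_ge0.
- move=> x a _; rewrite hat_graphonE eqxx /poisson_kernel /poisson_coef.
  by rewrite addn1 /= mul2n odd_double/= !mul0r.
Qed.

(** The absolute values keep the rates nonnegative, hence the function bounded, on all real tuples;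
    on degrees and quantiles they change nothing. *)
Definition degree_density k (A : 'M[nat]_k) (y : k.-tuple R) : R :=
  \prod_(p : 'I_k * 'I_k | (p.1 <= p.2)%N)
    poisson_kernel (p.1 == p.2) (pair_rate rho (fun a => `|tnth y a|) p) (A p.1 p.2).

Lemma bdm_degree_density k (A : 'M[nat]_k) :
  bdm (degree_density A : k.-tuple (measurableTypeR R) -> R).
Proof.
apply: bdm_prod => p _; split.
  apply: measurable_poisson_kernel; apply: measurable_funM => //.
  by apply: measurable_funM; apply: measurableT_comp => //; exact: measurable_tnth_real.
exists 1 => y; have l0 : 0 <= pair_rate rho (fun a => `|tnth y a|) p.
  by apply: pair_rate_ge0 => //; exact: rho_gt0.
by rewrite ger0_norm ?poisson_kernel_ge0// poisson_kernel_le1.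
Qed.

(** At almost every point the coordinates are distinct and interior, so the diagonal formula of
    [hat_graphon] serves exactly the loops and no endpoint value of the quantile enters. *)
Lemma hat_density k (A : 'M[nat]_k) : graphon_density A (hat_graphon W) =
  Ex (tuple_prob U k) (fun x => degree_density A (map_tuple q x)).
Proof.
rewrite (graphon_densityE hat_multigraphon).
have mS : measurable [set x : R | ~~ (0 < x < 1)].
  rewrite (_ : [set x | _] = ~` `]0, 1[%classic); first exact: measurableC.
  by apply/seteqP; split => x /=; rewrite in_itv/= => /negP.
apply: (Ex_eq_generic mS (unif01_outside R)).
- have gH := hat_multigraphon.
  exact: (bdm_pattern_prob (measurable_clamped gH) (clamped_ge0 gH) (clamped_le1 gH)).
- apply: (bdm_comp (bdm_degree_density A)).
  by apply: measurable_map_tuple; exact: measurable_inner_quantile.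
move=> x x01 xinj; apply: eq_bigr => p _; rewrite clamped_hatE.
have xin i : 0 < tnth x i < 1 by apply/negPn/negP; exact: x01.
have xid i : clamp01 (tnth x i) = tnth x i.
  by apply: clamp01_id; rewrite /= in_itv/=; case/andP: (xin i) => /ltW -> /ltW ->.
rewrite !xid; congr poisson_kernel.
  apply/eqP/eqP => [e|->//]; apply/eqP; apply/negPn/negP => /xinj.
  by rewrite e eqxx.
by rewrite /pair_rate !tnth_map /inner_quantile !xin !ger0_norm ?quantile_ge0.
Qed.

Lemma degree_densityE k (A : 'M[nat]_k) (x : k.-tuple R) :
  degree_density A (map_tuple deg x) =
  poisson_prod rho A (fun a => deg (tnth x a)) *
  expR (- total_rate rho (fun a => deg (tnth x a))).
Proof.
rewrite poisson_prod_kernel; apply: eq_bigr => p _.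
by rewrite /pair_rate !tnth_map !ger0_norm ?real_degree_ge0.
Qed.

End Quantile.

Theorem theorem1 (R : realType) (W : R -> R -> nat -> R)
  (W_multigraphon : multigraphon W)
  (rho_fin : (0 < edge_density W < +oo)%E)
  (d : nat -> measure_display) (T : forall n, measurableType (d n))
  (P : forall n, probability (T n) R)
  (X : forall n, T n -> 'M[nat]_n)
  (X_random : forall n, (0 < n)%N -> random_adjmx (X n))
  (X_stationary : forall n, (0 < n)%N -> edge_stationary (P n) (X n))
  (X_cvg : cvg_in_probability P X W)
  (X_offdiag :
    ereal_sup [set ((('C(n, 2)%:R)^-1)%:E *
        \sum_(i < n) \sum_(j < n | (i < j)%N)
          'E_(P n)[fun w => ((X n w i j)%:R * (m <= X n w i j)%N%:R)%R])%E
      | n in [set n | (2 <= n)%N]] @[m --> \oo] --> 0%E)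
  (X_diag :
    ereal_sup [set (((n%:R)^-1)%:E *
        \sum_(i < n)
          'E_(P n)[fun w => ((X n w i i)%:R * (m <= X n w i i)%N%:R)%R])%E
      | n in [set n | (1 <= n)%N]] @[m --> \oo] --> 0%E) :
  multigraphon (hat_graphon W) /\ graphon_equiv (hat_graphon W) W.
Proof.
have sw k (A : 'M[nat]_k) (i j l m : 'I_k) (aA : adjmx A) :=
  graphon_density_switch X_random X_stationary X_cvg aA (i := i) (j := j) (l := l) (m := m).
split; first exact: hat_multigraphon.
move=> k A _ aA; rewrite (hat_density W_multigraphon rho_fin).
rewrite (graphon_density_poisson W_multigraphon rho_fin sw aA).
(* Both densities are means of the bounded function [degree_density A], evaluated at independent
   quantiles on one side and at independent degrees on the other. *)
rewrite -(Ex_tuple_equimeasurable _ _ (degree_quantile_equimeasurable W_multigraphon rho_fin)).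
- by apply: eq_Ex => x; rewrite degree_densityE.
- exact: measurable_real_degree.
- exact: measurable_inner_quantile.
- exact: bdm_degree_density.
Qed.
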